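(* Let $d\ge1$, let $\Lambda\subset\mathbb{R}^d$ be a lattice with dual lattice $\Lambda^*$ and co-volume $|\Lambda|$, and let $\mathcal{D}\subset\mathbb{R}^d$ be an open bounded set whose boundary has Lebesgue measure zero and such that $|\Lambda||\mathcal{D}|=1$. For $N\in\mathbb{N}$ let $\kappa_N(w)=1$ if $w\in\Lambda^*\cap N^{1/d}\mathcal{D}$ and $\kappa_N(w)=0$ for the other $w\in\Lambda^*$, and put $t_N=\sum_{w\in\Lambda^*}\kappa_N(w)$. Let $\omega=(x_1,\dots,x_{t_N})\in\Omega^{t_N}$ be $t_N$ points drawn from the determinantal process on the flat torus $\Omega=\mathbb{R}^d/\Lambda$ with kernel $$K_N(u,v)=\sum_{w\in\Lambda^*}\kappa_N(w)e^{2\pi i\langle u-v,w\rangle}.$$ Then, for every $0<s<d$, as $N\to\infty$, $$\mathbb{E}\big(E_{s,\Lambda}(\omega)\big)=\frac{2\pi^{d/2}|\Lambda|^{-1}}{\Gamma\left(\frac s2\right)(d-s)}\,t_N^2-\frac{\pi^{s-\frac d2}\,\Gamma\left(\frac{d-s}2\right)}{\Gamma\left(\frac s2\right)|\Lambda|}\,I_\nu^{\mathcal{D}}(d-s)\,t_N^{1+s/d}+o\big(t_N^{1+s/d}\big),$$ where $$I_\nu^{\mathcal{D}}(t)=\int_{\mathcal{D}\times\mathcal{D}}\frac1{|x-y|^t}\,d\nu(x)\,d\nu(y),\qquad 0<t<d,$$ and $\nu$ is the multiple of Lebesgue measure on $\mathbb{R}^d$ such that $\nu(\Omega^* )=1$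 for a fundamental domain $\Omega^*$ of $\Lambda^*$.
   Context: A lattice is $\Lambda=A\mathbb{Z}^d$ with $A$ a nonsingular real $d\times d$ matrix; its co-volume is $|\Lambda|=|\det A|$ and its dual lattice is $\Lambda^*=\{x\in\mathbb{R}^d:\langle x,\lambda\rangle\in\mathbb{Z}\ \ \forall\lambda\in\Lambda\}=(A^t)^{-1}\mathbb{Z}^d$. For a measurable set $\mathcal{D}\subset\mathbb{R}^d$, $|\mathcal{D}|$ is its Lebesgue measure. With $v_1,\dots,v_d$ the columns of $A$, the fundamental domain $\Omega=\{t_1v_1+\dots+t_dv_d:t_i\in[0,1)\}$ is identified with the flat torus $\mathbb{R}^d/\Lambda$, and $\mu$ is Lebesgue measure on $\Omega$ normalized so that $\mu(\Omega)=1$. For $0<s<d$ and $x\in\mathbb{R}^d\setminus\Lambda$ define $$F_{s,\Lambda}(x)=\sum_{v\in\Lambda}\int_1^{+\infty}e^{-|x+v|^2t}\frac{t^{\frac s2-1}}{\Gamma(\frac s2)}\,dt+\frac1{|\Lambda|}\sum_{w\in\Lambda^*\setminus\{0\}}e^{2\pi i\langle x,w\rangle}\int_0^1\frac{\pi^{d/2}}{t^{d/2}}e^{-\frac{\pi^2|w|^2}{t}}\frac{t^{\frac s2-1}}{\Gamma(\frac s2)}\,dt$$ (the formula gives $+\infty$ for $x\in\Lambda$). The periodic Riesz $s$-energy of $\omega=(x_1,\dots,x_n)$ is $E_{s,\Lambda}(\omega)=\sum_{k\ne j}F_{s,\Lambda}(x_k-x_j)$, the sum being over ordered pairs $k\neq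 j$. A determinantal process with kernel $K$ (with respect to $\mu$) is a simple point process whose joint intensities with respect to $\mu$ are $\rho_k(x_1,\dots,x_k)=\det(K(x_i,x_j))_{1\le i,j\le k}$ for all $k\geq 1$. The kernel $K_N$ is the kernel of an orthogonal projection in $L^2(\mu)$ of rank $t_N$, so the process has exactly $t_N$ points almost surely; as a random vector in $\Omega^{t_N}$, $\omega$ has density $\frac1{t_N!}\det(K_N(x_i,x_j))_{1\le i,j\le t_N}$ with respect to $\mu^{\otimes t_N}$. *)

(* Defs.v *)
(* MathComp-Analysis. *)
From HB Require Import structures.
From mathcomp Require Import all_boot all_order all_algebra complex.
From mathcomp Require Import all_classical all_reals all_analysis.
From mathcomp Require Import measurable_realfun.

Set Implicit Arguments.
Unset Strict Implicit.
Unset Printing Implicit Defensive.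

Import Order.TTheory GRing.Theory Num.Theory.
Import numFieldNormedType.Exports.

Local Open Scope classical_set_scope.
Local Open Scope ring_scope.

Section pushforward_sigma_finite.
Context d1 d2 (T1 : measurableType d1) (T2 : measurableType d2) (R : realType).
Variables (m : {measure set T1 -> \bar R}) (sm : sigma_finite setT m).
Variables (f : T1 -> T2) (g : T2 -> T1).
Hypotheses (mg : measurable_fun setT g).
Hypothesis fK : cancel f g.

Lemma pushforward_sigma_finite : sigma_finite setT (pushforward m f).
Proof.
have [F FT mF] := sm.
exists (fun n => g @^-1` F n).
  by rewrite -preimage_bigcup -FT preimage_setT.
move=> n; have [mFn Fnoo] := mF n; split.
  by rewrite -[X in measurable X]setTI; exact: mg.
rewrite /pushforward (_ : f @^-1` _ = F n)//.
by apply/seteqP; split => x /=; rewrite fK.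
Qed.

End pushforward_sigma_finite.

Lemma product_sigma_finite d1 d2 (T1 : measurableType d1)
    (T2 : measurableType d2) (R : realType)
    (m1 : {sigma_finite_measure set T1 -> \bar R})
    (m2 : {sigma_finite_measure set T2 -> \bar R}) :
  sigma_finite setT (m1 \x m2)%E.
Proof.
have /sigma_finiteP[F [TF ndF Foo]] := sigma_finiteT m1.
have /sigma_finiteP[G [TG ndG Goo]] := sigma_finiteT m2.
exists (fun n => F n `*` G n).
  rewrite -setXTT TF TG predeqE => -[x y]; split.
    move=> [/= [n _ Fnx] [k _ Gky]]; exists (maxn n k) => //; split.
    - by move: x Fnx; exact/subsetPset/ndF/leq_maxl.
    - by move: y Gky; exact/subsetPset/ndG/leq_maxr.
  by move=> [n _ []/= ? ?]; split; exists n.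
move=> k; have [? ?] := Foo k; have [? ?] := Goo k.
split; first exact: measurableX.
by rewrite product_measure1E// lte_mul_pinfty// ge0_fin_numE.
Qed.

Section tuple_measure.
Context d (T : measurableType d) (R : realType).

Definition tcons n (x : T * n.-tuple T) : n.+1.-tuple T := [tuple of x.1 :: x.2].

Lemma measurable_tcons n : measurable_fun setT (@tcons n).
Proof. by apply: measurable_cons. Qed.

Section step.
Variables (m : {sigma_finite_measure set T -> \bar R}) (n : nat).
Variable mn : {sigma_finite_measure set (n.-tuple T) -> \bar R}.

Definition cons_measure : set (n.+1.-tuple T) -> \bar R :=
  pushforward (m \x mn)%E (@tcons n).

Let cons_measure0 : cons_measure set0 = 0%E.
Proof. by rewrite /cons_measure /pushforward preimage_set0 measure0. Qed.

Let cons_measure_ge0 A : (0 <= cons_measure A)%E.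
Proof. by rewrite /cons_measure /pushforward. Qed.

Let cons_measure_sigma_additive : semi_sigma_additive cons_measure.
Proof.
pose M : {measure set (n.+1.-tuple T) -> \bar R} :=
  measure_function_pushforward__canonical__measure_function_Measure
    (m \x mn)%E (@measurable_tcons n).
exact: (@measure_semi_sigma_additive _ _ _ M).
Qed.

HB.instance Definition _ := isMeasure.Build _ _ _ cons_measure
  cons_measure0 cons_measure_ge0 cons_measure_sigma_additive.

Let cons_measure_sigma_finite : sigma_finite setT cons_measure.
Proof.
pose M : {measure set (T * n.-tuple T)%type -> \bar R} := (m \x mn)%E.
pose g (t : n.+1.-tuple T) := (thead t, [tuple of behead t]).
have mg : measurable_fun setT g.
  apply: measurable_fun_pair; first exact: measurable_tnth.
  exact: measurable_behead.
have gK : cancel (@tcons n) g.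
  by move=> [x t]; rewrite /g theadE; congr pair; exact/val_inj.
exact: (@pushforward_sigma_finite _ _ _ _ _ M (product_sigma_finite m mn)
  _ g mg gK).
Qed.

HB.instance Definition _ := Measure_isSigmaFinite.Build _ _ _ cons_measure
  cons_measure_sigma_finite.

End step.

(* the n-fold product measure m (x) ... (x) m *)
Fixpoint tuple_measure (m : {sigma_finite_measure set T -> \bar R}) (n : nat) :
    {sigma_finite_measure set (n.-tuple T) -> \bar R} :=
  match n with
  | 0%N => dirac [tuple]
  | n'.+1 => cons_measure m (tuple_measure m n')
  end.

End tuple_measure.

(* The sigma-algebra generated by the coordinates, i.e. the Borel one, as for
   [n.-tuple T] in the library. *)
Definition measure_cV_display : measure_display.
Proof. exact: measure_tuple_display default_measure_display. Qed.

Section cV_measurable.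
Context {R : realType} {d : nat}.

Let coor (i : 'I_d) (x : 'cV[R]_d) : R := x i 0.

Let cV_set0 : g_sigma_preimage coor set0.
Proof. exact: sigma_algebra0. Qed.

Let cV_setC A : g_sigma_preimage coor A -> g_sigma_preimage coor (~` A).
Proof. exact: sigma_algebraC. Qed.

Let cV_bigcup (F : _^nat) : (forall i, g_sigma_preimage coor (F i)) ->
  g_sigma_preimage coor (\bigcup_i (F i)).
Proof. exact: sigma_algebra_bigcup. Qed.

HB.instance Definition _ := @isMeasurable.Build measure_cV_display
  'cV[R]_d (g_sigma_preimage coor) cV_set0 cV_setC cV_bigcup.

Lemma measurable_coor (i : 'I_d) :
  measurable_fun setT (fun x : 'cV[R]_d => x i 0).
Proof.
move=> _ Y mY; rewrite setTI; apply: sub_sigma_algebra => /=.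
rewrite -bigcup_seq/=; exists i => /=; first by rewrite mem_index_enum.
by exists Y => //; rewrite setTI.
Qed.

Lemma measurable_cV d' (T : measurableType d') (f : T -> 'cV[R]_d) :
  (forall i, measurable_fun setT (fun t => f t i 0)) -> measurable_fun setT f.
Proof.
move=> mf _ A mA; rewrite setTI.
suff : (g_sigma_preimage (fun i => coor i \o f)) `<=` measurable.
  by apply; rewrite g_sigma_preimage_comp; exists A => //; rewrite setTI.
apply: smallest_sub; first exact: sigma_algebra_measurable.
rewrite -bigcup_seq; apply: bigcup_sub => i _ _ [B mB <-].
exact: mf.
Qed.

End cV_measurable.

Section euclidean_space.
Context {R : realType} {d : nat}.

Definition dotv (x y : 'cV[R]_d) : R := \sum_i x i 0 * y i 0.

(* The Euclidean norm; [`|x|] on ['cV[R]_d] is the sup norm. *)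
Definition enorm (x : 'cV[R]_d) : R := Num.sqrt (dotv x x).

Definition col_of_tuple (t : d.-tuple (measurableTypeR R)) : 'cV[R]_d :=
  \col_i tnth t i.

Let tuple_of_col (x : 'cV[R]_d) : d.-tuple (measurableTypeR R) :=
  [tuple x i 0 | i < d].

Lemma measurable_col_of_tuple : measurable_fun setT col_of_tuple.
Proof.
apply: measurable_cV => i.
rewrite (_ : (fun t => _) = (@tnth d (measurableTypeR R) ^~ i)).
  exact: measurable_tnth.
by apply/funext => t; rewrite mxE.
Qed.

Definition lebesgue_cV : set 'cV[R]_d -> \bar R :=
  pushforward (tuple_measure (@lebesgue_measure R) d) col_of_tuple.

Let leb : {measure set 'cV[R]_d -> \bar R} :=
  measure_function_pushforward__canonical__measure_function_Measure
    (tuple_measure (@lebesgue_measure R) d) measurable_col_of_tuple.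

Let lebesgue_cV0 : lebesgue_cV set0 = 0%E.
Proof. exact: (measure0 leb). Qed.

Let lebesgue_cV_ge0 A : (0 <= lebesgue_cV A)%E.
Proof. exact: (measure_ge0 leb). Qed.

Let lebesgue_cV_sigma_additive : semi_sigma_additive lebesgue_cV.
Proof. exact: (@measure_semi_sigma_additive _ _ _ leb). Qed.

HB.instance Definition _ := isMeasure.Build _ _ _ lebesgue_cV
  lebesgue_cV0 lebesgue_cV_ge0 lebesgue_cV_sigma_additive.

Let lebesgue_cV_sigma_finite : sigma_finite setT lebesgue_cV.
Proof.
apply: (@pushforward_sigma_finite _ _ _ _ _ _ _ _ tuple_of_col).
- exact: sigma_finiteT.
- apply/measurable_fun_tnthP => i.
  rewrite (_ : _ \o _ = (fun x : 'cV[R]_d => x i 0)).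
    exact: measurable_coor.
  by apply/funext => x /=; rewrite tnth_mktuple.
- by move=> t; apply: eq_from_tnth => i; rewrite tnth_mktuple mxE.
Qed.

HB.instance Definition _ := Measure_isSigmaFinite.Build _ _ _ lebesgue_cV
  lebesgue_cV_sigma_finite.

End euclidean_space.

Section lattice.
Context {R : realType} {d : nat}.
Implicit Types (A : 'M[R]_d) (x y : 'cV[R]_d).

Definition lattice A : set 'cV[R]_d :=
  [set A *m z | z in [set z : 'cV[R]_d | forall i, z i 0 \is a Num.int]].

Definition covolume A : R := `|\det A|.

Definition dual_lattice A : set 'cV[R]_d :=
  [set x | forall v, lattice A v -> dotv x v \is a Num.int].

Definition fundamental_domain A : set 'cV[R]_d :=
  [set A *m t | t in [set t : 'cV[R]_d | forall i, 0 <= t i 0 < 1]].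

Lemma measurable_fundamental_domain A :
  A \in unitmx -> measurable (fundamental_domain A).
Proof.
move=> Au.
rewrite (_ : fundamental_domain A = \big[setI/setT]_(i < d)
    ((fun x => (invmx A *m x) i 0) @^-1` `[0, 1[%classic)).
  apply: bigsetI_measurable => i _.
  rewrite -[X in measurable X]setTI.
  have : measurable_fun setT (fun x : 'cV[R]_d => (invmx A *m x) i 0).
    rewrite (_ : (fun x => _) = (fun x : 'cV[R]_d =>
        \sum_j invmx A i j * x j 0)); last by apply/funext => x; rewrite mxE.
    apply: measurable_sum => j; apply: measurable_funM => //.
    exact: measurable_coor.
  by apply => //; exact: measurable_itv.
apply/seteqP; split => [_ [t t01 <-]|x].
  rewrite -bigcap_seq => i _ /=.
  by rewrite mulmxA mulVmx// mul1mx in_itv/= t01.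
rewrite -bigcap_seq => xA; exists (invmx A *m x).
  by move=> i; have := xA i (mem_index_enum i); rewrite /= in_itv.
by rewrite mulmxA mulmxV// mul1mx.
Qed.

(* Lebesgue measure on the fundamental domain, normalized to total mass 1; the
   second argument of [mnormalize] is used for null measures only. *)
Definition torus_measure A (Au : A \in unitmx) : probability 'cV[R]_d R :=
  mnormalize (mrestr lebesgue_cV (measurable_fundamental_domain Au))
    (dirac (0 : 'cV[R]_d)).

End lattice.

Section riesz.
Context {R : realType} {d : nat}.
Implicit Types (A : 'M[R]_d) (x y : 'cV[R]_d) (D : set 'cV[R]_d).

Definition Gamma (x : R) : R :=
  \int[lebesgue_measure]_(t in `]0, +oo[) (t `^ (x - 1) * expR (- t)).

Definition expi (theta : R) : R[i] := (cos theta +i* sin theta)%C.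

(* Sum of an absolutely summable family of reals. *)
Definition abs_sum (I : choiceType) (S : set I) (f : I -> R) : \bar R :=
  (\esum_(i in S) (EFin \o f)^\+ i - \esum_(i in S) (EFin \o f)^\- i)%E.

(* The value is +oo on the lattice. In the second series, the imaginary parts of
   the terms cancel by the symmetry w -> - w of the dual lattice. *)
Definition periodic_riesz A (s : R) x : \bar R :=
  (\esum_(v in lattice A)
      \int[lebesgue_measure]_(t in `[1%R, +oo[)
        (expR (- (enorm (x + v)) ^+ 2 * t) *
         (t `^ (s / 2 - 1) / Gamma (s / 2)))%:E
   + ((covolume A)^-1)%:E *
     abs_sum (dual_lattice A `\ 0%R) (fun w =>
       (complex.Re (expi (2 * pi * dotv x w)) *
        \int[lebesgue_measure]_(t in `]0, 1[)
          (pi `^ (d%:R / 2) / t `^ (d%:R / 2) *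
           expR (- (pi ^+ 2 * enorm w ^+ 2 / t)) *
           (t `^ (s / 2 - 1) / Gamma (s / 2))))%R))%E.

Definition riesz_energy A (s : R) n (omega : n.-tuple 'cV[R]_d) : \bar R :=
  (\sum_(k < n) \sum_(j < n | j != k)
     periodic_riesz A s (tnth omega k - tnth omega j))%E.

Definition kappa A D (N : nat) (w : 'cV[R]_d) : nat :=
  w \in dual_lattice A `&` [set N%:R `^ d%:R^-1 *: x | x in D].

Definition npoints A D (N : nat) : nat :=
  \sum_(w \in dual_lattice A) kappa A D N w.

Definition lattice_kernel A D (N : nat) (u v : 'cV[R]_d) : R[i] :=
  \sum_(w \in dual_lattice A)
    (kappa A D N w)%:R * expi (2 * pi * dotv (u - v) w).

Fact dual_normalization_ge0 A :
  0 <= (fine (lebesgue_cV (fundamental_domain (invmx A^T))))^-1.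
Proof. by rewrite invr_ge0 fine_ge0// measure_ge0. Qed.

(* The multiple nu of Lebesgue measure giving mass 1 to the fundamental domain
   of the dual lattice, whose basis matrix is the inverse transpose of A. *)
Definition dual_measure A : set 'cV[R]_d -> \bar R :=
  mscale (NngNum (dual_normalization_ge0 A)) lebesgue_cV.

HB.instance Definition _ A := Measure.on (dual_measure A).

Fact dual_measure_sigma_finite A : sigma_finite setT (dual_measure A).
Proof.
have [F FT mF] := sigma_finiteT (@lebesgue_cV R d).
exists F => // n; have [mFn Fnoo] := mF n; split => //.
by rewrite /dual_measure /mscale lte_mul_pinfty// ge0_fin_numE.
Qed.

HB.instance Definition _ A := Measure_isSigmaFinite.Build _ _ _
  (dual_measure A) (dual_measure_sigma_finite A).

Definition riesz_integral A D (t : R) : R :=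
  \int[(dual_measure A \x dual_measure A)%E]_(z in D `*` D)
    (enorm (z.1 - z.2) `^ t)^-1.

End riesz.

Section determinantal.
Local Open Scope ereal_scope.
Context {R : realType} {d dV : measure_display} {T : measurableType d}
  {V : measurableType dV}.

(* The random points x_1, ..., x_n have k-th joint intensity rho with respect
   to mu: rho is the density of the k-th factorial moment measure, which counts
   the ordered k-tuples of points with pairwise distinct indices. *)
Definition joint_intensity (P : probability T R) (n : nat)
    (X : {RV P >-> n.-tuple V}) (mu : {sigma_finite_measure set V -> \bar R})
    (k : nat) (rho : k.-tuple V -> R) : Prop :=
  forall B : set (k.-tuple V), measurable B ->
    \int[P]_u (\sum_(f : {ffun 'I_k -> 'I_n} | injectiveb f)
        \1_B [tuple tnth (X u) (f i) | i < k])%:E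
    = \int[tuple_measure mu k]_(x in B) (rho x)%:E.

(* The determinants are real and nonnegative for a positive Hermitian kernel. *)
Definition determinantal (P : probability T R) (n : nat)
    (X : {RV P >-> n.-tuple V}) (mu : {sigma_finite_measure set V -> \bar R})
    (K : V -> V -> R[i]) : Prop :=
  {ae P, forall u, uniq (X u)} /\
  forall k, (0 < k)%N -> joint_intensity X mu (fun x : k.-tuple V =>
    complex.Re (\det (\matrix_(i < k, j < k) K (tnth x i) (tnth x j)))).

End determinantal.

(* Main.v *)
(** The two-point intensity of the process is t_N^2 - |K_N(x, y)|^2, the sum over
    pairs of frequencies w, w' of 1 - cos (2 pi <x - y, w - w'>). Integrating
    F_{s,Lambda} against it on the torus only involves the Fourier coefficients
    of F_{s,Lambda}: unfolding the first series over the lattice and joining its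
    transform, an integral over [1, +oo[, to the coefficients of the second
    series, integrals over ]0, 1[, gives the Gamma integral
      F^(w) = pi^(s-d/2) Gamma((d-s)/2) / (Gamma(s/2) covol) |w|^-(d-s)  (w != 0),
    and F^(0) = 2 pi^(d/2) / (Gamma(s/2) (d - s) covol). Hence, exactly,
      E = F^(0) (t_N^2 - t_N) - sum_{w != w'} F^(w - w').
    The last sum is a Riemann sum of mesh N^(-1/d) for the singular kernel
    |x - y|^-(d-s) on D x D. It converges by dominated convergence: two distinct
    points of the scaled dual lattice are separated by a multiple of the mesh, so
    rounding x and y to the lattice can only decrease their distance by a bounded
    factor, unless it identifies them. *)

Require Import Defs.
From HB Require Import structures.
From mathcomp Require Import finmap ring lra zify.
From mathcomp Require Import all_boot all_order all_algebra complex.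
From mathcomp Require Import all_classical all_reals all_analysis.
From mathcomp Require Import measurable_realfun.

Set Implicit Arguments.
Unset Strict Implicit.
Unset Printing Implicit Defensive.

Import Order.TTheory GRing.Theory Num.Theory.
Import numFieldNormedType.Exports.

Local Open Scope classical_set_scope.
Local Open Scope ring_scope.

(** * Lebesgue measure on column vectors and linear changes of variables *)

(** Exchanging sums and integrals is the main obstacle: F is unbounded and its second series has
    terms of both signs. Two devices make almost every exchange an instance of Tonelli's theorem for
    nonnegative terms with values in the extended reals. Adding to F the constant B / covol, with B
    the sum of the coefficients of the second series, turns each cosine there into 1 + cos. And
    t_N^2 - |K_N|^2 is never split: each pair of frequencies keeps its own nonnegative weight 1 -
    cos, so a pair contributes F^(0) - F^(w - w') at once, plus the constant. The constant is
    subtracted again for each of the t_N^2 - t_N ordered pairs of points and cancels exactly, since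
    pairs with w = w' contribute nothing. The Riemann sums are normalized by powers of N and the
    statement by powers of t_N. They agree to leading order because t_N / N tends to nu(D) =
    |Lambda| |D| = 1, which uses that the boundary of D is null. The leftover - F^(0) t_N is
    absorbed in the error term because 1 + s/d > 1. *)

Section lebesgue_affine.
Context {R : realType}.
Local Notation mu := (@lebesgue_measure R).

(** The right-hand side is a measure in [B], so by uniqueness of Lebesgue measure half-open
    intervals suffice. A negative [a] exchanges the closed and the open end, hence the two cases. *)
Lemma lebesgue_measure_affine (a b : R) (B : set R) : a != 0 ->
  measurable B ->
  (mu B = `|a|%:E * mu ((fun x => a * x + b)%R @^-1` B))%E.
Proof.
move=> a0 mB.
pose phi : measurableTypeR R -> measurableTypeR R := fun x => a * x + b.
have mphi : measurable_fun setT phi.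
  by apply: measurable_funD => //; exact: measurable_funM.
pose m : {measure set measurableTypeR R -> \bar R} :=
  measure_function_pushforward__canonical__measure_function_Measure mu mphi.
rewrite (@lebesgue_measure_unique R (mscale (NngNum (normr_ge0 a)) m))//.
move=> _ [[u v] /= _ <-].
rewrite /mscale /= /pushforward lebesgue_measure_itv /=.
have [ap|an|a0'] := ltgtP a 0; last by rewrite a0' eqxx in a0.
- rewrite (_ : _ @^-1` _ = `[(v - b) / a, (u - b) / a[%classic).
    rewrite lebesgue_measure_itv /= !lte_fin ltr_ndivrMr// divfK//.
    rewrite ltrBlDr subrK; case: ifP => _; last by rewrite mule0.
    by rewrite -!EFinB -EFinM ltr0_norm//; congr EFin; field.
  apply/seteqP; split => x /=; rewrite !in_itv/= /phi => /andP[p q].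
    by rewrite ler_ndivrMr// ltr_ndivlMr//; apply/andP; split; lra.
  move: p q; rewrite ler_ndivrMr// ltr_ndivlMr// => p q.
  by apply/andP; split; lra.
- rewrite (_ : _ @^-1` _ = `](u - b) / a, (v - b) / a]%classic).
    rewrite lebesgue_measure_itv /= !lte_fin ltr_pdivrMr// divfK//.
    rewrite ltrBlDr subrK; case: ifP => _; last by rewrite mule0.
    by rewrite -!EFinB -EFinM gtr0_norm//; congr EFin; field.
  apply/seteqP; split => x /=; rewrite !in_itv/= /phi => /andP[p q].
    by rewrite ltr_pdivrMr// ler_pdivlMr//; apply/andP; split; lra.
  move: p q; rewrite ltr_pdivrMr// ler_pdivlMr// => p q.
  by apply/andP; split; lra.
Qed.

Lemma ge0_integral_affine (a b : R) (f : R -> \bar R) : a != 0 ->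
  measurable_fun setT f -> (forall x, 0 <= f x)%E ->
  (\int[mu]_x f (a * x + b)%R = `|a|^-1%:E * \int[mu]_x f x)%E.
Proof.
move=> a0 mf f0.
pose phi : measurableTypeR R -> measurableTypeR R := fun x => a * x + b.
have mphi : measurable_fun setT phi.
  by apply: measurable_funD => //; exact: measurable_funM.
pose m : {measure set measurableTypeR R -> \bar R} :=
  measure_function_pushforward__canonical__measure_function_Measure mu mphi.
rewrite [in RHS](@eq_measure_integral _ _ _ setT
  (mscale (NngNum (normr_ge0 a)) m)); last first.
  by move=> B mB _; exact: (lebesgue_measure_affine b a0 mB).
rewrite ge0_integral_mscale// (@ge0_integral_pushforward _ _ _ _ R phi mphi)//.
by rewrite preimage_setT /= muleA -EFinM mulVf ?mul1e// normr_eq0.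
Qed.

End lebesgue_affine.

(** * Integration over column vectors, one coordinate at a time *)

Section integral_cV.
Context {R : realType}.
Local Notation mu := (@lebesgue_measure R).
Local Notation lam := (@lebesgue_cV R _).

Lemma ge0_integral_cV0 (f : 'cV[R]_0 -> \bar R) :
  measurable_fun setT f -> (forall x, 0 <= f x)%E ->
  (\int[lam]_x f x = f 0%R)%E.
Proof.
move=> mf f0.
rewrite (@ge0_integral_pushforward _ _ _ _ R (@col_of_tuple R 0)
  (@measurable_col_of_tuple R 0) (tuple_measure mu 0))//.
rewrite preimage_setT /= integral_dirac//; last first.
  by apply: measurableT_comp => //; exact: measurable_col_of_tuple.
rewrite diracT mul1e /=; congr f.
by apply/matrixP => -[].
Qed.

Lemma measurable_col_mx n (phi : R * 'cV[R]_n -> R * 'cV[R]_n) :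
  measurable_fun setT phi ->
  measurable_fun setT (fun z => col_mx (phi z).1%:M (phi z).2 : 'cV[R]_(1 + n)).
Proof.
move=> mphi; apply: measurable_cV => i.
rewrite -(splitK i); case: (fintype.split i) => j /=.
  rewrite [X in measurable_fun _ X](_ : _ = fst \o phi).
    exact: measurableT_comp.
  by apply/funext => z; rewrite col_mxEu ord1 mxE eqxx mulr1n.
rewrite [X in measurable_fun _ X](_ : _ =
    (fun x : 'cV[R]_n => x j 0) \o snd \o phi).
  apply: measurableT_comp => //; apply: measurableT_comp => //.
  exact: measurable_coor.
by apply/funext => z; rewrite col_mxEd.
Qed.

(** The product measure is built by consing one coordinate at a time, so Tonelli's theorem peels off
    the first one. Later inductions on the dimension rest on this. *)
Lemma ge0_integral_cV n (f : 'cV[R]_(1 + n) -> \bar R) :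
  measurable_fun setT f -> (forall x, 0 <= f x)%E ->
  (\int[lam]_x f x = \int[mu]_x \int[lam]_y f (col_mx x%:M y))%E.
Proof.
move=> mf f0.
have mc k := @measurable_col_of_tuple R k.
rewrite (@ge0_integral_pushforward _ _ _ _ R _ (mc n.+1)
  (tuple_measure mu n.+1))// preimage_setT.
rewrite (@ge0_integral_pushforward _ _ _ _ R _
  (@measurable_tcons _ (measurableTypeR R) n)
  (product_measure1 mu (tuple_measure mu n)))//; last 2 first.
  - by apply: measurableT_comp => //; exact: mc.
  - by move=> t _; exact: f0.
rewrite preimage_setT fubini_tonelli1//; last 2 first.
  - apply: measurableT_comp => //; last exact: measurable_tcons.
    by apply: measurableT_comp => //; exact: mc.
  - by move=> t; exact: f0.
apply: eq_integral => x _; rewrite /fubini_F /=.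
have mx : measurable_fun setT
    (fun y : 'cV[R]_n => f (col_mx x%:M y : 'cV[R]_(1 + n))).
  apply: measurableT_comp => //.
  by apply: (@measurableT_comp _ _ _ _ _ _ _ _ (pair x) (measurable_col_mx (@measurable_id _ _ _))).
rewrite (@ge0_integral_pushforward _ _ _ _ R _ (mc n)
  (tuple_measure mu n))//.
rewrite preimage_setT; apply: eq_integral => t _ /=; congr f.
apply/matrixP => i j; rewrite (ord1 j) mxE.
rewrite -(splitK i); case: (fintype.split i) => k /=.
  by rewrite col_mxEu mxE (ord1 k) eqxx mulr1n (tnth_nth 0).
by rewrite col_mxEd mxE !(tnth_nth 0).
Qed.

End integral_cV.

Section measurable_cV_ops.
Context {R : realType} d' (T : measurableType d').

Lemma measurable_cV_coor n (f : T -> 'cV[R]_n) i :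
  measurable_fun setT f -> measurable_fun setT (fun t => f t i 0).
Proof. by move=> mf; exact: (measurableT_comp (measurable_coor i) mf). Qed.

Lemma measurable_cVD n (f g : T -> 'cV[R]_n) : measurable_fun setT f ->
  measurable_fun setT g -> measurable_fun setT (fun t => f t + g t).
Proof.
move=> mf mg; apply: measurable_cV => i.
rewrite [X in measurable_fun _ X](_ : _ = (fun t => f t i 0 + g t i 0)).
  by apply: measurable_funD; exact: measurable_cV_coor.
by apply/funext => t; rewrite mxE.
Qed.

Lemma measurable_cVB n (f g : T -> 'cV[R]_n) : measurable_fun setT f ->
  measurable_fun setT g -> measurable_fun setT (fun t => f t - g t).
Proof.
move=> mf mg; apply: measurable_cV => i.
rewrite [X in measurable_fun _ X](_ : _ = (fun t => f t i 0 - g t i 0)).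
  by apply: measurable_funB; exact: measurable_cV_coor.
by apply/funext => t; rewrite !mxE.
Qed.

Lemma measurable_mulmx m n (A : 'M[R]_(m, n)) (f : T -> 'cV[R]_n) :
  measurable_fun setT f -> measurable_fun setT (fun t => A *m f t).
Proof.
move=> mf; apply: measurable_cV => i.
rewrite [X in measurable_fun _ X](_ : _ = (fun t => \sum_j A i j * f t j 0)).
  apply: measurable_sum => j; apply: measurable_funM => //.
  exact: measurable_cV_coor.
by apply/funext => t; rewrite mxE.
Qed.

Lemma measurable_dotv n (f g : T -> 'cV[R]_n) : measurable_fun setT f ->
  measurable_fun setT g -> measurable_fun setT (fun t => dotv (f t) (g t)).
Proof.
move=> mf mg; apply: measurable_sum => j.
by apply: measurable_funM; exact: measurable_cV_coor.
Qed.

Lemma measurable_enorm n (f : T -> 'cV[R]_n) : measurable_fun setT f ->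
  measurable_fun setT (fun t => enorm (f t)).
Proof.
move=> mf; have ms : measurable_fun setT (@Num.sqrt R).
  by apply: continuous_measurable_fun; exact: sqrt_continuous.
exact: (measurableT_comp ms (measurable_dotv mf mf)).
Qed.

End measurable_cV_ops.

(** * Translations and invertible linear maps *)

Section linear_change.
Context {R : realType}.
Local Notation mu := (@lebesgue_measure R).
Local Notation lam := (@lebesgue_cV R _).

Let measurable_col n (f : 'cV[R]_(1 + n) -> \bar R) :
  measurable_fun setT f ->
  measurable_fun setT (fun z : R * 'cV[R]_n => f (col_mx z.1%:M z.2)).
Proof.
move=> mf; apply: measurableT_comp => //.
by apply: measurable_col_mx; exact: measurable_id.
Qed.

Let measurable_colr n (f : 'cV[R]_(1 + n) -> \bar R) x :
  measurable_fun setT f -> measurable_fun setT (fun y => f (col_mx x%:M y)).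
Proof.
move=> mf; exact: (measurableT_comp (measurable_col mf) (pair1_measurable x)).
Qed.

Let measurable_coll n (f : 'cV[R]_(1 + n) -> \bar R) y :
  measurable_fun setT f -> measurable_fun setT (fun x : R => f (col_mx x%:M y)).
Proof.
move=> mf; exact: (measurableT_comp (measurable_col mf) (pair2_measurable y)).
Qed.

Lemma ge0_integral_cV_swap n (f : 'cV[R]_(1 + n) -> \bar R) :
  measurable_fun setT f -> (forall x, 0 <= f x)%E ->
  (\int[lam]_x f x = \int[lam]_y \int[mu]_x f (col_mx x%:M y))%E.
Proof.
move=> mf f0; rewrite ge0_integral_cV//.
pose g (z : R * 'cV[R]_n) := f (col_mx z.1%:M z.2).
exact: (@fubini_tonelli _ _ _ _ R mu (@lebesgue_cV R n) g
  (measurable_col mf) (fun z => f0 _)).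
Qed.

Lemma ge0_integral_translate n (a : 'cV[R]_n) (f : 'cV[R]_n -> \bar R) :
  measurable_fun setT f -> (forall x, 0 <= f x)%E ->
  (\int[lam]_x f (x + a)%R = \int[lam]_x f x)%E.
Proof.
elim: n a f => [|n IH] a f mf f0.
  by apply: eq_integral => x _; congr f; apply/matrixP => -[].
have mfa : measurable_fun setT (fun x : 'cV[R]_n.+1 => f (x + a)).
  by apply: measurableT_comp => //; exact: measurable_cVD.
etransitivity; first exact: (ge0_integral_cV mfa (fun=> f0 _)).
apply/esym; etransitivity; first exact: (ge0_integral_cV mf f0).
apply/esym.
have aE : a = col_mx (usubmx (a : 'cV[R]_(1 + n)) 0 0)%:M (dsubmx (a : 'cV[R]_(1 + n))).
  by rewrite -mx11_scalar vsubmxK.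
rewrite aE; set a0 := usubmx _ 0 0; set a' := dsubmx _.
have colD x (y : 'cV[R]_n) : col_mx x%:M y + col_mx a0%:M a' =
    col_mx (x + a0)%:M (y + a') :> 'cV_n.+1.
  by rewrite add_col_mx -raddfD.
under eq_integral => x _.
  under eq_integral => y _ do rewrite colD.
  rewrite (IH a' (fun y => f (col_mx (x + a0)%:M y)))//; last first.
    exact: measurable_colr.
  over.
rewrite /=.
have := @ge0_integral_affine R 1 a0
  (fun x => \int[@lebesgue_cV R n]_y f (col_mx x%:M y))%E (oner_neq0 R).
under eq_integral do rewrite mul1r.
rewrite normr1 invr1 mul1e; apply.
  exact: (measurable_fun_fubini_tonelli_F _ (measurable_col mf)).
by move=> x; exact: integral_ge0.
Qed.

Let change n (A : 'M[R]_n) := forall f : 'cV[R]_n -> \bar R,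
  measurable_fun setT f -> (forall x, 0 <= f x)%E ->
  (\int[lam]_x f (A *m x)%R = `|\det A|^-1%:E * \int[lam]_x f x)%E.

Let changeM n (A B : 'M[R]_n) : change A -> change B -> change (A *m B).
Proof.
move=> hA hB f mf f0.
under eq_integral do rewrite -mulmxA.
rewrite (hB (fun x => f (A *m x)))//; last first.
  by apply: measurableT_comp => //; exact: measurable_mulmx.
by rewrite hA// det_mulmx normrM invfM EFinM muleCA muleA.
Qed.

(** With the last coordinates [y] fixed and the first one integrated first, [b *m y] is a mere
    translation; what remains is a scaling by [a] and the map [S]. *)
Let change_upper n (a : R) (b : 'rV[R]_n) (S : 'M[R]_n) :
  a != 0 -> change S -> change (block_mx a%:M b 0 S : 'M[R]_(1 + n)).
Proof.
move=> a0 hS f mf f0.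
have mfa : measurable_fun setT
    (fun x : 'cV[R]_(1 + n) => f ((block_mx a%:M b 0 S : 'M[R]_(1 + n)) *m x)).
  by apply: measurableT_comp => //; exact: measurable_mulmx.
rewrite !ge0_integral_cV_swap//.
under eq_integral => y _.
  under eq_integral => x _.
    rewrite mul_block_col mul0mx add0r -scalar_mxM.
    rewrite (mx11_scalar (b *m y)) -(raddfD (@scalar_mx R 1)); over.
  rewrite (@ge0_integral_affine R a _ (fun x => f (col_mx x%:M (S *m y))))//.
    over.
  exact: measurable_coll.
have mG : measurable_fun setT
    (fun y : 'cV[R]_n => \int[mu]_x f (col_mx x%:M y))%E.
  exact: (measurable_fun_fubini_tonelli_G (m1 := mu) _
    (measurable_col mf) (fun=> f0 _)).
have G0 y : (0 <= \int[mu]_x f (col_mx x%:M y))%E by exact: integral_ge0.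
pose G y := (\int[mu]_x f (col_mx x%:M y))%E.
have mGS : measurable_fun setT (fun y : 'cV[R]_n => G (S *m y)).
  by apply: measurableT_comp => //; exact: measurable_mulmx.
rewrite [LHS](_ : _ = `|a|^-1%:E * \int[lam]_y G (S *m y)%R)%E.
  by rewrite (hS G)// det_ublock det_scalar1 normrM invfM EFinM muleA.
exact: ge0_integralZl.
Qed.

(** Here the first coordinate is held fixed, and the remaining ones are translated by a multiple of
    [c]. *)
Let change_lower n (c : 'cV[R]_n) :
  change (block_mx 1%:M 0 c 1%:M : 'M[R]_(1 + n)).
Proof.
move=> f mf f0.
have mfa : measurable_fun setT
    (fun x : 'cV[R]_(1 + n) => f ((block_mx 1%:M 0 c 1%:M : 'M[R]_(1 + n)) *m x)).
  by apply: measurableT_comp => //; exact: measurable_mulmx.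
rewrite det_lblock !det1 mul1r normr1 invr1 mul1e.
rewrite (ge0_integral_cV mfa (fun=> f0 _)) (ge0_integral_cV mf f0).
apply: eq_integral => x _.
under eq_integral => y _ do
  rewrite mul_block_col mul0mx addr0 !mul1mx addrC.
rewrite (ge0_integral_translate _ (f := fun y => f (col_mx x%:M y)))//.
exact: measurable_colr.
Qed.

(** One step of Gaussian elimination with the upper left entry as pivot; the block left to the
    induction is the Schur complement. *)
Let change_nz n (A : 'M[R]_(1 + n)) : (forall S : 'M[R]_n, S \in unitmx -> change S) ->
  A \in unitmx -> ulsubmx A 0 0 != 0 -> change A.
Proof.
move=> IH Au a0; set a := ulsubmx A 0 0.
pose b := ursubmx A; pose c := dlsubmx A; pose D := drsubmx A.
have AE : A = (block_mx 1%:M 0 (a^-1 *: c) 1%:M : 'M[R]_(1 + n)) *m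
    (block_mx a%:M b 0 (D - a^-1 *: (c *m b)) : 'M[R]_(1 + n)).
  rewrite mulmx_block !mul1mx !mul0mx !addr0 mul_mx_scalar scalerA mulfV//.
  by rewrite scale1r -scalemxAl [_ + (D - _)]addrC subrK -mx11_scalar submxK.
rewrite AE; apply: changeM; first exact: change_lower.
apply: change_upper => //; apply: IH.
move: Au; rewrite AE unitmx_mul => /andP[_].
by rewrite !unitmxE det_ublock det_scalar1 unitrM => /andP[].
Qed.

Let ulsubmx_shear n (A : 'M[R]_(1 + n)) i :
  ulsubmx ((block_mx 1%:M (1 *: delta_mx 0 i) 0 1%:M : 'M[R]_(1 + n)) *m A) 0 0 =
  ulsubmx A 0 0 + dlsubmx A i 0.
Proof.
rewrite -{1}(submxK A) mulmx_block block_mxKul mul1mx mxE scale1r -rowE.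
by rewrite [row _ _ _ _]mxE.
Qed.

(* By induction on the dimension, A is a product of block triangular matrices. If
   its upper left entry vanishes, a shear makes it nonzero. *)
Lemma ge0_integral_mulmx n (A : 'M[R]_n) (f : 'cV[R]_n -> \bar R) :
  A \in unitmx -> measurable_fun setT f -> (forall x, 0 <= f x)%E ->
  (\int[lam]_x f (A *m x)%R = `|\det A|^-1%:E * \int[lam]_x f x)%E.
Proof.
move=> Au; move: f; rewrite -/(change A).
elim: n A Au => [|n IH] A Au.
  move=> f mf f0; rewrite det_mx00 normr1 invr1 mul1e.
  by apply: eq_integral => x _; congr f; apply/matrixP => -[].
have [a0|a0] := eqVneq (ulsubmx (A : 'M[R]_(1 + n)) 0 0) 0; last first.
  exact: (@change_nz n A).
have [i ci0] : exists i, dlsubmx (A : 'M[R]_(1 + n)) i 0 != 0.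
  apply/not_existsP => h.
  move: Au; rewrite unitmxE unitfE => /eqP; apply.
  rewrite -det_tr; apply/eqP/det0P; exists (delta_mx 0 0).
    by apply/eqP => /matrixP/(_ 0 0)/eqP; rewrite !mxE !eqxx oner_eq0.
  rewrite -rowE; apply/matrixP => p j; rewrite !mxE.
  have [->|[k ->]] : j = 0 \/ exists k, j = rshift 1 k :> 'I_(1 + n).
    rewrite -(splitK (j : 'I_(1 + n))); case: (fintype.split _) => k /=.
      by left; apply/val_inj; rewrite (ord1 k).
    by right; exists k.
    by rewrite -a0 !mxE; congr (A _ _); exact/val_inj.
  have /negP := h k; rewrite negbK !mxE => /eqP <-.
  by congr (A _ _); exact/val_inj.
(* The shear adding [e] times a lower row, the one with a nonzero entry in the first column, to the
   first row; [M (-1)] undoes [M 1]. *)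
pose M (e : R) : 'M[R]_(1 + n) := block_mx 1%:M (e *: delta_mx 0 i) 0 1%:M.
have MK : M (-1) *m M 1 = 1%:M.
  rewrite mulmx_block !mul1mx !mul0mx !mulmx1 mulmx0 addr0 add0r.
  by rewrite scaleN1r scale1r subrr add0r -scalar_mx_block.
have uM e : M e \in unitmx by rewrite unitmxE det_ublock !det1 mulr1 unitr1.
have -> : A = M (-1) *m (M 1 *m A) by rewrite mulmxA MK mul1mx.
apply: changeM.
  apply: change_upper; first exact: oner_neq0.
  by apply: IH; exact: unitmx1.
apply: change_nz => //; first by rewrite unitmx_mul uM.
by rewrite ulsubmx_shear a0 add0r.
Qed.

End linear_change.

(** * Lattices and fundamental domains *)

Section esum_countType.
Local Open Scope ereal_scope.
Context {R : realType} {I : countType}.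

Lemma esum_nneseries (a : I -> \bar R) : (forall i, 0 <= a i) ->
  \esum_(i in [set: I]) a i = \sum_(n <oo) oapp a 0 (pickle_inv n).
Proof.
move=> a0; rewrite nneseries_esumT; last by move=> n; case: pickle_inv.
pose b n := oapp a 0 (@pickle_inv I n).
rewrite [RHS](_ : _ = \esum_(n in range (@pickle I)) b n).
  rewrite esum_image; last by move=> i j _ _ /(pcan_inj pickleK).
  by apply: eq_esum => i _; rewrite /b pickleK_inv.
rewrite [RHS]esum_mkcond; apply: eq_esum => n _.
case: ifPn => // nr; rewrite /oapp; have := @pickle_invK I n.
case: pickle_inv => //= i ni; exfalso; apply/negP: nr.
by rewrite negbK inE; exists i.
Qed.

Context d (T : measurableType d) (f : I -> T -> \bar R) (D : set T).
Hypothesis mD : measurable D.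
Hypothesis mf : forall i, measurable_fun D (f i).
Hypothesis f0 : forall i x, 0 <= f i x.

Let g n x := oapp (f ^~ x) 0 (@pickle_inv I n).

Let mg n : measurable_fun D (g n).
Proof. by rewrite /g; case: pickle_inv => [i|] /=; [exact: mf|exact: measurable_cst]. Qed.

Let g0 n x : 0 <= g n x.
Proof. by rewrite /g; case: pickle_inv => //= i; exact: f0. Qed.

Lemma measurable_esum : measurable_fun D (fun x => \esum_(i in [set: I]) f i x).
Proof.
under eq_fun do rewrite esum_nneseries//.
by apply: (@ge0_emeasurable_sum _ _ R D g predT) => [k x _ _|k _].
Qed.

Lemma ge0_integral_esum (mu : {measure set T -> \bar R}) :
  \int[mu]_(x in D) (\esum_(i in [set: I]) f i x) =
  \esum_(i in [set: I]) \int[mu]_(x in D) f i x.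
Proof.
rewrite esum_nneseries; last by move=> i; exact: integral_ge0.
under eq_integral do rewrite esum_nneseries//.
rewrite (integral_nneseries mu mD mg)//.
apply: eq_eseriesr => n _; rewrite /g; case: pickle_inv => //=.
exact: integral0.
Qed.

End esum_countType.

Section esum_misc.
Local Open Scope ereal_scope.
Context {R : realType}.

Lemma esum_eq1 (I : choiceType) (S : set I) (i : I) (a : I -> \bar R) :
  S i -> 0 <= a i -> (forall j, S j -> j != i -> a j = 0) ->
  \esum_(j in S) a j = a i.
Proof.
move=> Si ai0 a0; rewrite -[RHS]esum_set1//.
rewrite [LHS]esum_mkcond [RHS]esum_mkcond; apply: eq_esum => j _.
have [->|ji] := eqVneq j i; first by rewrite mem_set// mem_set.
rewrite (memNset (_ : ~ [set i] j)); last exact/eqP.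
by case: ifPn => // /set_mem Sj; exact: a0.
Qed.

Lemma esumZl (I : countType) (a : I -> \bar R) (k : R) :
  (0 <= k)%R -> (forall i, 0 <= a i) ->
  \esum_(i in [set: I]) (k%:E * a i) = k%:E * \esum_(i in [set: I]) a i.
Proof.
move=> k0 a0; rewrite !esum_nneseries//; last by move=> i; exact: mule_ge0.
rewrite -nneseriesZl//; last by move=> n _; case: pickle_inv.
by apply: eq_eseriesr => n _; case: pickle_inv => //=; rewrite mule0.
Qed.

End esum_misc.

Section lattice_points.
Context {R : realType} {d : nat}.
Implicit Types (A : 'M[R]_d) (x : 'cV[R]_d) (z : 'cV[int]_d).

Definition ivec z : 'cV[R]_d := map_mx intr z.

Definition vfloor x : 'cV[int]_d := \col_i Num.floor (x i 0).

Lemma ivecD z z' : ivec (z + z') = ivec z + ivec z'.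
Proof. exact: map_mxD. Qed.

Lemma ivecN z : ivec (- z) = - ivec z.
Proof. exact: map_mxN. Qed.

Lemma ivec0 : ivec 0 = 0.
Proof. exact: map_mx0. Qed.

Lemma ivec_inj : injective ivec.
Proof.
move=> z z' /matrixP h; apply/matrixP => i j.
by have := h i j; rewrite !mxE => /intr_inj.
Qed.

Lemma latticeP A x : lattice A x <-> exists z, x = A *m ivec z.
Proof.
split=> [[y yint <-]|[z ->]].
  exists (vfloor y); congr (_ *m _); apply/matrixP => i j.
  by rewrite (ord1 j) !mxE floorK.
by exists (ivec z) => // i; rewrite mxE intr_int.
Qed.

Lemma lattice_inj A : A \in unitmx -> injective (fun z => A *m ivec z).
Proof. by move=> Au z z' /(congr1 (mulmx (invmx A))); rewrite !mulKmx// => /ivec_inj. Qed.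

Lemma esum_lattice A (a : 'cV[R]_d -> \bar R) : A \in unitmx ->
  (\esum_(v in lattice A) a v = \esum_(z in [set: 'cV[int]_d]) a (A *m ivec z)%R)%E.
Proof.
move=> Au; rewrite -(@esum_image _ _ _ _ (fun z => A *m ivec z)); last first.
  by move=> z z' _ _; exact: lattice_inj.
congr (esum _ _); apply/seteqP; split => x.
  by move=> /latticeP[z ->]; exists z.
by move=> [z _ <-]; apply/latticeP; exists z.
Qed.

Lemma dotv_mulmx A x y : dotv x (A *m y) = dotv (A^T *m x) y.
Proof.
have dE (u v : 'cV[R]_d) : dotv u v = (u^T *m v) 0 0.
  by rewrite mxE; apply: eq_bigr => i _; rewrite mxE.
by rewrite !dE trmx_mul trmxK mulmxA.
Qed.

(** Pairing [x] with the columns of [A] reads off the entries of [A^T *m x], so testing on a basis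
    already forces these to be integers. *)
Lemma dual_latticeE A : A \in unitmx -> dual_lattice A = lattice (invmx A^T).
Proof.
move=> Au; have ATu : A^T \in unitmx by rewrite unitmx_tr.
apply/seteqP; split => x.
  move=> dx; exists (A^T *m x); last by rewrite mulKmx.
  move=> i; have := dx (A *m delta_mx i 0).
  rewrite dotv_mulmx (_ : dotv _ _ = (A^T *m x) i 0).
    by apply; exists (delta_mx i 0) => // j; rewrite mxE eqxx andbT; case: (j == i).
  rewrite /dotv (bigD1 i)//= big1 => [|j ji]; last first.
    by rewrite [delta_mx _ _ _ _]mxE (negbTE ji) mulr0.
  by rewrite [delta_mx _ _ _ _]mxE !eqxx mulr1 addr0.
move=> [z zi <-] _ [y yi <-]; rewrite dotv_mulmx mulKVmx//.
by apply: rpred_sum => i _; exact: rpredM.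
Qed.

(** The tiling property: coordinates in the basis [A] split uniquely into integer and fractional
    parts, so each point lies in exactly one translate of the fundamental domain. *)
Lemma fundamental_domainP A x z : A \in unitmx ->
  fundamental_domain A (x - A *m ivec z) <-> vfloor (invmx A *m x) = z.
Proof.
move=> Au; split.
  move=> [t t01 /esym/eqP]; rewrite subr_eq => /eqP ->.
  rewrite mulmxDr !mulKmx//; apply/matrixP => i j; rewrite (ord1 j) !mxE.
  apply: floor_def; rewrite intrD addrC; have /andP[t0 t1] := t01 i.
  by rewrite lerDl t0/= ltrD2l.
move=> <-; exists (invmx A *m x - ivec (vfloor (invmx A *m x))); last first.
  by rewrite mulmxBr mulKVmx.
move=> i; have := floor_itv ((invmx A *m x) i 0); rewrite [_ i 0]mxE.
by rewrite intrD !mxE => /andP[? ?]; apply/andP; split; lra.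
Qed.

End lattice_points.

(** * The tiling of space by the cells of a lattice *)

Section cells.
Context {R : realType}.
Local Notation mu := (@lebesgue_measure R).
Local Notation lam := (@lebesgue_cV R _).

(** Meant for the indicator of [[0, 1[], where it gives the volume of the unit cube. *)
Lemma integral_prod_coor n (phi : R -> R) : measurable_fun setT phi ->
  (forall x, 0 <= phi x) -> (\int[mu]_x (phi x)%:E = 1)%E ->
  (\int[@lebesgue_cV R n]_x (\prod_(i < n) phi (x i 0)%R)%:E = 1)%E.
Proof.
move=> mphi phi0 phi1.
have mprod k : measurable_fun setT (fun x : 'cV[R]_k => (\prod_(i < k) phi (x i 0))%:E).
  apply/measurable_EFinP; apply: measurable_prod => i _.
  by apply: measurableT_comp => //; exact: measurable_coor.
have prod0 k (x : 'cV[R]_k) : (0 <= (\prod_(i < k) phi (x i 0))%:E)%E.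
  by rewrite lee_fin prodr_ge0.
elim: n => [|n IH].
  by rewrite (ge0_integral_cV0 (mprod 0%N) (prod0 0%N)) big_ord0.
etransitivity; first exact: (ge0_integral_cV (mprod (1 + n)%N) (prod0 (1 + n)%N)).
rewrite -phi1; apply: eq_integral => x _.
rewrite [LHS](_ : _ = (\int[@lebesgue_cV R n]_y
    ((phi x)%:E * (\prod_(i < n) phi (y i 0))%:E))%E).
  by rewrite (ge0_integralZl _ measurableT (mprod n)) ?lee_fin// IH mule1.
apply: eq_integral => y _; rewrite big_split_ord/= big_ord1 EFinM.
rewrite col_mxEu mxE eqxx mulr1n; congr (_ * _%:E)%E.
by apply: eq_bigr => i _; rewrite col_mxEd.
Qed.

Context {d : nat}.
Variable A : 'M[R]_d.
Hypothesis Au : A \in unitmx.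

Lemma lebesgue_fundamental_domain :
  (lam (fundamental_domain A) = (covolume A)%:E)%E.
Proof.
have mF := measurable_fundamental_domain Au.
have m1 : measurable_fun setT (fun x => (\1_(fundamental_domain A) x)%:E : \bar R).
  by apply/measurable_EFinP; exact: measurable_indic.
have i0 x : (0 <= (\1_(fundamental_domain A) x)%:E :> \bar R)%E by rewrite lee_fin.
have := ge0_integral_mulmx Au m1 i0.
rewrite [X in X = _ -> _](_ : _ = 1%E).
  rewrite [X in (_ * X)%E](_ : _ = lam (fundamental_domain A)); last first.
    by rewrite integral_indic// setIT.
  move=> /(congr1 (fun x => (covolume A)%:E * x))%E.
  rewrite /covolume mule1 muleA -EFinM mulfV ?mul1e ?normr_eq0//; last first.
    by move: Au; rewrite unitmxE unitfE.
have := @integral_prod_coor d (\1_(`[0, 1[%classic : set R)).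
move=> /(_ _ _ _) <- //; last first.
  by rewrite integral_indic//= setIT lebesgue_measure_itv/= lte_fin ltr01 sube0.
apply: eq_integral => x _; congr EFin; rewrite indicE.
have [/set_mem|/negP] := boolP (_ \in _).
  move=> [t t01 /(congr1 (mulmx (invmx A)))]; rewrite !mulKmx// => tx.
  rewrite big1// => i _; rewrite indicE mem_set//= in_itv/= -tx.
  by case/andP: (t01 i) => -> ->.
move=> nF; suff [i ni] : exists i, ~ (0 <= x i 0 < 1).
  by rewrite (bigD1 i)//= indicE memNset ?mul0r//= in_itv.
by apply/existsNP => h; apply: nF; rewrite inE; exists x.
Qed.

Let cell (z : 'cV[int]_d) (x : 'cV[R]_d) : R := (vfloor (invmx A *m x) == z)%:R.

Let cellE z x : cell z x = \1_(fundamental_domain A) (x - A *m ivec z).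
Proof.
rewrite /cell indicE; congr (nat_of_bool _)%:R; apply/eqP/idP => [/(fundamental_domainP x z Au)|].
  exact: mem_set.
by move=> /set_mem /(fundamental_domainP x z Au).
Qed.

Let measurable_cell z : measurable_fun setT (cell z).
Proof.
rewrite [X in measurable_fun _ X](_ : _ =
    (fun x => \1_(fundamental_domain A) (x - A *m ivec z))).
  have mF := measurable_fundamental_domain Au.
  have m1 : measurable_fun setT (\1_(fundamental_domain A) : _ -> R).
    exact: measurable_indic.
  by apply: (measurableT_comp m1); exact: measurable_cVB.
by apply/funext => x; rewrite cellE.
Qed.

Let integral_cell z : (\int[lam]_x (cell z x)%:E = (covolume A)%:E)%E.
Proof.
have mF := measurable_fundamental_domain Au.
under eq_integral do rewrite cellE.
have m1 : measurable_fun setT (fun x => (\1_(fundamental_domain A) x)%:E : \bar R).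
  by apply/measurable_EFinP; exact: measurable_indic.
etransitivity; first apply: (ge0_integral_translate (- (A *m ivec z)) m1).
  by move=> x; rewrite lee_fin.
by rewrite integral_indic// setIT; exact: lebesgue_fundamental_domain.
Qed.

Let esum_cell (h : 'cV[int]_d -> \bar R) x : (forall z, 0 <= h z)%E ->
  (h (vfloor (invmx A *m x)) = \esum_(z in setT) (h z * (cell z x)%:E))%E.
Proof.
move=> h0; rewrite (@esum_eq1 _ _ _ (vfloor (invmx A *m x)))// /cell ?eqxx ?mule1//.
by move=> z _; rewrite eq_sym => /negbTE ->; rewrite mule0.
Qed.

Let measurable_hcell (h : 'cV[int]_d -> \bar R) z :
  measurable_fun setT (fun x => h z * (cell z x)%:E)%E.
Proof. by apply: measurable_funeM; apply/measurable_EFinP; exact: measurable_cell. Qed.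

Let hcell_ge0 (h : 'cV[int]_d -> \bar R) z x : (forall z, 0 <= h z)%E ->
  (0 <= h z * (cell z x)%:E)%E.
Proof. by move=> h0; rewrite mule_ge0// lee_fin ler0n. Qed.

Lemma measurable_vfloor (h : 'cV[int]_d -> \bar R) : (forall z, 0 <= h z)%E ->
  measurable_fun setT (fun x => h (vfloor (invmx A *m x))).
Proof.
move=> h0; under eq_fun do rewrite (esum_cell _ h0).
by apply: measurable_esum => // z x; exact: hcell_ge0.
Qed.

(** The integrand is a step function, constant on cells of volume [covolume A]. This is the bridge
    from lattice sums to integrals, used both for the convergence of Gaussian sums and for the
    Riemann sums. *)
Lemma ge0_integral_vfloor (h : 'cV[int]_d -> \bar R) : (forall z, 0 <= h z)%E ->
  (\int[lam]_x h (vfloor (invmx A *m x))%R =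
   (covolume A)%:E * \esum_(z in [set: 'cV[int]_d]) h z)%E.
Proof.
move=> h0; under eq_integral do rewrite (esum_cell _ h0).
rewrite (ge0_integral_esum (I := 'cV[int]_d))//; last by move=> z x; exact: hcell_ge0.
rewrite -esumZl//; last exact: normr_ge0.
apply: eq_esum => z _.
rewrite ge0_integralZl ?integral_cell 1?muleC//.
  by apply/measurable_EFinP; exact: measurable_cell.
by move=> x _; rewrite lee_fin ler0n.
Qed.

(** Space is cut into cells, and each cell is translated back to the fundamental domain. *)
Lemma ge0_integral_unfold (f : 'cV[R]_d -> \bar R) :
  measurable_fun setT f -> (forall x, 0 <= f x)%E ->
  (\int[lam]_(x in fundamental_domain A) (\esum_(v in lattice A) f (x + v)%R) =
   \int[lam]_x f x)%E.
Proof.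
move=> mf f0; have mF := measurable_fundamental_domain Au.
under eq_integral do rewrite esum_lattice//.
have mfz z : measurable_fun setT (fun x : 'cV[R]_d => f (x + A *m ivec z)).
  by apply: measurableT_comp => //; exact: measurable_cVD.
rewrite (ge0_integral_esum (I := 'cV[int]_d))//; last first.
  by move=> z; exact: measurable_funTS.
rewrite [RHS](_ : _ = \int[lam]_x \esum_(z in [set: 'cV[int]_d])
    (f x * (cell z x)%:E))%E; last first.
  apply: eq_integral => x _.
  by rewrite -(esum_cell (h := fun=> f x)).
rewrite (ge0_integral_esum (I := 'cV[int]_d))//; last 2 first.
- by move=> z; apply: emeasurable_funM => //; apply/measurable_EFinP; exact: measurable_cell.
- by move=> z x; rewrite mule_ge0// lee_fin ler0n.
apply: eq_esum => z _; rewrite integral_mkcond.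
have mg : measurable_fun setT (fun x => f x * (cell z x)%:E)%E.
  by apply: emeasurable_funM => //; apply/measurable_EFinP; exact: measurable_cell.
apply/esym; etransitivity.
  apply/esym; apply: (ge0_integral_translate (A *m ivec z) mg) => x.
  by rewrite mule_ge0// lee_fin ler0n.
apply: eq_integral => x _; rewrite cellE addrK patchE indicE.
by case: ifPn => _; rewrite ?mule1 ?mule0.
Qed.

End cells.

(** * Densities: from indicators to nonnegative functions *)

Section sum_density.
Local Open Scope ereal_scope.
Import HBNNSimple.
Context {R : realType} d1 d2 (X : measurableType d1) (Y : measurableType d2).
Variables (m : {measure set X -> \bar R}) (mu : {measure set Y -> \bar R}).
Variables (I : Type) (r : seq I) (phi : I -> X -> Y) (rho : Y -> R).
Hypothesis mphi : forall i, measurable_fun setT (phi i).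
Hypothesis mrho : measurable_fun setT rho.
Hypothesis rho0 : forall y, (0 <= rho y)%R.
Hypothesis mrhoE : forall B, measurable B ->
  \int[m]_x (\sum_(i <- r) (\1_B (phi i x))%:E) = \int[mu]_(y in B) (rho y)%:E.

(** Linearity extends the hypothesis from indicators to simple functions, monotone convergence to
    [h]. The finite family [phi] is there for the factorial moment measures of a point process; a
    family of one map gives the density of the torus measure. *)
Lemma ge0_integral_sum_density (h : Y -> \bar R) :
  measurable_fun setT h -> (forall y, 0 <= h y) ->
  \int[m]_x (\sum_(i <- r) h (phi i x)) = \int[mu]_y (h y * (rho y)%:E).
Proof.
move=> mh h0; pose h_ := nnsfun_approx measurableT mh.
have mrho' : measurable_fun setT (EFin \o rho) by exact/measurable_EFinP.
have mhn n : measurable_fun setT (fun y => (h_ n y)%:E).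
  exact/measurable_EFinP/measurable_funP.
have nd y : {homo (fun n => (h_ n y)%:E) : a b / (a <= b)%N >-> a <= b}.
  by move=> a b ab; rewrite lee_fin; exact/lefP/nd_nnsfun_approx.
have hcvg y : (h_ n y)%:E @[n --> \oo] --> h y.
  by apply: cvg_nnsfun_approx => // t _; exact: h0.
have Lcvg : \int[m]_x (\sum_(i <- r) (h_ n (phi i x))%:E) @[n --> \oo] -->
    \int[m]_x (\sum_(i <- r) h (phi i x)).
  have -> : (fun x => \sum_(i <- r) h (phi i x)) =
      fun x => limn (fun n => \sum_(i <- r) (h_ n (phi i x))%:E).
    apply/funext => x; apply/esym/cvg_lim => //.
    by apply: cvg_nnesum => i _; [apply: nearW => n; rewrite lee_fin|exact: hcvg].
  apply: cvg_monotone_convergence => //.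
  - move=> n; apply: emeasurable_sum => i.
    exact: (measurableT_comp (mhn n) (mphi i)).
  - by move=> n x _; apply: sume_ge0 => i _; rewrite lee_fin.
  - by move=> x _ a b ab; apply: lee_sum => i _; exact: nd.
have Rcvg : \int[mu]_y ((h_ n y)%:E * (rho y)%:E) @[n --> \oo] -->
    \int[mu]_y (h y * (rho y)%:E).
  have -> : (fun y => h y * (rho y)%:E) =
      fun y => limn (fun n => (h_ n y)%:E * (rho y)%:E).
    apply/funext => y; apply/esym/cvg_lim => //.
    by apply: cvgeZr => //; exact: hcvg.
  apply: cvg_monotone_convergence => //.
  - by move=> n; exact: emeasurable_funM.
  - by move=> n y _; rewrite mule_ge0// lee_fin.
  - by move=> y _ a b ab; rewrite lee_wpmul2r ?lee_fin//; exact: nd.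
rewrite -(cvg_lim _ Lcvg)// -(cvg_lim _ Rcvg)//; congr (limn _).
apply/funext => n.
pose s : seq R := finmap.enum_fset (fset_set (range (h_ n))).
pose B k := h_ n @^-1` [set k].
have mB k : measurable (B k) by exact: measurable_funPTI.
have s0 k : k \in s -> (0 <= k)%R.
  move=> ks; have : k \in fset_set (range (h_ n)) by exact: ks.
  by rewrite in_fset_set// => /set_mem[y _ <-].
have hE y : (h_ n y = \sum_(k <- s) k * \1_(B k) y)%R.
  by rewrite [LHS]fimfunE fsbig_finite.
have kB0 k y : (0 <= (k * \1_(B k) y)%:E) by exact: nnfun_muleindic_ge0.
have mkB k : measurable_fun setT (fun y => (k * \1_(B k) y)%:E).
  by apply/measurable_EFinP; apply: measurable_funM.
transitivity (\sum_(k <- s) k%:E * \int[m]_x (\sum_(i <- r) (\1_(B k) (phi i x))%:E)).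
  rewrite [LHS](_ : _ = \int[m]_x (\sum_(k <- s)
      (\sum_(i <- r) (k * \1_(B k) (phi i x))%:E))); last first.
    apply: eq_integral => x _; rewrite exchange_big/=; apply: eq_bigr => i _.
    by rewrite hE sumEFin.
  rewrite ge0_integral_sum//; last 2 first.
  - by move=> k; apply: emeasurable_sum => i; exact: (measurableT_comp (mkB k) (mphi i)).
  - by move=> k x _; exact: sume_ge0.
  rewrite !big_seq; apply: eq_bigr => k ks.
  rewrite -ge0_integralZl//; last 3 first.
  - apply: emeasurable_sum => i.
    have m1 : measurable_fun setT (fun y => (\1_(B k) y)%:E : \bar R).
      by apply/measurable_EFinP; exact: measurable_indic.
    exact: (measurableT_comp m1 (mphi i)).
  - by move=> x _; apply: sume_ge0 => i _; rewrite lee_fin.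
  - by rewrite lee_fin s0.
  apply: eq_integral => x _; rewrite ge0_sume_distrr//.
rewrite [RHS](_ : _ = \int[mu]_y (\sum_(k <- s) (k%:E * (\1_(B k) y * rho y)%:E))); last first.
  apply: eq_integral => y _; rewrite -EFinM hE mulr_suml -sumEFin.
  by apply: eq_bigr => k _; rewrite -mulrA EFinM.
rewrite ge0_integral_sum//; last 2 first.
- move=> k; apply: measurable_funeM; apply/measurable_EFinP.
  by apply: measurable_funM.
- by move=> k y _; rewrite -EFinM mulrA EFinM mule_ge0// lee_fin.
rewrite !big_seq; apply: eq_bigr => k ks.
rewrite mrhoE// ge0_integralZl//; last 3 first.
- by apply/measurable_EFinP; apply: measurable_funM.
- by move=> y _; rewrite lee_fin mulr_ge0.
- by rewrite lee_fin s0.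
congr (_ * _); rewrite integral_mkcond; apply: eq_integral => y _.
by rewrite patchE indicE; case: ifPn; rewrite ?mul1r ?mul0r.
Qed.

End sum_density.

(** * Integration on the flat torus *)

Section torus.
Context {R : realType} {d : nat}.
Variable A : 'M[R]_d.
Hypothesis Au : A \in unitmx.
Local Notation lam := (@lebesgue_cV R d).
Local Notation tor := (torus_measure Au).

Let covol_gt0 : 0 < covolume A.
Proof. by rewrite normr_gt0 -unitfE -unitmxE. Qed.

Lemma ge0_integral_torus (f : 'cV[R]_d -> \bar R) :
  measurable_fun setT f -> (forall x, 0 <= f x)%E ->
  (\int[tor]_x f x =
   (covolume A)^-1%:E * \int[lam]_(x in fundamental_domain A) f x)%E.
Proof.
move=> mf f0; have mF := measurable_fundamental_domain Au.
have c0 : 0 <= (covolume A)^-1 by rewrite invr_ge0 ltW.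
pose rho (x : 'cV[R]_d) : R := (covolume A)^-1 * \1_(fundamental_domain A) x.
have mrho : measurable_fun setT rho by apply: measurable_funM.
have rho0 x : 0 <= rho x by rewrite mulr_ge0.
have := @ge0_integral_sum_density R _ _ _ _ tor lam unit [:: tt] (fun=> id) rho
  _ mrho rho0 _ f mf f0.
under eq_integral do rewrite big_seq1.
move=> -> //; last first.
  move=> B mB; under eq_integral do rewrite big_seq1.
  rewrite integral_indic// setIT/= /rho.
  under [RHS]eq_integral do rewrite EFinM.
  rewrite ge0_integralZl//; last first.
    by apply/measurable_EFinP; exact: measurable_indic.
  rewrite integral_indic// /mnormalize /= /mrestr setTI.
  rewrite lebesgue_fundamental_domain//= eqe gt_eqF// muleC setIC.
  by [].
under eq_integral => x _ do rewrite /rho EFinM muleCA.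
rewrite ge0_integralZl//; last 2 first.
- apply: emeasurable_funM => //.
  by apply/measurable_EFinP; exact: measurable_indic.
- by move=> x _; rewrite mule_ge0// lee_fin.
congr (_ * _)%E; rewrite [RHS]integral_mkcond; apply: eq_integral => x _.
by rewrite patchE indicE; case: ifPn; rewrite ?mule1 ?mule0.
Qed.

(** Exactly one lattice translate of [x] falls in the fundamental domain. Read from right to left,
    it inserts a partition of unity. *)
Lemma esum_lattice_fundamental (c : \bar R) x : (0 <= c)%E ->
  (\esum_(v in lattice A) (c * (\1_(fundamental_domain A) (x + v)%R)%:E) = c)%E.
Proof.
move=> c0; rewrite esum_lattice//.
pose z0 := - vfloor (invmx A *m x).
have xz z : x + A *m ivec z = x - A *m ivec (- z).
  by rewrite ivecN mulmxN opprK.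
rewrite (@esum_eq1 _ _ _ z0)//.
- rewrite indicE mem_set ?mule1//= xz.
  by apply/fundamental_domainP => //; rewrite opprK.
- by rewrite mule_ge0// lee_fin.
- move=> z _ zz0; rewrite indicE memNset ?mule0// => /=.
  rewrite xz => /fundamental_domainP-/(_ Au) h.
  by move: zz0; rewrite /z0 h opprK eqxx.
Qed.

Definition periodic_lattice (T : Type) (f : 'cV[R]_d -> T) :=
  forall x v, lattice A v -> f (x + v) = f x.

(** A partition of unity moved by [a] turns the left side into a sum over the lattice, which unfolds
    to an integral over the whole space; there translation by [a] is harmless. *)
Lemma ge0_integral_torus_translate (a : 'cV[R]_d) (f : 'cV[R]_d -> \bar R) :
  measurable_fun setT f -> (forall x, 0 <= f x)%E -> periodic_lattice f ->
  (\int[tor]_x f (x + a)%R = \int[tor]_x f x)%E.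
Proof.
move=> mf f0 pf; have mF := measurable_fundamental_domain Au.
have mxa : measurable_fun setT (fun x : 'cV[R]_d => x + a) by exact: measurable_cVD.
have mfa : measurable_fun setT (fun x : 'cV[R]_d => f (x + a)).
  exact: (measurableT_comp mf mxa).
rewrite !ge0_integral_torus//; congr (_ * _)%E.
pose h (x : 'cV[R]_d) : \bar R := (f (x + a)%R * (\1_(fundamental_domain A) (x + a)%R)%:E)%E.
have m1 : measurable_fun setT (fun x => (\1_(fundamental_domain A) x)%:E : \bar R).
  by apply/measurable_EFinP; exact: measurable_indic.
have mh : measurable_fun setT h.
  by apply: emeasurable_funM => //; exact: (measurableT_comp m1 mxa).
have h0 x : (0 <= h x)%E by rewrite mule_ge0// lee_fin.
transitivity (\int[lam]_(x in fundamental_domain A)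
    \esum_(v in lattice A) h (x + v)%R)%E.
  apply: eq_integral => x _; rewrite -[LHS](esum_lattice_fundamental (x + a))//.
  by apply: eq_esum => v Av; rewrite /h [x + v + a]addrAC [f (x + a + v)]pf.
rewrite ge0_integral_unfold//.
transitivity (\int[lam]_x (f x * (\1_(fundamental_domain A) x)%:E))%E.
  apply: (@ge0_integral_translate R d a
    (fun x => f x * (\1_(fundamental_domain A) x)%:E)%E).
    exact: emeasurable_funM.
  by move=> x; rewrite mule_ge0// lee_fin.
rewrite [RHS]integral_mkcond; apply: eq_integral => x _.
by rewrite patchE indicE; case: ifPn; rewrite ?mule1 ?mule0.
Qed.

(** The periodic weight can be moved inside the lattice sum, translated along with each term; after
    unfolding, the shift by [y] disappears. *)
Lemma ge0_integral_torus_unfold (y : 'cV[R]_d) (g : 'cV[R]_d -> \bar R)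
    (phi : 'cV[R]_d -> R) :
  measurable_fun setT g -> (forall x, 0 <= g x)%E ->
  measurable_fun setT phi -> (forall x, 0 <= phi x) -> periodic_lattice phi ->
  (\int[tor]_x ((\esum_(v in lattice A) g (x - y + v)%R) * (phi (x - y)%R)%:E) =
   (covolume A)^-1%:E * \int[lam]_x (g x * (phi x)%:E))%E.
Proof.
move=> mg g0 mphi phi0 pphi; have mF := measurable_fundamental_domain Au.
pose F x := (g (x - y)%R * (phi (x - y)%R)%:E)%E.
have mxy (a : 'cV[R]_d) : measurable_fun setT (fun x : 'cV[R]_d => x + a).
  exact: measurable_cVD.
have mphi' : measurable_fun setT (EFin \o phi) by exact/measurable_EFinP.
have mF' : measurable_fun setT F.
  by apply: emeasurable_funM;
    [exact: (measurableT_comp mg (mxy _))|exact: (measurableT_comp mphi' (mxy _))].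
have F0 x : (0 <= F x)%E by rewrite mule_ge0// lee_fin.
have gphi0 x : (0 <= g x * (phi x)%:E)%E by rewrite mule_ge0// lee_fin.
have FE x : ((\esum_(v in lattice A) g (x - y + v)%R) * (phi (x - y)%R)%:E =
    \esum_(v in lattice A) F (x + v)%R)%E.
  rewrite !esum_lattice// muleC -esumZl//; apply: eq_esum => z _.
  rewrite /F [x + _ - y]addrAC [phi (x - y + _)]pphi 1?muleC//.
  by apply/latticeP; exists z.
under eq_integral do rewrite FE.
rewrite ge0_integral_torus; last 2 first.
- under eq_fun do rewrite esum_lattice//.
  apply: measurable_esum => // z; exact: (measurableT_comp mF' (mxy _)).
- by move=> x; exact: esum_ge0.
congr (_ * _)%E; rewrite ge0_integral_unfold//.
apply: (@ge0_integral_translate R d (- y) (fun x => g x * (phi x)%:E)%E) => //.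
exact: emeasurable_funM.
Qed.

(** The phase absorbs translations of [x], turns 1 - cos into 1 + cos (phase pi), and carries the
    coordinates already treated in inductions on the dimension. *)
Definition torus_cos (w : 'cV[R]_d) (theta : R) (x : 'cV[R]_d) : R :=
  cos (2 * pi * dotv x w + theta).

Lemma dotvDl (x y w : 'cV[R]_d) : dotv (x + y) w = dotv x w + dotv y w.
Proof. by rewrite -big_split/=; apply: eq_bigr => i _; rewrite mxE mulrDl. Qed.

Lemma dotvNl (x w : 'cV[R]_d) : dotv (- x) w = - dotv x w.
Proof. by rewrite -sumrN; apply: eq_bigr => i _; rewrite mxE mulNr. Qed.

Lemma dotvC (x w : 'cV[R]_d) : dotv x w = dotv w x.
Proof. by apply: eq_bigr => i _; rewrite mulrC. Qed.

Lemma dotvZl (a : R) (x w : 'cV[R]_d) : dotv (a *: x) w = a * dotv x w.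
Proof. by rewrite mulr_sumr; apply: eq_bigr => i _; rewrite mxE mulrA. Qed.

Lemma dotv_ge0 (x : 'cV[R]_d) : 0 <= dotv x x.
Proof. by apply: sumr_ge0 => i _; rewrite -expr2 sqr_ge0. Qed.

Lemma dotv_eq0 (x : 'cV[R]_d) : (dotv x x == 0) = (x == 0).
Proof.
apply/eqP/eqP => [|->]; last by rewrite /dotv big1// => i _; rewrite mxE mul0r.
move=> /eqP; rewrite psumr_eq0 => [/allP h|i _]; last by rewrite -expr2 sqr_ge0.
apply/matrixP => i j; rewrite (ord1 j) !mxE.
by have := h i (mem_index_enum i); rewrite /= mulf_eq0 orbb => /eqP.
Qed.

Lemma cosD2pin (a : R) (n : nat) : cos (a + 2 * pi * n%:R) = cos a.
Proof. by rewrite -(periodicn (@cosD2pi R) n a); congr cos; rewrite -mulr_natr; ring. Qed.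

Lemma cosD2piz (a : R) (k : R) : k \is a Num.int -> cos (a + 2 * pi * k) = cos a.
Proof.
move=> /intrP[z ->]; case: z => n; first by rewrite cosD2pin.
rewrite NegzE mulrNz mulrN -[RHS](cosD2pin _ n.+1).
by rewrite -[in RHS](subrK (2 * pi * n.+1%:R) a) cosD2pin cosD2pin.
Qed.

Lemma torus_cos_periodic w theta : dual_lattice A w ->
  periodic_lattice (torus_cos w theta).
Proof.
move=> dw x v Av; rewrite /torus_cos dotvDl mulrDr addrAC cosD2piz//.
by rewrite dotvC; exact: dw.
Qed.

Lemma measurable_torus_cos w theta : measurable_fun setT (torus_cos w theta).
Proof.
have mc : measurable_fun setT (@cos R).
  by apply: continuous_measurable_fun; exact: continuous_cos.
apply: (measurableT_comp mc); apply: measurable_funD => //.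
by apply: measurable_funM => //; exact: measurable_dotv.
Qed.

Lemma integrable_torus_cos w theta : tor.-integrable setT (EFin \o torus_cos w theta).
Proof.
apply: measurable_bounded_integrable => //.
- by rewrite [X in (X < _)%E](@probability_setT _ _ _ tor) ltry.
- exact: measurable_torus_cos.
- exists 1; split => //= M M1 x _; apply: le_trans (ltW M1); exact: cos_max.
Qed.

(* For w != 0, translating by w / (2 |w|^2) changes the sign of the cosine. *)
Lemma integral_torus_cos w theta : dual_lattice A w ->
  (\int[tor]_x (torus_cos w theta x)%:E = ((w == 0)%:R * cos theta)%:E)%E.
Proof.
move=> dw; have [->|w0] := eqVneq w 0.
  rewrite mul1r -[RHS]mule1 -(probability_setT tor) -integral_cst//.
  apply: eq_integral => x _; congr (cos _)%:E; rewrite /dotv big1 ?mulr0 ?add0r//.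
  by move=> i _; rewrite mxE mulr0.
rewrite mul0r; pose a := (2 * dotv w w)^-1 *: w.
have ww0 : dotv w w != 0 by rewrite dotv_eq0.
have shift x : torus_cos w theta (x + a) = - torus_cos w theta x.
  rewrite /torus_cos dotvDl dotvZl -cosDpi; congr cos; field.
  by [].
have p1 x : (0 <= (1 + torus_cos w theta x)%:E)%E.
  by rewrite lee_fin -lerBlDl sub0r; exact: cos_geN1.
have m1 : measurable_fun setT (fun x => (1 + torus_cos w theta x)%:E).
  by apply/measurable_EFinP; apply: measurable_funD => //; exact: measurable_torus_cos.
have pp : periodic_lattice (fun x => (1 + torus_cos w theta x)%:E).
  by move=> x v Av; rewrite torus_cos_periodic.
have := ge0_integral_torus_translate a m1 p1 pp.
under eq_integral do rewrite shift EFinD EFinN.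
under [RHS]eq_integral do rewrite EFinD.
have ic := integrable_torus_cos w theta.
have i1 : tor.-integrable setT (cst 1%E) by exact: finite_measure_integrable_cst.
rewrite [X in X = _ -> _](@integralB _ _ _ tor setT measurableT (cst 1%E)
  (EFin \o torus_cos w theta) i1 ic).
rewrite [X in _ = X -> _](@integralD _ _ _ tor setT measurableT (cst 1%E)
  (EFin \o torus_cos w theta) i1 ic).
have -> : (\int[tor]_x cst 1 x = 1)%E.
  rewrite integral_cst// [X in (_ * X)%E](@probability_setT _ _ _ tor).
  by rewrite mule1.
have : (\int[tor]_x (torus_cos w theta x)%:E)%E \is a fin_num.
  exact: integrable_fin_num ic.
rewrite /comp; case: (\int[tor]_x _)%E => // r _ /=.
by move=> -[] h; congr EFin; lra.
Qed.

Let has_mean (f : 'cV[R]_d -> R) (a : R) :=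
  tor.-integrable setT (EFin \o f) /\ (\int[tor]_x (f x)%:E = a%:E)%E.

Let has_meanD f g a b r : has_mean f a -> has_mean g b ->
  has_mean (fun x => f x + r * g x) (a + r * b).
Proof.
move=> [fi fa] [gi gb].
have rgi : tor.-integrable setT (fun x => r%:E * (g x)%:E)%E by exact: integrableZl.
have E : (EFin \o (fun x => f x + r * g x)) = (EFin \o f \+ (fun x => r%:E * (g x)%:E))%E.
  by apply/funext => x /=; rewrite EFinD EFinM.
split; first by rewrite E; exact: integrableD.
rewrite [LHS](@integralD _ _ _ tor setT measurableT (EFin \o f) _ fi rgi) fa.
rewrite [X in (_ + X)%E](@integralZl _ _ _ tor setT measurableT (EFin \o g) gi r).
by rewrite gb.
Qed.

(** Linearizing the product of cosines leaves pure cosines of frequencies [w], [u], [w + u] and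
    [w - u], of which only a zero frequency has a nonzero mean. *)
Lemma integral_torus_cos2 (y w u : 'cV[R]_d) :
  dual_lattice A w -> dual_lattice A u -> w != 0 -> u != 0 ->
  (\int[tor]_x ((1 + torus_cos w 0 (x - y)%R) * (1 - torus_cos u 0 (x - y)%R))%:E
   = (1 - (w == u)%:R / 2 - (w == - u)%:R / 2)%:E)%E.
Proof.
move=> dw du w0 u0.
pose c v := torus_cos v (- (2 * pi * dotv y v)).
have cE v x : torus_cos v 0 (x - y) = c v x.
  by rewrite /c /torus_cos dotvDl dotvNl; congr cos; ring.
have dD v v' : dotv y (v + v') = dotv y v + dotv y v'.
  by rewrite !(dotvC y) dotvDl.
have dN v : dotv y (- v) = - dotv y v by rewrite !(dotvC y) dotvNl.
have prod x : (1 + c w x) * (1 - c u x) =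
    1 + 1 * c w x + -1 * c u x + - 2^-1 * c (w + u) x + - 2^-1 * c (w - u) x.
  have cc : 2 * (c w x * c u x) = c (w + u) x + c (w - u) x.
    rewrite /c /torus_cos !(dotvC x) !dD !dotvDl dN dotvNl.
    set a := 2 * pi * dotv w x + _; set b := 2 * pi * dotv u x + _.
    rewrite (_ : 2 * pi * (dotv w x + dotv u x) + _ = a + b); last by rewrite /a /b; ring.
    rewrite (_ : 2 * pi * (dotv w x - dotv u x) + _ = a - b); last by rewrite /a /b; ring.
    by rewrite (cosD a b) (cosB a b); ring.
  by lra.
have dN' v : dual_lattice A v -> dual_lattice A (- v).
  by move=> dv x Ax; rewrite dotvNl rpredN; exact: dv.
have dD' v v' : dual_lattice A v -> dual_lattice A v' -> dual_lattice A (v + v').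
  by move=> dv dv' x Ax; rewrite dotvDl; apply: rpredD; [exact: dv|exact: dv'].
have mc v : dual_lattice A v -> has_mean (c v) (v == 0)%:R.
  move=> dv; split; first exact: integrable_torus_cos.
  rewrite integral_torus_cos//; have [->|] := eqVneq v 0; last by rewrite mul0r.
  by rewrite (_ : dotv y 0 = 0) ?mulr0 ?oppr0 ?cos0 ?mulr1// dotvC /dotv big1// => i _;
    rewrite mxE mul0r.
have m1 : has_mean (cst 1) 1.
  split; first exact: finite_measure_integrable_cst.
  have := @integral_cst _ _ _ tor setT measurableT 1%E.
  by rewrite [X in (_ * X)%E](@probability_setT _ _ _ tor) mule1.
under eq_integral do rewrite !cE prod.
have [_ ->] := has_meanD (- 2^-1) (has_meanD (- 2^-1) (has_meanD (-1)
  (has_meanD 1 m1 (mc w dw)) (mc u du)) (mc _ (dD' _ _ dw du)))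
  (mc _ (dD' _ _ dw (dN' _ du))).
rewrite (negbTE w0) (negbTE u0) subr_eq0 addr_eq0; congr EFin; lra.
Qed.

End torus.

(** * Fourier transform of Gaussians *)

Section gauss_fourier.
Context {R : realType}.
Local Notation mu := (@lebesgue_measure R).

Lemma integral_gauss_scaled (c : R) : 0 < c ->
  (\int[mu]_x (expR (- (x ^+ 2 * c)))%:E = (Num.sqrt (pi / c))%:E)%E.
Proof.
move=> c0; have sc0 : 0 < Num.sqrt c by rewrite sqrtr_gt0.
have mg : measurable_fun setT (fun x : R => (gauss_fun x)%:E).
  by apply/measurable_EFinP; exact: measurable_gauss_fun.
have := @ge0_integral_affine R (Num.sqrt c) 0 (fun x => (gauss_fun x)%:E)
   (lt0r_neq0 sc0) mg (fun x => gauss_fun_ge0 x).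
rewrite integralT_gauss => h; transitivity (`|Num.sqrt c|^-1%:E * (Num.sqrt pi)%:E : \bar R)%E.
  rewrite -h; apply: eq_integral => x _; rewrite /gauss_fun addr0 exprMn.
  by rewrite sqr_sqrtr ?ltW// mulrC.
by rewrite -EFinM gtr0_norm// sqrtrM ?pi_ge0// sqrtrV ?(ltW c0)// mulrC.
Qed.

Lemma integrable_gauss_scaled (c : R) : 0 < c ->
  mu.-integrable setT (fun x => (expR (- (x ^+ 2 * c)))%:E).
Proof.
move=> c0; apply/integrableP; split.
  apply/measurable_EFinP; apply: measurableT_comp => //.
  by apply: measurableT_comp => //; exact: measurable_funM.
under eq_integral do rewrite gee0_abs ?lee_fin ?expR_ge0//.
by rewrite integral_gauss_scaled// ltry.
Qed.

Lemma gauss_moment_le (y : R) : `|y| * expR (- y ^+ 2) <= expR (- (y ^+ 2 * 2^-1)).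
Proof.
have h : `|y| <= expR (y ^+ 2 * 2^-1).
  apply: le_trans (expR_ge1Dx _); rewrite -[y ^+ 2]real_normK ?num_real//.
  have : 0 <= (`|y| - 1) ^+ 2 by exact: sqr_ge0.
  by rewrite sqrrB1 -mulr_natr; lra.
apply: le_trans (ler_wpM2r (expR_ge0 _) h) _.
by rewrite -expRD ler_expR; lra.
Qed.

Let integrable_dom (h : R -> R) (C c : R) : 0 < c -> measurable_fun setT h ->
  (forall x, `|h x| <= C * expR (- (x ^+ 2 * c))) ->
  mu.-integrable setT (EFin \o h).
Proof.
move=> c0 mh hC.
apply: (@le_integrable _ _ _ mu setT measurableT _
  (fun x => C%:E * (expR (- (x ^+ 2 * c)))%:E)%E).
- exact/measurable_EFinP.
- move=> x _; rewrite -EFinM !abse_EFin lee_fin; apply: le_trans (hC x) _.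
  exact: ler_norm.
- by apply: integrableZl => //; exact: integrable_gauss_scaled.
Qed.

Let gauss_cos (w x : R) := expR (- x ^+ 2) * cos (w * x).

Let gauss_xsin (w x : R) := expR (- x ^+ 2) * (x * sin (w * x)).

Let meas_cos : measurable_fun setT (@cos R).
Proof. by apply: continuous_measurable_fun; exact: continuous_cos. Qed.

Let meas_sin : measurable_fun setT (@sin R).
Proof. by apply: continuous_measurable_fun; exact: continuous_sin. Qed.

Let meas_gauss : measurable_fun setT (fun x : R => expR (- x ^+ 2)).
Proof. exact: measurable_gauss_fun. Qed.

Let meas_gauss_cos w : measurable_fun setT (gauss_cos w).
Proof.
apply: measurable_funM => //; apply: (measurableT_comp meas_cos).
exact: measurable_funM.
Qed.

Let meas_gauss_xsin w : measurable_fun setT (gauss_xsin w).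
Proof.
apply: measurable_funM => //; apply: measurable_funM => //.
by apply: (measurableT_comp meas_sin); exact: measurable_funM.
Qed.

Let int_gauss_cos w : mu.-integrable setT (EFin \o gauss_cos w).
Proof.
apply: (@integrable_dom _ 1 1) => // x; rewrite mul1r mulr1 normrM.
by rewrite ger0_norm ?expR_ge0// ler_piMr ?expR_ge0//; exact: cos_max.
Qed.

Let gauss_xsin_le w x : `|gauss_xsin w x| <= expR (- (x ^+ 2 * 2^-1)).
Proof.
apply: le_trans (gauss_moment_le x); rewrite !normrM mulrCA.
rewrite (ger0_norm (expR_ge0 _)) mulrA ler_piMr ?mulr_ge0 ?expR_ge0//.
exact: sin_max.
Qed.

Let int_gauss_xsin w : mu.-integrable setT (EFin \o gauss_xsin w).
Proof.
apply: (@integrable_dom _ 1 2^-1) => // x.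
by rewrite mul1r; exact: gauss_xsin_le.
Qed.

Let G w := (\int[mu]_x gauss_cos w x)%R.

Let is_derive_gauss_cos x w :
  is_derive w (1 : R) (fun w => gauss_cos w x) (- gauss_xsin w x).
Proof.
rewrite /gauss_cos /gauss_xsin.
apply: trigger_derive; rewrite /GRing.scale/=; ring.
Qed.

(** Differentiation under the integral sign, with the majorant of [gauss_moment_le], which does not
    depend on [w]. *)
Let derive_G w : is_derive w (1 : R) G (- (\int[mu]_x gauss_xsin w x)%R).
Proof.
have I0 : `]w - 1, w + 1[%classic w by rewrite /= in_itv/=; apply/andP; split; lra.
have d1 a x : partial1of2 gauss_cos a x = - gauss_xsin a x.
  by rewrite partial1of2E; have := is_derive_gauss_cos x a => /@derive_val ->.
have i2 : mu.-integrable setT (EFin \o (fun x : R => expR (- (x ^+ 2 * 2^-1)))).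
  by apply: integrable_gauss_scaled; rewrite invr_gt0.
have ub a x : `]w - 1, w + 1[%classic a -> setT x ->
    `|partial1of2 gauss_cos a x| <= expR (- (x ^+ 2 * 2^-1)).
  by move=> _ _; rewrite d1 normrN gauss_xsin_le.
have df a x : `]w - 1, w + 1[%classic a -> setT x -> derivable (gauss_cos ^~ x) a 1.
  by move=> _ _; have := is_derive_gauss_cos x a => /@ex_derive.
apply: DeriveDef.
  exact: (derivable_under_integral measurableT I0 (fun a _ => int_gauss_cos a)
     df (fun=> expR_ge0 _) i2 ub).
rewrite -derive1E (differentiation_under_integral measurableT I0 (fun a _ => int_gauss_cos a)
     df (fun=> expR_ge0 _) i2 ub).
under eq_Rintegral do rewrite d1.
rewrite -mulN1r -RintegralZl//.
by apply: eq_Rintegral => x _; rewrite mulN1r.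
Qed.

Let integral_isometry (s a : R) (f : R -> \bar R) : `|s| = 1 ->
  measurable_fun setT f -> (\int[mu]_x f (s * x + a)%R = \int[mu]_x f x)%E.
Proof.
move=> s1 mf; have ge0_shift g : measurable_fun setT g -> (forall x, 0 <= g x)%E ->
    (\int[mu]_x g (s * x + a)%R = \int[mu]_x g x)%E.
  move=> mg g0; have s0 : s != 0 by rewrite -normr_eq0 s1 oner_eq0.
  by have := ge0_integral_affine a s0 mg g0; rewrite s1 invr1 mul1e.
rewrite integralE [RHS]integralE; congr (_ - _)%E.
  rewrite -(ge0_shift _ (measurable_funepos mf) (funepos_ge0 f)).
  by apply: eq_integral => x _; rewrite !funeposE.
rewrite -(ge0_shift _ (measurable_funeneg mf) (funeneg_ge0 f)).
by apply: eq_integral => x _; rewrite !funenegE.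
Qed.

Let integral_shift (a : R) (f : R -> \bar R) : measurable_fun setT f ->
  (\int[mu]_x f (x + a)%R = \int[mu]_x f x)%E.
Proof.
move=> mf; rewrite -(integral_isometry a (normr1 R) mf).
by apply: eq_integral => x _; rewrite mul1r.
Qed.

Let gauss_sin (w x : R) := expR (- x ^+ 2) * sin (w * x).

Let dgauss_sin (w x : R) := - 2 * gauss_xsin w x + w * gauss_cos w x.

Let is_derive_gauss_sin w x a :
  is_derive a (1 : R) (fun a => gauss_sin w (x + a)) (dgauss_sin w (x + a)).
Proof.
rewrite /gauss_sin /dgauss_sin /gauss_cos /gauss_xsin.
apply: trigger_derive; rewrite /GRing.scale/=; ring.
Qed.

Let int_gauss_sin w : mu.-integrable setT (EFin \o gauss_sin w).
Proof.
apply: (@integrable_dom _ 1 1) => //.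
  by apply: measurable_funM => //; apply: (measurableT_comp meas_sin); exact: measurable_funM.
move=> x; rewrite mul1r mulr1 normrM.
by rewrite ger0_norm ?expR_ge0// ler_piMr ?expR_ge0//; exact: sin_max.
Qed.

Let dgauss_sin_le w a x : -1 < a < 1 ->
  `|dgauss_sin w (x + a)| <= (2 + `|w|) * expR 2^-1 * expR (- (x ^+ 2 * 4^-1)).
Proof.
move=> /andP[a1 a2]; set y := x + a.
(* A majorant uniform in the translation, from (x + a)^2 / 2 = x^2 / 4 + (x + 2 a)^2 / 4 - a^2 / 2
   and a^2 <= 1. *)
have yx : expR (- (y ^+ 2 * 2^-1)) <= expR 2^-1 * expR (- (x ^+ 2 * 4^-1)).
  rewrite -expRD ler_expR /y; have := sqr_ge0 (x + 2 * a).
  by nra.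
apply: (@le_trans _ _ ((2 + `|w|) * expR (- (y ^+ 2 * 2^-1)))); last first.
  by rewrite -mulrA ler_wpM2l// addr_ge0.
rewrite /dgauss_sin; apply: le_trans (ler_normD _ _) _.
rewrite mulrDl lerD//.
  by rewrite mulNr normrN normrM (ger0_norm (ler0n _ 2)) ler_wpM2l//; exact: gauss_xsin_le.
rewrite normrM ler_wpM2l// /gauss_cos normrM ger0_norm ?expR_ge0//.
rewrite -[leRHS]mulr1 ler_pM ?expR_ge0//; last exact: cos_max.
by rewrite ler_expR; have := sqr_ge0 y; lra.
Qed.

(* The integral of a derivative vanishes: differentiate the translation-invariant
   integral of the translates of the primitive. *)
Let integral_dgauss_sin w : (\int[mu]_x dgauss_sin w x = 0)%R.
Proof.
pose f a x := gauss_sin w (x + a).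
have I0 : `](-1 : R), 1[%classic 0 by rewrite /= in_itv/=; apply/andP; split; lra.
have d1 a x : partial1of2 f a x = dgauss_sin w (x + a).
  by rewrite partial1of2E; have := is_derive_gauss_sin w x a => /@derive_val ->.
have mf a : measurable_fun setT (f a).
  have := @measurable_int _ _ _ mu setT _ (int_gauss_sin w) => /measurable_EFinP m.
  by apply: (measurableT_comp m); exact: measurable_funD.
have iff a : mu.-integrable setT (EFin \o f a).
  apply/integrableP; split; first by apply/measurable_EFinP; exact: mf.
  have /integrableP[m] := int_gauss_sin w.
  rewrite -(integral_shift a)//; exact: measurableT_comp.
have i2 : mu.-integrable setT (EFin \o (fun x : R =>
    (2 + `|w|) * expR 2^-1 * expR (- (x ^+ 2 * 4^-1)))).
  apply: (@integrable_dom _ ((2 + `|w|) * expR 2^-1) 4^-1) => //.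
    apply: measurable_funM => //; apply: measurableT_comp => //.
    by apply: measurableT_comp => //; exact: measurable_funM.
  by move=> x; rewrite ger0_norm// !mulr_ge0 ?expR_ge0// addr_ge0.
have g0 x : 0 <= (2 + `|w|) * expR 2^-1 * expR (- (x ^+ 2 * 4^-1)).
  by rewrite !mulr_ge0 ?expR_ge0// addr_ge0.
have ub a x : `](-1 : R), 1[%classic a -> setT x ->
    `|partial1of2 f a x| <= (2 + `|w|) * expR 2^-1 * expR (- (x ^+ 2 * 4^-1)).
  by move=> /=; rewrite in_itv/= => a1 _; rewrite d1 dgauss_sin_le.
have df a x : `](-1 : R), 1[%classic a -> setT x -> derivable (f ^~ x) a 1.
  by move=> _ _; have := is_derive_gauss_sin w x a => /@ex_derive.
have := differentiation_under_integral measurableT I0 (fun a _ => iff a) df g0 i2 ub.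
rewrite (_ : (fun a => _) = cst ((\int[mu]_x f 0 x)%R)); last first.
  apply/funext => a; rewrite /Rintegral /f; congr fine.
  have /integrableP[m _] := int_gauss_sin w.
  by rewrite (integral_shift a m) (integral_shift 0 m).
rewrite derive1_cst => /esym; under eq_Rintegral do rewrite d1 addr0.
by [].
Qed.

(** Integration by parts, with the boundary terms hidden in the vanishing integral of the derivative
    of e^(-x^2) sin (w x). *)
Let gauss_ode w : (\int[mu]_x gauss_xsin w x = w / 2 * G w)%R.
Proof.
have := integral_dgauss_sin w; rewrite /dgauss_sin RintegralD//; last 2 first.
- exact: (@integrableZl _ _ _ mu setT measurableT (-2) _ (int_gauss_xsin w)).
- exact: (@integrableZl _ _ _ mu setT measurableT w _ (int_gauss_cos w)).
rewrite RintegralZl// RintegralZl// -/(G w); lra.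
Qed.

(* G solves G' = - (w / 2) G. *)
Let G_closed w : G w = Num.sqrt pi * expR (- (w ^+ 2 / 4)).
Proof.
pose K w := expR (w ^+ 2 / 4) * G w.
have dK x : is_derive x (1 : R) K 0.
  have := derive_G x; rewrite gauss_ode => dG.
  by apply: trigger_derive; rewrite /GRing.scale/=; field.
have := is_derive_0_is_cst w 0 dK.
rewrite /K expr0n mul0r expR0 mul1r => h.
have G0 : G 0 = Num.sqrt pi.
  rewrite /G /Rintegral (_ : (\int[mu]_x _)%E = (Num.sqrt pi)%:E)//.
  rewrite -integralT_gauss; apply: eq_integral => x _.
  by rewrite /gauss_cos mul0r cos0 mulr1.
by rewrite -G0 -h mulrAC -expRD subrr expR0 mul1r.
Qed.

Let integral_gauss_sin w : (\int[mu]_x (gauss_sin w x)%:E = 0)%E.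
Proof.
have ig := int_gauss_sin w; have /integrableP[m _] := ig.
have N1 : `|-1 : R| = 1 by rewrite normrN1.
have := integral_isometry 0 N1 m.
have := integrable_fin_num measurableT ig.
under [X in _ -> X = _ -> _]eq_integral => x _.
  rewrite /= (_ : gauss_sin w (-1 * x + 0) = - gauss_sin w x); last first.
    by rewrite addr0 mulN1r /gauss_sin sqrrN mulrN sinN mulrN.
  rewrite EFinN; over.
rewrite integralN/=; last exact: integrable_add_def.
rewrite /comp; case: (\int[mu]_x _)%E => //= r _ [] h; congr EFin; lra.
Qed.

Let integral_gauss_cos_phase w theta :
  (\int[mu]_x (expR (- x ^+ 2) * (1 + cos (w * x + theta)))%:E =
   (Num.sqrt pi * (1 + expR (- (w ^+ 2 / 4)) * cos theta))%:E)%E.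
Proof.
transitivity (\int[mu]_x ((gauss_fun x)%:E + ((cos theta)%:E * (gauss_cos w x)%:E +
    (- sin theta)%:E * (gauss_sin w x)%:E)))%E.
  apply: eq_integral => x _; rewrite -!EFinM -!EFinD cosD; congr EFin.
  by rewrite /gauss_cos /gauss_sin /gauss_fun; ring.
have iC := @integrableZl _ _ _ mu setT measurableT (cos theta) _ (int_gauss_cos w).
have iS := @integrableZl _ _ _ mu setT measurableT (- sin theta) _ (int_gauss_sin w).
rewrite [LHS](@integralD _ _ _ mu setT measurableT (EFin \o @gauss_fun R) _
  (@integrableT_gauss R) (integrableD measurableT iC iS)).
rewrite [X in (_ + X)%E](@integralD _ _ _ mu setT measurableT _ _ iC iS).
rewrite [X in (_ + (X + _))%E](@integralZl _ _ _ mu setT measurableT _ (int_gauss_cos w)).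
rewrite [X in (_ + (_ + X))%E](@integralZl _ _ _ mu setT measurableT _ (int_gauss_sin w)).
rewrite [X in (_ + (_ + _ * X))%E](integral_gauss_sin w) mule0 adde0.
rewrite [X in (X + _)%E]integralT_gauss.
rewrite [X in (_ + _ * X)%E](_ : _ = (G w)%:E); last first.
  by rewrite /G /Rintegral fineK//; exact: (integrable_fin_num measurableT (int_gauss_cos w)).
by rewrite G_closed -EFinM -EFinD; congr EFin; ring.
Qed.

Lemma ge0_integral_gauss_cos (c w theta : R) : 0 < c ->
  (\int[mu]_x (expR (- (x ^+ 2 * c)) * (1 + cos (w * x + theta)))%:E =
   (Num.sqrt (pi / c) * (1 + expR (- (w ^+ 2 / (4 * c))) * cos theta))%:E)%E.
Proof.
move=> c0; have sc0 : 0 < Num.sqrt c by rewrite sqrtr_gt0.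
pose g y : R := expR (- y ^+ 2) * (1 + cos (w / Num.sqrt c * y + theta)).
have mg : measurable_fun setT (fun x : R => (g x)%:E).
  apply/measurable_EFinP; apply: measurable_funM => //.
  apply: measurable_funD => //; apply: (measurableT_comp meas_cos).
  by apply: measurable_funD => //; exact: measurable_funM.
have g0 y : (0 <= (g y)%:E)%E.
  by rewrite lee_fin mulr_ge0 ?expR_ge0// -lerBlDl sub0r; exact: cos_geN1.
have := ge0_integral_affine 0 (lt0r_neq0 sc0) mg g0.
rewrite integral_gauss_cos_phase gtr0_norm// => h.
transitivity (\int[mu]_x (g (Num.sqrt c * x + 0))%:E)%E.
  apply: eq_integral => x _; rewrite /g addr0 exprMn sqr_sqrtr ?ltW//.
  rewrite [w / _ * _]mulrA divfK ?gt_eqF//.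
  by rewrite [c * _]mulrC.
rewrite h -EFinM sqrtrM ?pi_ge0// sqrtrV ?(ltW c0)//; congr EFin.
rewrite exprMn exprVn sqr_sqrtr ?(ltW c0)// mulrA [_^-1 * Num.sqrt pi]mulrC.
by rewrite invfM [4^-1 * _]mulrC mulrA.
Qed.

End gauss_fourier.

Section gauss_fourier_cV.
Context {R : realType}.
Local Notation mu := (@lebesgue_measure R).
Local Notation lam := (@lebesgue_cV R _).

Lemma enorm_sqr n (x : 'cV[R]_n) : enorm x ^+ 2 = dotv x x.
Proof. by rewrite sqr_sqrtr// dotv_ge0. Qed.

Lemma dotv_col_mx n (x y : R) (u v : 'cV[R]_n) :
  dotv (col_mx x%:M u : 'cV[R]_(1 + n)) (col_mx y%:M v) = x * y + dotv u v.
Proof.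
rewrite /dotv big_split_ord/= big_ord1 !col_mxEu !mxE eqxx !mulr1n; congr (_ + _).
by apply: eq_bigr => i _; rewrite !col_mxEd.
Qed.

Lemma measurable_gauss_cos n (c : R) (w : 'cV[R]_n) theta :
  measurable_fun setT (fun x : 'cV[R]_n =>
    (expR (- (enorm x ^+ 2 * c)) * (1 + torus_cos w theta x))%:E).
Proof.
apply/measurable_EFinP; apply: measurable_funM.
  apply: measurableT_comp => //; apply: measurableT_comp => //.
  by apply: measurable_funM => //; apply: measurable_funX; exact: measurable_enorm.
by apply: measurable_funD => //; exact: measurable_torus_cos.
Qed.

Lemma torus_cosD1_ge0 n (w : 'cV[R]_n) theta x : 0 <= 1 + torus_cos w theta x.
Proof. by rewrite -lerBlDl sub0r; exact: cos_geN1. Qed.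

Lemma gauss_cos_ge0 n (c : R) (w : 'cV[R]_n) theta x :
  (0 <= (expR (- (enorm x ^+ 2 * c)) * (1 + torus_cos w theta x))%:E)%E.
Proof. by rewrite lee_fin mulr_ge0 ?expR_ge0// torus_cosD1_ge0. Qed.

(** The Fourier transform of a Gaussian, by induction on the dimension. A fixed first coordinate
    contributes only a phase to the others, which is why the statement is general in [theta]; the
    added 1 keeps the integrand nonnegative for Tonelli's theorem. *)
Lemma ge0_integral_gauss_cV n (c : R) (w : 'cV[R]_n) theta : 0 < c ->
  (\int[lam]_x (expR (- (enorm x ^+ 2 * c)) * (1 + torus_cos w theta x))%:E =
   (Num.sqrt (pi / c) ^+ n *
    (1 + expR (- (pi ^+ 2 * enorm w ^+ 2 / c)) * cos theta))%:E)%E.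
Proof.
move=> c0; elim: n w theta => [|n IH] w theta.
  rewrite (ge0_integral_cV0 (measurable_gauss_cos c w theta)); last first.
    exact: gauss_cos_ge0.
  rewrite expr0 mul1r /torus_cos !enorm_sqr /dotv !big_ord0.
  by rewrite !(mul0r, mulr0, oppr0) expR0 add0r !mul1r.
have := ge0_integral_cV (measurable_gauss_cos c (w : 'cV[R]_(1 + n)) theta)
  (gauss_cos_ge0 c w theta).
move=> h; etransitivity; first exact: h.
have wE : w = col_mx (usubmx (w : 'cV[R]_(1 + n)) 0 0)%:M
    (dsubmx (w : 'cV[R]_(1 + n))) by rewrite -mx11_scalar vsubmxK.
rewrite {h} wE; set w0 := usubmx _ 0 0; set w' := dsubmx _.
pose q := expR (- (pi ^+ 2 * enorm w' ^+ 2 / c)).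
pose S := Num.sqrt (pi / c).
have q0 : 0 <= q by exact: expR_ge0.
have q1 : 0 <= 1 - q.
  rewrite subr_ge0 -expR0 ler_expR oppr_le0 divr_ge0 ?(ltW c0)//.
  by rewrite mulr_ge0 ?sqr_ge0.
have S0 : 0 <= S by exact: sqrtr_ge0.
(* The inner integral yields 1 + q cos, rewritten as (1 - q) + q (1 + cos): both parts are
   nonnegative since 0 <= q <= 1, and both have known integrals. *)
transitivity (\int[mu]_x ((S ^+ n * (1 - q))%:E * (expR (- (x ^+ 2 * c)))%:E +
   (S ^+ n * q)%:E * (expR (- (x ^+ 2 * c)) *
     (1 + cos (2 * pi * w0 * x + theta)))%:E))%E.
  apply: eq_integral => x _.
  transitivity ((expR (- (x ^+ 2 * c)))%:E * \int[@lebesgue_cV R n]_y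
      (expR (- (enorm y ^+ 2 * c)) *
      (1 + torus_cos w' (2 * pi * w0 * x + theta) y))%:E)%E.
    rewrite -ge0_integralZl//; last 2 first.
    - exact: measurable_gauss_cos.
    - by move=> y _; exact: gauss_cos_ge0.
    apply: eq_integral => y _; rewrite -EFinM mulrA -expRD; congr (expR _ * (1 + cos _))%:E.
      by rewrite !enorm_sqr dotv_col_mx; ring.
    by rewrite dotv_col_mx; ring.
  by rewrite IH -/q -/S -!EFinM -EFinD; congr EFin; ring.
have mc : measurable_fun setT (@cos R).
  by apply: continuous_measurable_fun; exact: continuous_cos.
have me : measurable_fun setT (fun x : R => expR (- (x ^+ 2 * c))).
  apply: measurableT_comp => //; apply: measurableT_comp => //.
  exact: measurable_funM.
have mec : measurable_fun setT (fun x : R => expR (- (x ^+ 2 * c)) *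
    (1 + cos (2 * pi * w0 * x + theta))).
  apply: measurable_funM => //; apply: measurable_funD => //.
  by apply: (measurableT_comp mc); apply: measurable_funD.
have me' : measurable_fun setT (fun x : R => (expR (- (x ^+ 2 * c)))%:E).
  exact/measurable_EFinP.
have mec' : measurable_fun setT (fun x : R => (expR (- (x ^+ 2 * c)) *
    (1 + cos (2 * pi * w0 * x + theta)))%:E).
  exact/measurable_EFinP.
have ec0 x : 0 <= expR (- (x ^+ 2 * c)) * (1 + cos (2 * pi * w0 * x + theta)).
  by rewrite mulr_ge0 ?expR_ge0// -lerBlDl sub0r; exact: cos_geN1.
rewrite ge0_integralD//=; last 4 first.
- by move=> x _; rewrite -EFinM lee_fin !mulr_ge0 ?exprn_ge0 ?expR_ge0.
- exact: measurable_funeM.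
- by move=> x _; rewrite -EFinM lee_fin mulr_ge0// mulr_ge0 ?exprn_ge0.
- exact: measurable_funeM.
have scl (k : R) (f : R -> R) : 0 <= k -> measurable_fun setT (fun x => (f x)%:E) ->
    (forall x, 0 <= f x) ->
    (\int[mu]_x (k%:E * (f x)%:E) = k%:E * \int[mu]_x (f x)%:E)%E.
  move=> k0 mf f0; apply: ge0_integralZl => //.
  by move=> x _; rewrite lee_fin.
rewrite !scl// ?mulr_ge0 ?exprn_ge0//.
rewrite ge0_integral_gauss_cos// integral_gauss_scaled// -/S -!EFinM -EFinD.
have nE : enorm (col_mx w0%:M w' : 'cV[R]_(1 + n)) ^+ 2 = w0 * w0 + enorm w' ^+ 2.
  by rewrite !enorm_sqr dotv_col_mx.
congr EFin; rewrite nE.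
have -> : - (pi ^+ 2 * (w0 * w0 + enorm w' ^+ 2) / c) =
  - ((2 * pi * w0) ^+ 2 / (4 * c)) + - (pi ^+ 2 * enorm w' ^+ 2 / c).
  by field; exact: lt0r_neq0.
by rewrite expRD -/q [S ^+ n.+1]exprS; ring.
Qed.

End gauss_fourier_cV.

(** * The Gamma function *)

Section power_integrals.
Context {R : realType}.
Local Notation mu := (@lebesgue_measure R).

Lemma continuous_powR_gt0 (p x : R) : 0 < x -> {for x, continuous (@powR R ^~ p)}.
Proof.
move=> x0; apply/differentiable_continuous/derivable1_diffP.
by apply: derivable_powR; rewrite in_itv/= x0.
Qed.

Lemma powR_cvgy (a : R) : 0 < a -> x `^ (- a) @[x --> +oo] --> (0 : R).
Proof.
move=> a0; apply/cvgrPdist_lt => e e0.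
near=> x; rewrite sub0r normrN.
have x0 : 0 < x by near: x; exact: nbhs_pinfty_gt.
rewrite ger0_norm ?powR_ge0// powRN invf_plt ?posrE ?powR_gt0//.
have -> : e^-1 = (e^-1 `^ a^-1) `^ a by rewrite -powRrM mulVf ?gt_eqF// powRr1// invr_ge0 ltW.
by rewrite gt0_ltr_powR ?nnegrE ?powR_ge0 ?(ltW x0).
Unshelve. all: by end_near. Qed.

Lemma integral_powR_tail (a r : R) : 0 < a -> 0 < r ->
  (\int[mu]_(t in `[r, +oo[) (t `^ (- a - 1))%:E = (r `^ (- a) / a)%:E)%E.
Proof.
move=> a0 r0; pose F (t : R) := - (t `^ (- a) / a).
have dF x : r < x -> is_derive x (1 : R) F (x `^ (- a - 1)).
  move=> rx; have x0 : 0 < x by exact: lt_trans rx.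
  have := is_derive1_powR (- a) x0 => dx.
  by apply: trigger_derive; rewrite /GRing.scale/=; field; exact: lt0r_neq0.
rewrite (@ge0_continuous_FTC2y R _ F r 0).
- by rewrite -EFinB sub0r /F opprK.
- by move=> x _; exact: powR_ge0.
- apply: continuous_in_subspaceT => x /set_mem /=; rewrite in_itv/= andbT => rx.
  by apply: continuous_powR_gt0; exact: lt_le_trans rx.
- rewrite /F -oppr0 -[in X in _ --> X](mul0r a^-1); apply: cvgN.
  by apply: cvgMr_tmp; exact: powR_cvgy.
- by move=> x rx; have := dF x rx => /@ex_derive.
- apply: cvg_at_right_filter; rewrite /F; apply: cvgN; apply: cvgMr_tmp.
  exact: continuous_powR_gt0.
- move=> x; rewrite in_itv/= andbT => rx; rewrite derive1E.
  by have := dF x rx => /@derive_val ->.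
Qed.

Lemma integral_expRN_tail (u : R) :
  (\int[mu]_(t in `[u, +oo[) (expR (- t))%:E = (expR (- u))%:E)%E.
Proof.
pose F (t : R) := - expR (- t).
have dF x : is_derive x (1 : R) F (expR (- x)).
  by apply: trigger_derive; rewrite /GRing.scale/=; ring.
rewrite (@ge0_continuous_FTC2y R _ F u 0).
- by rewrite -EFinB sub0r /F opprK.
- by move=> x _; exact: expR_ge0.
- apply: continuous_subspaceT => x.
  by apply: continuous_comp; [exact: opp_continuous|exact: continuous_expR].
- rewrite /F -oppr0; apply: cvgN.
  exact: cvgr_expR.
- by move=> x rx; have := dF x => /@ex_derive.
- apply: cvg_at_right_filter.
  apply: differentiable_continuous; apply/derivable1_diffP.
  by have := dF u => /@ex_derive.
- by move=> x _; rewrite derive1E; have := dF x => /@derive_val ->.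
Qed.

Lemma integral_powR_segment (a r v : R) : 0 < a -> 0 < r -> r < v ->
  (\int[mu]_(t in `[r, v]) (t `^ (a - 1))%:E = ((v `^ a - r `^ a) / a)%:E)%E.
Proof.
move=> a0 r0 rv; pose F (t : R) := t `^ a / a.
have dF (x : R) : 0 < x -> is_derive x (1 : R) F (x `^ (a - 1)).
  move=> x0; have := is_derive1_powR a x0 => dx.
  by apply: trigger_derive; rewrite /GRing.scale/=; field; exact: lt0r_neq0.
have cF (x : R) : 0 < x -> {for x, continuous F}.
  by move=> x0; apply: cvgMr_tmp; exact: continuous_powR_gt0.
rewrite (@continuous_FTC2 R _ F r v)//.
- by rewrite -EFinB /F -mulrBl.
- apply: continuous_in_subspaceT => x /set_mem /=; rewrite in_itv/= => /andP[rx _].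
  by apply: continuous_powR_gt0; exact: lt_le_trans rx.
- split.
  + move=> x; rewrite in_itv/= => /andP[rx _].
    by have := dF x (lt_trans r0 rx) => /@ex_derive.
  + by apply: cvg_at_right_filter; exact: cF.
  + by apply: cvg_at_left_filter; apply: cF; exact: lt_trans rv.
- move=> x; rewrite in_itv/= => /andP[rx _]; rewrite derive1E.
  by have := dF x (lt_trans r0 rx) => /@derive_val ->.
Qed.

Lemma integral_powR_head (a v : R) : 0 < a -> 0 < v ->
  (\int[mu]_(t in `]0%R, v]) (t `^ (a - 1))%:E = (v `^ a / a)%:E)%E.
Proof.
(* For [a < 1] the integrand is unbounded at 0, so the interval is exhausted by the segments
   [[r n, v]]; [n.+2] keeps [r n < v] even at [n = 0]. *)
move=> a0 v0; pose r n : R := v / n.+2%:R.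
have r0 n : 0 < r n by rewrite divr_gt0.
have rv n : r n < v by rewrite ltr_pdivrMr// ltr_pMr// ltr1n.
pose f (t : R) := (t `^ (a - 1))%:E.
have mf : measurable_fun setT f by apply/measurable_EFinP; exact: measurable_powR.
pose g n := f \_ `[r n, v].
have mg n : measurable_fun setT (g n).
  by apply/(measurable_restrictT _ _).1 => //; exact: measurable_funTS.
have g0 n x : (0 <= g n x)%E.
  by rewrite /g patchE; case: ifP => // _; rewrite lee_fin powR_ge0.
have ndg x : {homo g ^~ x : n m / (n <= m)%N >-> (n <= m)%E}.
  move=> n m nm; rewrite /g !patchE; case: ifPn => [/set_mem/=|_].
    rewrite in_itv/= => /andP[nx xv]; rewrite mem_set//= in_itv/= xv andbT.
    apply: le_trans nx; rewrite ler_pM2l// lef_pV2 ?posrE//.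
    by rewrite ler_nat !ltnS.
  by case: ifP => _; rewrite ?lee_fin ?powR_ge0.
have gcvg x : g n x @[n --> \oo] --> (f \_ `]0, v]) x.
  rewrite patchE; case: ifPn => [/set_mem/=|nx].
    rewrite in_itv/= => /andP[x0 xv].
    apply: cvg_near_cst; near=> n.
    rewrite /g patchE mem_set//= in_itv/= xv andbT.
    rewrite ler_pdivrMr// mulrC -ler_pdivrMr//.
    apply: le_trans (_ : n%:R <= _); last by rewrite ler_nat leqW.
    by near: n; exact: nbhs_infty_ger.
  apply: cvg_near_cst; apply: nearW => n; rewrite /g patchE memNset//= => h.
  move/negP: nx; apply; apply/mem_set; rewrite /= in_itv/=.
  by move: h; rewrite in_itv/= => /andP[rx ->]; rewrite (lt_le_trans _ rx).
have := @cvg_monotone_convergence _ _ _ mu _ measurableT g mg (fun n x _ => g0 n x) (fun x _ => ndg x).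
rewrite [X in _ --> X](_ : _ = \int[mu]_(t in `]0%R, v]) f t)%E; last first.
  rewrite [RHS]integral_mkcond; apply: eq_integral => x _.
  exact/cvg_lim/gcvg.
have -> : (fun n => \int[mu]_x g n x)%E = (fun n => ((v `^ a - r n `^ a) / a)%:E).
  by apply/funext => n; rewrite -integral_powR_segment// [RHS]integral_mkcond.
move=> /cvg_lim <- //; apply/cvg_lim => //.
apply: cvg_EFin; first exact: nearW.
rewrite -[in X in _ --> X](subr0 (v `^ a)).
apply: cvgMr_tmp; apply: cvgB; first exact: cvg_cst.
have rE n : r n `^ a = v `^ a * n.+2%:R `^ (- a).
  by rewrite /r powRM ?invr_ge0 ?(ltW v0)// -powR_inv1// -powRrM mulN1r.
have -> : (fun n => r n `^ a) = (fun n => v `^ a * n.+2%:R `^ (- a)).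
  exact/funext.
rewrite -[in X in _ --> X](mulr0 (v `^ a)).
apply: cvgMl_tmp; have := @cvgr_idn R; rewrite -(cvg_shiftn 2) => h.
have {h} : n.+2%:R @[n --> \oo] --> (+oo : set_system R).
  by apply: cvg_trans h; apply: near_eq_cvg; apply: nearW => n; rewrite /= addn2.
by move=> h; exact: (cvg_comp _ _ h (powR_cvgy a0)).
Unshelve. all: by end_near.
Qed.

End power_integrals.

Lemma integral_bool {R : realType} d (T : measurableType d)
    (m : {measure set T -> \bar R}) (P : T -> bool) (f : T -> R) :
  (\int[m]_x ((P x)%:R * f x)%:E = \int[m]_(x in [set x | P x]) (f x)%:E)%E.
Proof.
rewrite [RHS]integral_mkcond; apply: eq_integral => x _; rewrite patchE.
case: ifPn => [/set_mem /= ->|nP]; first by rewrite mul1r.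
by case: (boolP (P x)) => [Px|_]; [rewrite mem_set in nP|rewrite mul0r].
Qed.

Section gamma.
Context {R : realType}.
Local Notation mu := (@lebesgue_measure R).

Let meas_le d (T : measurableType d) (f g : T -> R) : measurable_fun setT f ->
  measurable_fun setT g -> measurable_fun setT (fun x => (f x <= g x)%R%:R : R).
Proof.
move=> mf mg; have := measurable_fun_ler mf mg => mb.
have m : measurable_fun setT (fun b : bool => b%:R : R) by [].
exact: (measurableT_comp m mb).
Qed.

Let meas_lt d (T : measurableType d) (f g : T -> R) : measurable_fun setT f ->
  measurable_fun setT g -> measurable_fun setT (fun x => (f x < g x)%R%:R : R).
Proof.
move=> mf mg; have := measurable_fun_ltr mf mg => mb.
have m : measurable_fun setT (fun b : bool => b%:R : R) by [].
exact: (measurableT_comp m mb).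
Qed.

Let meas_pow d (T : measurableType d) (f : T -> R) (p : R) : measurable_fun setT f ->
  measurable_fun setT (fun x => f x `^ p).
Proof. by move=> mf; apply: (measurableT_comp (measurable_powR p)). Qed.

Let meas_expN d (T : measurableType d) (f : T -> R) : measurable_fun setT f ->
  measurable_fun setT (fun x => expR (- f x)).
Proof. by move=> mf; do 2 apply: measurableT_comp => //. Qed.

Let setE1 : [set u : R | 0 < u] = `]0, +oo[%classic.
Proof. by apply/seteqP; split => x /=; rewrite in_itv/= andbT. Qed.

Let setE2 (u : R) : [set v : R | u <= v] = `[u, +oo[%classic.
Proof. by apply/seteqP; split => x /=; rewrite in_itv/= andbT. Qed.

Let Zl (k : R) (f : R -> R) : 0 <= k -> measurable_fun setT f -> (forall x, 0 <= f x) ->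
  (\int[mu]_x (k * f x)%:E = k%:E * \int[mu]_x (f x)%:E)%E.
Proof.
move=> k0 mf f0; under eq_integral do rewrite EFinM.
apply: ge0_integralZl => //; first exact/measurable_EFinP.
by move=> x _; rewrite lee_fin.
Qed.

(* The substitutions in the Gamma integral are replaced by Tonelli's theorem:
   expR (- u) is the integral of expR (- v) over v >= u. *)
Lemma gamma_shift (a : R) : 0 < a ->
  (\int[mu]_(u in `]0%R, +oo[) (u `^ (a - 1) * expR (- u))%:E =
   a^-1%:E * \int[mu]_(v in `]0%R, +oo[) (v `^ a * expR (- v))%:E)%E.
Proof.
move=> a0.
pose F (z : R * R) := (((0 < z.1)%R%:R * z.1 `^ (a - 1)) *
  ((z.1 <= z.2)%R%:R * expR (- z.2)))%:E.
have mF : measurable_fun setT F.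
  apply/measurable_EFinP; apply: measurable_funM; apply: measurable_funM.
  - exact: meas_lt.
  - exact: meas_pow.
  - exact: meas_le.
  - exact: meas_expN.
have F0 z : (0 <= F z)%E by rewrite lee_fin !mulr_ge0 ?powR_ge0 ?expR_ge0.
have := @fubini_tonelli _ _ _ _ R mu mu F mF F0.
rewrite (_ : (\int[mu]_x \int[mu]_y F (x, y))%E =
  (\int[mu]_(u in `]0%R, +oo[) (u `^ (a - 1) * expR (- u))%:E)%E); last first.
  rewrite -setE1 -integral_bool; apply: eq_integral => u _.
  rewrite /F /= Zl ?mulr_ge0 ?powR_ge0//; last first.
    by apply: measurable_funM; [exact: meas_le|exact: meas_expN].
  by rewrite integral_bool setE2 integral_expRN_tail -EFinM mulrA.
move=> ->; rewrite -setE1 -!integral_bool -Zl ?invr_ge0 ?(ltW a0)//; last 2 first.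
- apply: measurable_funM; first exact: meas_lt.
  by apply: measurable_funM; [exact: meas_pow|exact: meas_expN].
- by move=> x; rewrite !mulr_ge0 ?powR_ge0 ?expR_ge0.
apply: eq_integral => v _.
transitivity (\int[mu]_u (expR (- v) * (((0 < u)%R && (u <= v)%R)%:R * u `^ (a - 1)))%:E)%E.
  by apply: eq_integral => u _; rewrite /F/= -mulnb natrM; congr EFin; ring.
rewrite Zl ?expR_ge0//; last 2 first.
- under eq_fun do rewrite -mulnb natrM.
  apply: measurable_funM; last exact: meas_pow.
  by apply: measurable_funM; [exact: meas_lt|exact: meas_le].
- by move=> x; rewrite mulr_ge0 ?powR_ge0.
rewrite integral_bool (_ : [set x | _] = `]0, v]%classic); last first.
  by apply/seteqP; split => x /=; rewrite in_itv/=.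
have [v0|v0] := ltP 0 v; last first.
  rewrite set_itv_ge ?integral_set0 ?mule0 ?mul0r ?mulr0//.
  by rewrite bnd_simp -leNgt.
by rewrite integral_powR_head// -EFinM mul1r; congr EFin; field; exact: lt0r_neq0.
Qed.

(** The substitution u = q / t, again through Tonelli's theorem: expR (- (q / t)) is the integral of
    expR (- u) over q <= u t. Integrating over t >= q / u first leaves q^(-a) u^a / a, so the Gamma
    integral comes out in the form given by [gamma_shift]. *)
Lemma gamma_inversion (a q : R) : 0 < a -> 0 < q ->
  (\int[mu]_(t in `]0%R, +oo[) (t `^ (- a - 1) * expR (- (q / t)))%:E =
   (q `^ (- a))%:E * \int[mu]_(u in `]0%R, +oo[) (u `^ (a - 1) * expR (- u))%:E)%E.
Proof.
move=> a0 q0; rewrite gamma_shift//.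
pose F (z : R * R) := (((0 < z.1)%R%:R * z.1 `^ (- a - 1)) *
  ((q <= z.2 * z.1)%R%:R * expR (- z.2)))%:E.
have mF : measurable_fun setT F.
  apply/measurable_EFinP; apply: measurable_funM; apply: measurable_funM.
  - exact: meas_lt.
  - exact: meas_pow.
  - by apply: meas_le => //; exact: measurable_funM.
  - exact: meas_expN.
have F0 z : (0 <= F z)%E by rewrite lee_fin !mulr_ge0 ?powR_ge0 ?expR_ge0.
have := @fubini_tonelli _ _ _ _ R mu mu F mF F0.
rewrite (_ : (\int[mu]_x \int[mu]_y F (x, y))%E =
  (\int[mu]_(t in `]0%R, +oo[) (t `^ (- a - 1) * expR (- (q / t)))%:E)%E); last first.
  rewrite -setE1 -integral_bool; apply: eq_integral => t _.
  rewrite /F /= Zl ?mulr_ge0 ?powR_ge0//; last first.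
    by apply: measurable_funM; [apply: meas_le => //; exact: measurable_funM|exact: meas_expN].
  have [t0|t0] := ltP 0 t; last by rewrite !mul0r mul0e.
  rewrite integral_bool (_ : [set u | _] = `[q / t, +oo[%classic); last first.
    by apply/seteqP; split => x /=; rewrite in_itv/= andbT ler_pdivrMr.
  by rewrite integral_expRN_tail -EFinM mulrA.
move=> ->; rewrite -setE1 -!integral_bool muleA -EFinM -Zl; last 3 first.
- by rewrite mulr_ge0 ?powR_ge0 ?invr_ge0 ?(ltW a0).
- apply: measurable_funM; first exact: meas_lt.
  by apply: measurable_funM; [exact: meas_pow|exact: meas_expN].
- by move=> x; rewrite !mulr_ge0 ?powR_ge0 ?expR_ge0.
apply: eq_integral => u _.
transitivity (\int[mu]_t (expR (- u) * (((0 < t)%R && (q <= u * t)%R)%:R * t `^ (- a - 1)))%:E)%E.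
  by apply: eq_integral => t _; rewrite /F/= -mulnb natrM; congr EFin; ring.
rewrite Zl ?expR_ge0//; last 2 first.
- under eq_fun do rewrite -mulnb natrM.
  apply: measurable_funM; last exact: meas_pow.
  by apply: measurable_funM; [exact: meas_lt|apply: meas_le => //; exact: measurable_funM].
- by move=> x; rewrite mulr_ge0 ?powR_ge0.
rewrite integral_bool.
have [u0|u0] := ltP 0 u; last first.
  rewrite (_ : [set x | _] = set0) ?integral_set0 ?mule0 ?mul0r ?mulr0//.
  apply/seteqP; split => x //= /andP[x0]; rewrite leNgt => /negP; apply.
  by apply: le_lt_trans q0; rewrite mulr_le0_ge0// ltW.
rewrite (_ : [set x | _] = `[q / u, +oo[%classic); last first.
  apply/seteqP; split => x /=; rewrite in_itv/= andbT ler_pdivrMr// [x * u]mulrC.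
    by case/andP.
  move=> h; rewrite h andbT -(pmulr_rgt0 _ u0); exact: lt_le_trans h.
rewrite integral_powR_tail ?divr_gt0// -EFinM mul1r; congr EFin.
rewrite powRM ?invr_ge0 ?ltW// -powR_inv1 ?ltW// -powRrM mulN1r opprK.
ring.
Qed.

End gamma.

Section gamma_finite.
Context {R : realType}.
Local Notation mu := (@lebesgue_measure R).

Let meas_gamma (a : R) : measurable_fun setT (fun u : R => (u `^ (a - 1) * expR (- u))%:E).
Proof.
apply/measurable_EFinP; apply: measurable_funM; first exact: measurable_powR.
by do 2 apply: measurableT_comp => //.
Qed.

Let gamma_ge0 (a u : R) : (0 <= (u `^ (a - 1) * expR (- u))%:E)%E.
Proof. by rewrite lee_fin mulr_ge0 ?powR_ge0 ?expR_ge0. Qed.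

Lemma integral0y_split (f : R -> \bar R) : measurable_fun setT f -> (forall x, 0 <= f x)%E ->
  (\int[mu]_(x in `]0%R, +oo[) f x =
   \int[mu]_(x in `]0%R, 1%R[) f x + \int[mu]_(x in `[1%R, +oo[) f x)%E.
Proof.
move=> mf f0; rewrite -ge0_integral_setU//; last 2 first.
- exact: measurable_funTS.
- rewrite disj_set2E; apply/eqP/seteqP; split => x //=.
  by rewrite !in_itv/= andbT => -[/andP[_]]; rewrite ltNge => /negP.
congr (integral _ _ _); apply/seteqP; split => x /=; rewrite !in_itv/= !andbT.
  by move=> x0; have [x1|x1] := ltP x 1; [left; rewrite x0|right].
by case=> [/andP[]//|]; exact: lt_le_trans.
Qed.

Lemma integral_powR_01 (a : R) : 0 < a ->
  (\int[mu]_(t in `]0%R, 1%R[) (t `^ (a - 1))%:E <= (a^-1)%:E)%E.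
Proof.
move=> a0; apply: le_trans (_ : \int[mu]_(t in `]0%R, 1%R]) (t `^ (a - 1))%:E <= _)%E.
  apply: ge0_subset_integral => //.
  - by apply: measurable_funTS; apply/measurable_EFinP; exact: measurable_powR.
  - by move=> x _; rewrite lee_fin powR_ge0.
  - by move=> x /=; rewrite !in_itv/= => /andP[-> /ltW].
by rewrite integral_powR_head// powR1 mul1r.
Qed.

Lemma gamma_integral_lty (a : R) : 0 < a ->
  (\int[mu]_(u in `]0%R, +oo[) (u `^ (a - 1) * expR (- u))%:E < +oo)%E.
Proof.
move=> a0; rewrite integral0y_split//; apply: lte_add_pinfty.
  apply: (@le_lt_trans _ _ (\int[mu]_(t in `]0%R, 1%R[) (t `^ (a - 1))%:E)%E).
    apply: ge0_le_integral => //.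
    - apply: measurable_funTS; exact: meas_gamma.
    - by apply: measurable_funTS; apply/measurable_EFinP; exact: measurable_powR.
    - move=> x /=; rewrite in_itv/= => /andP[x0 _].
      rewrite lee_fin ler_piMr ?powR_ge0// -expR0 ler_expR oppr_le0; exact: ltW.
  by apply: le_lt_trans (integral_powR_01 a0) _; rewrite ltry.
have [n an] : exists n : nat, a + 1 <= n.+1%:R.
  by exists (Num.truncn (a + 1)); apply: ltW; exact: truncnS_gt.
(* On [1, +oo[, x^(a + 1) <= x^(n + 1) <= (n + 1)! e^x by the exponential series, so the integrand
   is at most C x^(-2). *)
pose C : R := (n.+1)`!%:R.
have C0 : 0 < C by rewrite ltr0n fact_gt0.
apply: (@le_lt_trans _ _ (\int[mu]_(t in `[1%R, +oo[) (C * t `^ (- 1 - 1))%:E)%E).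
  apply: ge0_le_integral => //.
  - apply: measurable_funTS; exact: meas_gamma.
  - apply: measurable_funTS; apply/measurable_EFinP; exact: measurable_funM.
  - move=> x /=; rewrite in_itv/= andbT => x1.
    have x0 : 0 < x by exact: lt_le_trans x1.
    rewrite lee_fin expRN ler_pdivrMr ?expR_gt0//.
    have : x `^ (a + 1) <= C * expR x.
      apply: le_trans (ler_powR x1 an) _; rewrite powR_mulrn ?(ltW x0)//.
      rewrite -ler_pdivrMl// mulrC.
      by apply: le_trans (expR_ge1Dxn n (ltW x0)); rewrite lerDr.
    move=> h; rewrite (_ : a - 1 = (a + 1) + (- 1 - 1)); last by ring.
    rewrite (@powRD _ x (a + 1) (- 1 - 1)) ?(gt_eqF x0) ?implybT//.
    by rewrite mulrAC ler_wpM2r ?powR_ge0.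
under eq_integral do rewrite EFinM.
rewrite ge0_integralZl//; last 3 first.
- by apply: measurable_funTS; apply/measurable_EFinP; exact: measurable_powR.
- by move=> x _; rewrite lee_fin powR_ge0.
- by rewrite lee_fin ltW.
by rewrite integral_powR_tail// -EFinM ltry.
Qed.

Lemma GammaE (a : R) : 0 < a ->
  (\int[mu]_(u in `]0%R, +oo[) (u `^ (a - 1) * expR (- u))%:E = (Gamma a)%:E)%E.
Proof.
move=> a0; rewrite /Gamma /Rintegral fineK//.
rewrite ge0_fin_numE ?gamma_integral_lty//.
exact: integral_ge0.
Qed.

(** After [gamma_shift] the power of the variable is positive, so on [1, +oo[ the integrand is at
    least e^(-x). *)
Lemma Gamma_gt0 (a : R) : 0 < a -> 0 < Gamma a.
Proof.
move=> a0; rewrite -lte_fin -GammaE// gamma_shift//.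
apply: mule_gt0; first by rewrite lte_fin invr_gt0.
have mg := meas_gamma (a + 1); rewrite addrK in mg.
have g0 := gamma_ge0 (a + 1); rewrite addrK in g0.
rewrite integral0y_split//.
apply: (@lt_le_trans _ _ (\int[mu]_(x in `[1%R, +oo[) (expR (- x))%:E)%E).
  by rewrite integral_expRN_tail lte_fin expR_gt0.
rewrite -[leLHS]add0e; apply: leeD; first exact: integral_ge0.
apply: ge0_le_integral => //.
- apply: measurable_funTS; apply/measurable_EFinP.
  by do 2 apply: measurableT_comp => //.
- by apply: measurable_funTS; exact: mg.
- move=> x /=; rewrite in_itv/= andbT => x1; rewrite lee_fin ler_peMl ?expR_ge0//.
  by rewrite -(powRr0 x) ler_powR// ltW.
Qed.

Lemma integral_heat (a q : R) : 0 < a -> 0 < q ->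
  (\int[mu]_(t in `]0%R, +oo[) (t `^ (- a - 1) * expR (- (q / t)))%:E =
   (q `^ (- a) * Gamma a)%:E)%E.
Proof. by move=> a0 q0; rewrite gamma_inversion// GammaE// -EFinM. Qed.

End gamma_finite.

(** * Norm estimates and convergence of Gaussian lattice sums *)

Section euclidean_bounds.
Context {R : realType}.

Lemma enorm_ge0 n (x : 'cV[R]_n) : 0 <= enorm x.
Proof. exact: sqrtr_ge0. Qed.

Lemma dotv_parallelogram n (x y : 'cV[R]_n) :
  dotv (x + y) (x + y) <= 2 * dotv x x + 2 * dotv y y.
Proof.
have := dotv_ge0 (x - y).
rewrite !(dotvDl, dotvNl) !(dotvC x (_ + _), dotvC y (_ + _), dotvC x (_ - _), dotvC y (_ - _)).
rewrite !(dotvDl, dotvNl) (dotvC y x); lra.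
Qed.

Lemma coor_le_enorm n (x : 'cV[R]_n) i : `|x i 0| <= enorm x.
Proof.
rewrite -sqrtr_sqr ler_wsqrtr// /dotv (bigD1 i)//= -expr2 lerDl.
by apply: sumr_ge0 => j _; rewrite -expr2 sqr_ge0.
Qed.

Lemma mulmx_dotv_bound m n (M : 'M[R]_(m, n)) :
  exists2 C : R, 0 < C & forall x : 'cV[R]_n, dotv (M *m x) (M *m x) <= C * dotv x x.
Proof.
(* Each entry of [M *m x] is at most the l1 norm of its row times the norm of [x]; the 1 makes the
   constant positive even for a zero matrix. *)
exists (1 + \sum_i (\sum_j `|M i j|) ^+ 2) => [|x].
  by rewrite ltr_pwDl// sumr_ge0// => i _; exact: sqr_ge0.
rewrite mulrDl mul1r -[leLHS]add0r lerD ?dotv_ge0// mulr_suml ler_sum// => i _.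
rewrite -expr2 -enorm_sqr -exprMn -[leLHS]real_normK ?num_real// ler_sqr ?nnegrE//; last first.
  by rewrite mulr_ge0 ?enorm_ge0// sumr_ge0.
rewrite mxE mulr_suml; apply: le_trans (ler_norm_sum _ _ _) _.
by apply: ler_sum => j _; rewrite normrM ler_wpM2l// coor_le_enorm.
Qed.

Variables (d : nat) (B : 'M[R]_d).
Hypothesis Bu : B \in unitmx.

(** A nonzero integer vector has norm at least 1, and [invmx B] stretches squared norms by a bounded
    factor [C] at most. *)
Lemma lattice_min_norm :
  exists2 m : R, 0 < m & forall w, lattice B w -> w != 0 -> m <= dotv w w.
Proof.
have [C C0 hC] := mulmx_dotv_bound (invmx B).
exists C^-1; first by rewrite invr_gt0.
move=> w /latticeP[z wE] w0; rewrite -div1r ler_pdivrMr// mulrC.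
have zE : ivec z = invmx B *m w by rewrite wE mulKmx.
apply: le_trans (_ : dotv (ivec z) (ivec z) <= _); last by rewrite zE hC.
have z0 : z != 0 by apply: contraNneq w0 => z0; rewrite wE z0 ivec0 mulmx0.
have [i zi0] : exists i, z i 0 != 0.
  apply/not_existsP => h; move/negP: z0; apply; apply/eqP/matrixP => i j.
  by rewrite (ord1 j) mxE; have /negP := h i; rewrite negbK => /eqP.
rewrite /dotv (bigD1 i)//= -[leLHS]addr0 lerD//; last first.
  by apply: sumr_ge0 => j _; rewrite -expr2 sqr_ge0.
rewrite mxE -expr2 -[leLHS](expr1n _ 2) -[leRHS]real_normK ?num_real//.
rewrite ler_sqr ?nnegrE// -intr_norm -[1]/(1%:~R) ler_int.
by rewrite -gtz0_ge1 normr_gt0.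
Qed.

(** Rounding down in the basis [B], to the corner of the cell containing [x]; this need not be the
    nearest lattice point. *)
Definition lattice_floor (x : 'cV[R]_d) : 'cV[R]_d := B *m ivec (vfloor (invmx B *m x)).

Lemma lattice_floor_dist :
  exists2 D : R, 0 < D & forall x, dotv (x - lattice_floor x) (x - lattice_floor x) <= D.
Proof.
have [C C0 hC] := mulmx_dotv_bound B.
exists (C * d.+1%:R) => [|x]; first by rewrite mulr_gt0.
have -> : x - lattice_floor x = B *m (invmx B *m x - ivec (vfloor (invmx B *m x))).
  by rewrite mulmxBr mulKVmx.
apply: le_trans (hC _) _; rewrite ler_pM2l// /dotv.
apply: le_trans (_ : \sum_(i < d) 1 <= _); last by rewrite sumr_const card_ord ler_nat leqW.
apply: ler_sum => i _; rewrite -expr2 !mxE.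
have := floor_itv (\sum_j invmx B i j * x j 0); rewrite intrD => /andP[f0 f1].
by rewrite expr_le1//; lra.
Qed.

Lemma lattice_floorP x : lattice B (lattice_floor x).
Proof. by apply/latticeP; exists (vfloor (invmx B *m x)). Qed.

Lemma ge0_integral_lattice_floor (h : 'cV[R]_d -> \bar R) : (forall x, 0 <= h x)%E ->
  (\int[lebesgue_cV]_x h (lattice_floor x) =
   (covolume B)%:E * \esum_(w in lattice B) h w)%E.
Proof.
move=> h0; rewrite esum_lattice//.
by apply: (ge0_integral_vfloor Bu (h := fun z => h (B *m ivec z))).
Qed.

Lemma measurable_lattice_floor (h : 'cV[R]_d -> \bar R) : (forall x, 0 <= h x)%E ->
  measurable_fun setT (fun x => h (lattice_floor x)).
Proof. by move=> h0; apply: (measurable_vfloor Bu (h := fun z => h (B *m ivec z))). Qed.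

(** The sum is the integral of a step function. As |x|^2 <= 2 |floor x|^2 + 2 D, that function is at
    most e^(c D) e^(-c |x|^2 / 2), an integrable Gaussian. *)
Lemma esum_lattice_gauss (c : R) : 0 < c ->
  (\esum_(w in lattice B) (expR (- (enorm w ^+ 2 * c)))%:E < +oo)%E.
Proof.
move=> c0; have [D D0 hD] := lattice_floor_dist.
pose h (w : 'cV[R]_d) : \bar R := (expR (- (enorm w ^+ 2 * c)))%:E.
have cov0 : 0 < covolume B by rewrite normr_gt0 -unitfE -unitmxE.
have h0 x : (0 <= h x)%E by rewrite lee_fin expR_ge0.
suff : ((covolume B)%:E * (\esum_(w in lattice B) h w) < +oo)%E.
  case: (\esum_(w in lattice B) h w) (esum_ge0 (S := lattice B) (fun x _ => h0 x)) => //.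
    by move=> r _ _; rewrite ltry.
  by rewrite gt0_muley ?lte_fin.
have me c' : measurable_fun setT (fun x : 'cV[R]_d => expR (- (enorm x ^+ 2 * c'))).
  do 2 apply: measurableT_comp => //; apply: measurable_funM => //.
  by apply: measurable_funX; exact: measurable_enorm.
have me' c' : measurable_fun setT (fun x : 'cV[R]_d => (expR (- (enorm x ^+ 2 * c')))%:E).
  by apply/measurable_EFinP; exact: me.
rewrite -ge0_integral_lattice_floor//.
apply: (@le_lt_trans _ _ (\int[lebesgue_cV]_(x in [set: 'cV[R]_d])
    (expR (c * D) * expR (- (enorm x ^+ 2 * (c / 2))))%:E)%E).
  apply: ge0_le_integral => //.
  - exact: measurable_lattice_floor.
  - by apply/measurable_EFinP; apply: measurable_funM => //; exact: me.
  - move=> x _; rewrite lee_fin -expRD ler_expR !enorm_sqr.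
    have := dotv_parallelogram (lattice_floor x) (x - lattice_floor x).
    have := hD x; rewrite [lattice_floor x + _]addrC subrK => h1 h2.
    have h3 : dotv x x * (c / 2) <= (2 * dotv (lattice_floor x) (lattice_floor x) + 2 * D) * (c / 2).
      by rewrite ler_pM2r ?divr_gt0//; lra.
    lra.
under eq_integral do rewrite EFinM.
rewrite ge0_integralZl//.
rewrite lte_mul_pinfty ?lee_fin ?expR_ge0//.
(* Frequency 0 and phase pi / 2 make the cosine vanish identically, leaving the plain Gaussian
   integral. *)
have := ge0_integral_gauss_cV (0 : 'cV[R]_d) (pi / 2) (divr_gt0 c0 (ltr0n R 2)).
rewrite [X in X = _ -> _](_ : _ = (\int[lebesgue_cV]_(x in [set: 'cV[R]_d])
    (expR (- (enorm x ^+ 2 * (c / 2))))%:E)%E) => [->|]; first exact: ltry.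
apply: eq_integral => x _; rewrite /torus_cos (_ : dotv x 0 = 0).
  by rewrite mulr0 add0r cos_pihalf addr0 mulr1.
by rewrite dotvC /dotv big1// => i _; rewrite mxE mul0r.
Qed.

End euclidean_bounds.

Lemma measurable_invr {R : realType} : measurable_fun setT (fun t : R => t^-1).
Proof.
have m : measurable_fun setT (fun b : bool => b%:R : R) by [].
rewrite (_ : (fun t => _) = (fun t : R =>
    (0 <= t)%R%:R * t `^ (-1) - (t < 0)%R%:R * (- t) `^ (-1))).
  apply: measurable_funB; apply: measurable_funM.
  - have mb : measurable_fun setT (fun t : R => (0 <= t)%R) by exact: measurable_fun_ler.
    exact: (measurableT_comp m mb).
  - exact: measurable_powR.
  - have mb : measurable_fun setT (fun t : R => (t < 0)%R) by exact: measurable_fun_ltr.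
    exact: (measurableT_comp m mb).
  - by apply: (measurableT_comp (measurable_powR (-1))).
apply/funext => t; have [t0|t0] := leP 0 t.
  by rewrite mul1r mul0r subr0 powR_inv1.
by rewrite mul0r sub0r mul1r powR_inv1 ?oppr_ge0 ?(ltW t0)// invrN opprK.
Qed.

(** * Fourier coefficients of the periodic Riesz kernel *)

Section heat_integrals.
Context {R : realType} (d : nat) (s : R).
Hypotheses (s_gt0 : 0 < s) (s_ltd : s < d%:R).
Local Notation mu := (@lebesgue_measure R).
Local Notation lam := (@lebesgue_cV R d).

Let G := Gamma (s / 2).
Let G0 : 0 < G. Proof. by apply: Gamma_gt0; rewrite divr_gt0. Qed.
Let a := (d%:R - s) / 2.
Let a0 : 0 < a. Proof. by rewrite divr_gt0// subr_gt0. Qed.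

(** With [q] = pi^2 |w|^2, the Fourier transform at [w] of exp (- |x|^2 t), times the weight
    t^(s/2-1) / Gamma(s/2). The second series integrates it over ]0, 1[, the transform of the first
    series over [1, +oo[. *)
Definition heat_term (q t : R) : R :=
  pi `^ (d%:R / 2) / t `^ (d%:R / 2) * expR (- (q / t)) * (t `^ (s / 2 - 1) / G).

Definition heat_int (D : set R) (q : R) : \bar R :=
  (\int[mu]_(t in D) (heat_term q t)%:E)%E.

Lemma heat_term_ge0 q t : 0 <= heat_term q t.
Proof. by rewrite !mulr_ge0 ?powR_ge0 ?expR_ge0 ?invr_ge0 ?powR_ge0 ?(ltW G0). Qed.

Lemma heat_termE q t : 0 < t ->
  heat_term q t = pi `^ (d%:R / 2) / G * (t `^ (- a - 1) * expR (- (q / t))).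
Proof.
move=> t0; rewrite /heat_term -powRN.
have -> : - a - 1 = - (d%:R / 2) + (s / 2 - 1) by rewrite /a; field.
rewrite (@powRD _ t (- (d%:R / 2)) (s / 2 - 1)) ?(gt_eqF t0) ?implybT//; ring.
Qed.

Lemma measurable_heat_term q : measurable_fun setT (heat_term q).
Proof.
have mV : measurable_fun setT (fun t : R => t^-1) by exact: measurable_invr.
apply: measurable_funM; last by apply: measurable_funM => //; exact: measurable_powR.
apply: measurable_funM.
  by apply: measurable_funM => //; apply: (measurableT_comp mV); exact: measurable_powR.
do 2 apply: measurableT_comp => //; exact: measurable_funM.
Qed.

Let mh q : measurable_fun setT (fun t => (heat_term q t)%:E).
Proof. by apply/measurable_EFinP; exact: measurable_heat_term. Qed.

Let h0 q t : (0 <= (heat_term q t)%:E)%E.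
Proof. by rewrite lee_fin heat_term_ge0. Qed.

Lemma heat_int_ge0 D q : (0 <= heat_int D q)%E.
Proof. exact: integral_ge0. Qed.

Lemma heat_int_total q : 0 < q ->
  (heat_int `]0%R, 1%R[ q + heat_int `[1%R, +oo[ q =
   (pi `^ (d%:R / 2) / G * (q `^ (- a) * Gamma a))%:E)%E.
Proof.
move=> q0; rewrite /heat_int -(integral0y_split (mh q) (h0 q)) EFinM -(integral_heat a0 q0).
rewrite -ge0_integralZl//; last 3 first.
- apply: measurable_funTS; apply/measurable_EFinP; apply: measurable_funM.
    exact: measurable_powR.
  do 2 apply: measurableT_comp => //; apply: measurable_funM => //.
  exact: measurable_invr.
- by move=> x _; rewrite lee_fin mulr_ge0 ?powR_ge0 ?expR_ge0.
- by rewrite lee_fin divr_ge0 ?powR_ge0 ?(ltW G0).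
apply: eq_integral => t /set_mem /=; rewrite in_itv/= andbT => t0.
by rewrite heat_termE// EFinM.
Qed.

(** At [q = 0] the exponent - a - 1 < -1 would make the part over ]0, 1[ diverge, but the second
    series omits w = 0. Divided by the covolume, this tail is thus the whole of F^(0), the
    coefficient of t_N^2. *)
Lemma heat_int_tail0 : heat_int `[1%R, +oo[ 0 =
  (2 * pi `^ (d%:R / 2) / (G * (d%:R - s)))%:E.
Proof.
transitivity (\int[mu]_(t in `[1%R, +oo[) ((pi `^ (d%:R / 2) / G)%:E * (t `^ (- a - 1))%:E))%E.
  apply: eq_integral => t /set_mem /=; rewrite in_itv/= andbT => t1.
  by rewrite heat_termE ?(lt_le_trans _ t1)// mul0r oppr0 expR0 mulr1 EFinM.
rewrite ge0_integralZl//; last 3 first.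
- by apply: measurable_funTS; apply/measurable_EFinP; exact: measurable_powR.
- by move=> x _; rewrite lee_fin powR_ge0.
- by rewrite lee_fin divr_ge0 ?powR_ge0 ?(ltW G0).
rewrite integral_powR_tail// powR1 -EFinM; congr EFin; rewrite /a.
have ds : d%:R - s != 0 by rewrite subr_eq0 gt_eqF.
by field; rewrite ds gt_eqF.
Qed.

Lemma heat_int_tail_le q : 0 <= q ->
  (heat_int `[1%R, +oo[ q <= heat_int `[1%R, +oo[ 0)%E.
Proof.
move=> q0; apply: ge0_le_integral => //; try by apply: measurable_funTS; exact: mh.
move=> t /=; rewrite in_itv/= andbT => t1; have t0 : 0 < t by exact: lt_le_trans t1.
rewrite lee_fin !heat_termE// ler_wpM2l ?divr_ge0 ?powR_ge0 ?(ltW G0)//.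
by rewrite ler_wpM2l ?powR_ge0// ler_expR mul0r oppr0 oppr_le0 divr_ge0// ltW.
Qed.

Lemma heat_int_tail_fin q : 0 <= q -> heat_int `[1%R, +oo[ q \is a fin_num.
Proof.
move=> q0; rewrite ge0_fin_numE ?heat_int_ge0//.
by apply: le_lt_trans (heat_int_tail_le q0) _; rewrite heat_int_tail0 ltry.
Qed.

Lemma heat_int_head_fin q : 0 < q -> heat_int `]0%R, 1%R[ q \is a fin_num.
Proof.
move=> q0; rewrite ge0_fin_numE ?heat_int_ge0//.
apply: (@le_lt_trans _ _ (heat_int `]0%R, 1%R[ q + heat_int `[1%R, +oo[ q)%E).
  by rewrite leeDl// heat_int_ge0.
by rewrite heat_int_total// ltry.
Qed.

(** On ]0, 1[, 1 / t >= 1. Keeping a positive [q2] inside for convergence at 0, the rest of the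
    frequency yields Gaussian decay. *)
Lemma heat_int_head_le q1 q2 : 0 <= q1 ->
  (heat_int `]0%R, 1%R[ (q1 + q2) <= (expR (- q1))%:E * heat_int `]0%R, 1%R[ q2)%E.
Proof.
move=> q10; rewrite -ge0_integralZl//; last by apply: measurable_funTS; exact: mh.
apply: ge0_le_integral => //.
- by apply: measurable_funTS; exact: mh.
- by apply: measurable_funeM; apply: measurable_funTS; exact: mh.
- move=> t /=; rewrite in_itv/= => /andP[t0 t1].
  rewrite -EFinM lee_fin !heat_termE// [leRHS]mulrCA ler_wpM2l ?divr_ge0 ?powR_ge0 ?(ltW G0)//.
  rewrite [leRHS]mulrCA ler_wpM2l ?powR_ge0// -expRD ler_expR mulrDl opprD lerD2r lerN2.
  by rewrite ler_peMr// invf_ge1// ltW.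
Qed.

Definition riesz_short (x : 'cV[R]_d) : \bar R :=
  (\int[mu]_(t in `[1%R, +oo[)
     (expR (- (enorm x) ^+ 2 * t) * (t `^ (s / 2 - 1) / G))%:E)%E.

Let F (z : 'cV[R]_d * R) : R :=
  (1 <= z.2)%R%:R * (expR (- (enorm z.1) ^+ 2 * z.2) * (z.2 `^ (s / 2 - 1) / G)).

Let mF : measurable_fun setT F.
Proof.
apply: measurable_funM.
  have m : measurable_fun setT (fun b : bool => b%:R : R) by [].
  have mb : measurable_fun setT (fun z : 'cV[R]_d * R => (1 <= z.2)%R).
    exact: measurable_fun_ler.
  exact: (measurableT_comp m mb).
apply: measurable_funM.
  apply: measurableT_comp => //; apply: measurable_funM => //.
  apply: measurableT_comp => //; apply: measurable_funX.
  exact: measurable_enorm.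
apply: measurable_funM => //.
exact: (measurableT_comp (measurable_powR (s / 2 - 1)) measurable_snd).
Qed.

Let F0 z : 0 <= F z.
Proof. by rewrite !mulr_ge0 ?expR_ge0 ?powR_ge0 ?invr_ge0 ?(ltW G0). Qed.

Let riesz_shortE x : riesz_short x = (\int[mu]_t (F (x, t))%:E)%E.
Proof.
rewrite /F/= integral_bool (_ : [set t | _] = `[1, +oo[%classic)//.
by apply/seteqP; split => t /=; rewrite in_itv/= andbT.
Qed.

Lemma riesz_short_ge0 x : (0 <= riesz_short x)%E.
Proof. by rewrite riesz_shortE; apply: integral_ge0 => t _; rewrite lee_fin. Qed.

Lemma measurable_riesz_short : measurable_fun setT riesz_short.
Proof.
have mF' : measurable_fun setT (EFin \o F) by exact/measurable_EFinP.
have := measurable_fun_fubini_tonelli_F (m2 := mu) (EFin \o F) mF' (fun z => F0 z).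
by congr (measurable_fun _ _); apply/funext => x; rewrite riesz_shortE.
Qed.

(** By Tonelli's theorem the space integral is taken first, at fixed [t]: a Gaussian against 1 + cos
    with phase pi, which gives the transform at 0 minus the transform at [u]. The two tails can be
    separated because both are finite. *)
Lemma integral_riesz_short (u : 'cV[R]_d) :
  (\int[lam]_x (riesz_short x * (1 - torus_cos u 0 x)%:E) =
   heat_int `[1%R, +oo[ 0 - heat_int `[1%R, +oo[ (pi ^+ 2 * enorm u ^+ 2))%E.
Proof.
have cE x : 1 - torus_cos u 0 x = 1 + torus_cos u pi x.
  by rewrite /torus_cos addr0 cosDpi.
pose H (z : 'cV[R]_d * R) : \bar R := (F z * (1 + torus_cos u pi z.1))%:E.
have mc : measurable_fun setT (fun x => 1 + torus_cos u pi x).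
  by apply: measurable_funD => //; exact: measurable_torus_cos.
have mH : measurable_fun setT H.
  apply/measurable_EFinP; apply: measurable_funM => //.
  exact: (measurableT_comp mc measurable_fst).
have H0 z : (0 <= H z)%E by rewrite lee_fin mulr_ge0 ?torus_cosD1_ge0.
transitivity (\int[lam]_x \int[mu]_t H (x, t))%E.
  apply: eq_integral => x _; rewrite cE riesz_shortE.
  rewrite -ge0_integralZr//; last 3 first.
  - apply/measurable_EFinP; exact: (measurableT_comp mF (pair1_measurable x)).
  - by move=> t _; rewrite lee_fin.
  - by rewrite lee_fin torus_cosD1_ge0.
rewrite (@fubini_tonelli _ _ _ _ R lam mu H mH H0).
pose q := pi ^+ 2 * enorm u ^+ 2.
have q0 : 0 <= q by rewrite mulr_ge0 ?sqr_ge0.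
transitivity (\int[mu]_(t in `[1%R, +oo[) (heat_term 0 t - heat_term q t)%:E)%E.
  rewrite (_ : `[1%R, +oo[%classic = [set t : R | (1 <= t)%R]); last first.
    by apply/seteqP; split => t /=; rewrite in_itv/= andbT.
  rewrite -integral_bool; apply: eq_integral => t _; rewrite /H/= /F/=.
  have [t1|t1] := leP 1 t; last first.
    by under eq_integral do rewrite !mul0r; rewrite integral0 mul0r.
  have t0 : 0 < t by exact: lt_le_trans t1.
  transitivity ((t `^ (s / 2 - 1) / G)%:E * \int[lam]_x
      (expR (- (enorm x ^+ 2 * t)) * (1 + torus_cos u pi x))%:E)%E.
    rewrite -ge0_integralZl//; last 3 first.
    - exact: measurable_gauss_cos.
    - by move=> x _; exact: gauss_cos_ge0.
    - by rewrite lee_fin divr_ge0 ?powR_ge0 ?(ltW G0).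
    by apply: eq_integral => x _; rewrite /= -EFinM mulNr mul1r; congr EFin; ring.
  rewrite ge0_integral_gauss_cV// cospi -EFinM; congr EFin.
  have -> : Num.sqrt (pi / t) ^+ d = pi `^ (d%:R / 2) / t `^ (d%:R / 2).
    rewrite -powR12_sqrt ?divr_ge0 ?pi_ge0 ?(ltW t0)// -powR_mulrn ?powR_ge0//.
    rewrite -powRrM powRM ?pi_ge0 ?invr_ge0 ?(ltW t0)// [2^-1 * _]mulrC.
    by rewrite -[t^-1]powR_inv1 ?(ltW t0)// -[_ `^ (d%:R / 2) in X in _ * X]powRrM mulN1r powRN.
  by rewrite /heat_term -/q mul0r oppr0 expR0 /=; ring.
have ih p : 0 <= p -> mu.-integrable `[1%R, +oo[ (EFin \o heat_term p).
  move=> p0; apply/integrableP; split; first by apply: measurable_funTS; exact: mh.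
  under eq_integral do rewrite /= ger0_norm ?heat_term_ge0//.
  by have := heat_int_tail_fin p0; rewrite ge0_fin_numE ?heat_int_ge0.
exact: (integralB_EFin _ (ih 0 (lexx _)) (ih q q0)).
Qed.

End heat_integrals.

(** * The periodic Riesz kernel integrated against 1 - cos *)

Section periodic_riesz_torus.
Context {R : realType} {d : nat} (A : 'M[R]_d) (Au : A \in unitmx) (s : R).
Hypotheses (s_gt0 : 0 < s) (s_ltd : s < d%:R).
Local Notation mu := (@lebesgue_measure R).
Local Notation lam := (@lebesgue_cV R d).
Local Notation tor := (torus_measure Au).
Local Notation dual0 := (dual_lattice A `\ 0%R).

Let Bd := invmx A^T.
Let Bdu : Bd \in unitmx. Proof. by rewrite unitmx_inv unitmx_tr. Qed.

Let covol_gt0 : 0 < covolume A.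
Proof. by rewrite normr_gt0 -unitfE -unitmxE. Qed.

Let ci : R := (covolume A)^-1.
Let ci0 : 0 < ci. Proof. by rewrite invr_gt0. Qed.

(** Integer vectors form a countable type, as termwise integration requires; the excluded w = 0
    becomes a zero term. *)
Lemma esum_dual0 (f : 'cV[R]_d -> \bar R) :
  (\esum_(w in dual0) f w =
   \esum_(z in [set: 'cV[int]_d]) (if z == 0%R then 0 else f (Bd *m ivec z)%R))%E.
Proof.
rewrite setDE esum_mkcondr dual_latticeE// (esum_lattice _ Bdu).
apply: eq_esum => z _; have [->|z0] := eqVneq z 0.
  by rewrite ivec0 mulmx0 memNset//= => /(_ erefl).
rewrite mem_set//= => h; move/eqP: z0; apply; apply: (lattice_inj Bdu).
by rewrite h ivec0 mulmx0.
Qed.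

(* The coefficient of the dual lattice vector w in the second series defining
   F_{s,Lambda}, up to the factor 1 / covol. *)
Definition heat_coef (w : 'cV[R]_d) : R :=
  fine (heat_int d s `]0%R, 1%R[ (pi ^+ 2 * enorm w ^+ 2)).

Lemma heat_coef_ge0 w : 0 <= heat_coef w.
Proof. by apply: fine_ge0; exact: (heat_int_ge0 d s_gt0). Qed.

Let q_gt0 (w : 'cV[R]_d) : w != 0 -> 0 < pi ^+ 2 * enorm w ^+ 2.
Proof.
move=> w0; rewrite mulr_gt0 ?exprn_gt0 ?pi_gt0// sqrtr_gt0.
by rewrite lt_neqAle dotv_ge0 eq_sym dotv_eq0 w0.
Qed.

Let heat_coefE w : w != 0 ->
  ((heat_coef w)%:E = heat_int d s `]0%R, 1%R[ (pi ^+ 2 * enorm w ^+ 2))%E.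
Proof. by move=> w0; rewrite fineK// heat_int_head_fin// q_gt0. Qed.

Lemma heat_coefN w : heat_coef (- w) = heat_coef w.
Proof. by rewrite /heat_coef !enorm_sqr dotvNl dotvC dotvNl opprK. Qed.

(** With [m] the least squared norm of a nonzero dual vector, split |w|^2 = (|w|^2 - m) + m: the
    coefficient is at most C exp (- pi^2 |w|^2), and Gaussian sums converge. *)
Lemma heat_coef_summable : (\esum_(w in dual0) (heat_coef w)%:E < +oo)%E.
Proof.
have [m m0 hm] := lattice_min_norm Bdu.
pose K := fine (heat_int d s `]0%R, 1%R[ (pi ^+ 2 * m)).
have pm0 : 0 < pi ^+ 2 * m :> R by rewrite mulr_gt0 ?exprn_gt0 ?pi_gt0.
have K0 : 0 <= K by rewrite fine_ge0// heat_int_ge0.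
have p0 : 0 < (pi : R) ^+ 2 by rewrite exprn_gt0 ?pi_gt0.
pose C := expR (pi ^+ 2 * m) * K.
have C0 : 0 <= C by rewrite mulr_ge0 ?expR_ge0.
apply: (@le_lt_trans _ _ (C%:E * (\esum_(w in lattice Bd) (expR (- (enorm w ^+ 2 * pi ^+ 2)))%:E))%E).
  rewrite esum_dual0 (esum_lattice _ Bdu) -esumZl//; apply: le_esum => z _.
  have [_|z0] := eqVneq z 0; first by rewrite -EFinM lee_fin mulr_ge0 ?expR_ge0.
  set w := Bd *m ivec z.
  have w0 : w != 0.
    apply: contra z0 => /eqP w0; apply/eqP/(lattice_inj Bdu).
    by rewrite -/w w0 ivec0 mulmx0.
  have mw : m <= dotv w w by apply: hm => //; apply/latticeP; exists z.
  rewrite heat_coefE//.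
  have -> : pi ^+ 2 * enorm w ^+ 2 = (pi ^+ 2 * (enorm w ^+ 2 - m)) + pi ^+ 2 * m by ring.
  apply: le_trans (heat_int_head_le d s_gt0 _ _) _.
    by rewrite mulr_ge0 ?(ltW p0)// subr_ge0 enorm_sqr.
  rewrite -[X in (_ * X <= _)%E]fineK ?heat_int_head_fin// -/K -!EFinM lee_fin /C.
  by rewrite [leRHS]mulrAC -expRD ler_wpM2r// ler_expR; lra.
by rewrite lte_mul_pinfty ?lee_fin// esum_lattice_gauss.
Qed.

Definition riesz_shift : R := fine (\esum_(w in dual0) (heat_coef w)%:E)%E.

Let B := riesz_shift.

Let BE : (B%:E = \esum_(w in dual0) (heat_coef w)%:E)%E.
Proof.
rewrite /B /riesz_shift fineK// ge0_fin_numE ?heat_coef_summable//.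
by apply: esum_ge0 => w _; rewrite lee_fin heat_coef_ge0.
Qed.

Let long w x : R := heat_coef w * (1 + torus_cos w 0 x).

Let long_ge0 w x : 0 <= long w x.
Proof. by rewrite mulr_ge0 ?heat_coef_ge0 ?torus_cosD1_ge0. Qed.

(** The real part of [expi] is a cosine, written (1 + cos) - 1. Both resulting nonnegative families
    are summable, so the signed sum is the difference of their sums. *)
Lemma abs_sum_riesz x :
  (abs_sum dual0 (fun w => (complex.Re (expi (2 * pi * dotv x w)) *
     \int[mu]_(t in `]0, 1[) (pi `^ (d%:R / 2) / t `^ (d%:R / 2) *
           expR (- (pi ^+ 2 * enorm w ^+ 2 / t)) *
           (t `^ (s / 2 - 1) / Gamma (s / 2))))%R) =
   \esum_(w in dual0) (long w x)%:E - B%:E)%E.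
Proof.
have sb : summable dual0 (fun w => (heat_coef w)%:E).
  rewrite /summable; under eq_esum do rewrite gee0_abs ?lee_fin ?heat_coef_ge0//.
  exact: heat_coef_summable.
have sl : summable dual0 (fun w => (long w x)%:E).
  apply: le_lt_trans (summableD sb sb : _ < +oo)%E.
  apply: le_esum => w _; rewrite -EFinD !abse_EFin lee_fin.
  rewrite !ger0_norm ?addr_ge0 ?heat_coef_ge0 ?long_ge0// /long -mulr2n -mulr_natr.
  rewrite ler_wpM2l ?heat_coef_ge0//.
  by have := cos_le1 (2 * pi * dotv x w + 0); rewrite /torus_cos; lra.
rewrite BE -(esumB sl sb); last 2 first.
- by move=> w _; rewrite lee_fin long_ge0.
- by move=> w _; rewrite lee_fin heat_coef_ge0.
rewrite /abs_sum (_ : EFin \o _ =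
    ((fun w => (long w x)%:E) \- (fun w => (heat_coef w)%:E))%E)//.
apply/funext => w; congr EFin.
transitivity (cos (2 * pi * dotv x w) * heat_coef w); first by [].
by rewrite /long /torus_cos addr0; ring.
Qed.

(* F_{s,Lambda} plus a constant; being a sum of nonnegative terms, it can be
   integrated termwise by Tonelli's theorem. *)
Definition riesz_shifted x : \bar R :=
  ((\esum_(v in lattice A) riesz_short s (x + v)%R) +
   ci%:E * (\esum_(w in dual0) (long w x)%:E))%E.

Let esum_long_fin x : (\esum_(w in dual0) (long w x)%:E)%E \is a fin_num.
Proof.
rewrite ge0_fin_numE; last by apply: esum_ge0 => w _; rewrite lee_fin.
apply: (@le_lt_trans _ _ (\esum_(w in dual0) ((heat_coef w)%:E + (heat_coef w)%:E))%E).
  apply: le_esum => w _; rewrite -EFinD lee_fin /long -mulr2n -mulr_natr.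
  rewrite ler_wpM2l ?heat_coef_ge0//.
  by have := cos_le1 (2 * pi * dotv x w + 0); rewrite /torus_cos; lra.
by rewrite esumD ?lte_add_pinfty ?heat_coef_summable// => w _; rewrite lee_fin heat_coef_ge0.
Qed.

Lemma riesz_shiftedE x :
  (riesz_shifted x = periodic_riesz A s x + (ci * B)%:E)%E.
Proof.
rewrite /riesz_shifted /periodic_riesz abs_sum_riesz -addeA; congr (_ + _)%E.
have := esum_long_fin x; case: (\esum_(w in dual0) _)%E => // r _.
by rewrite -EFinB -!EFinM -EFinD; congr EFin; rewrite mulrBr subrK.
Qed.

Lemma riesz_shifted_ge0 x : (0 <= riesz_shifted x)%E.
Proof.
apply: adde_ge0; first by apply: esum_ge0 => v _; exact: riesz_short_ge0.
by rewrite mule_ge0 ?lee_fin ?(ltW ci0)//; apply: esum_ge0 => w _; rewrite lee_fin.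
Qed.

Let measurable_short : measurable_fun setT (@riesz_short R d s).
Proof. exact: measurable_riesz_short. Qed.

Let measurable_short_sum :
  measurable_fun setT (fun x : 'cV[R]_d => \esum_(v in lattice A) riesz_short s (x + v)%R)%E.
Proof.
have m z : measurable_fun setT (fun x : 'cV[R]_d => riesz_short s (x + A *m ivec z)).
  have mz : measurable_fun setT (fun x : 'cV[R]_d => x + A *m ivec z).
    exact: measurable_cVD.
  exact: (measurableT_comp measurable_short mz).
pose f (z : 'cV[int]_d) (x : 'cV[R]_d) := riesz_short s (x + A *m ivec z).
have f0 z x : (0 <= f z x)%E by exact: riesz_short_ge0.
have := @measurable_esum R 'cV[int]_d _ _ f setT m f0.
by congr (measurable_fun _ _); apply/funext => x; rewrite esum_lattice.
Qed.

Let mlong w : measurable_fun setT (fun x => (long w x)%:E).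
Proof.
apply/measurable_EFinP; apply: measurable_funM => //.
by apply: measurable_funD => //; exact: measurable_torus_cos.
Qed.

Let measurable_long_sum :
  measurable_fun setT (fun x => \esum_(w in dual0) (long w x)%:E)%E.
Proof.
pose f (z : 'cV[int]_d) (x : 'cV[R]_d) : \bar R :=
  if z == 0 then 0%E else (long (Bd *m ivec z) x)%:E.
have m z : measurable_fun setT (f z) by rewrite /f; case: (z == 0).
have f0 z x : (0 <= f z x)%E by rewrite /f; case: (z == 0); rewrite // lee_fin.
have := @measurable_esum R 'cV[int]_d _ _ f setT m f0.
by congr (measurable_fun _ _); apply/funext => x; rewrite esum_dual0.
Qed.

Lemma measurable_riesz_shifted : measurable_fun setT riesz_shifted.
Proof. by apply: emeasurable_funD => //; exact: measurable_funeM. Qed.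

(** For u != 0, F^(0) - F^(u) plus the mean [ci * B] of the added constant, since 1 - cos has mean
    1. *)
Definition riesz_fourier (u : 'cV[R]_d) : R :=
  ci * (2 * pi `^ (d%:R / 2) / (Gamma (s / 2) * (d%:R - s)) -
        pi `^ (s - d%:R / 2) * Gamma ((d%:R - s) / 2) / Gamma (s / 2) *
          (enorm u `^ (d%:R - s))^-1 + B).

Let heat_total u : u != 0 ->
  fine (heat_int d s `[1%R, +oo[ (pi ^+ 2 * enorm u ^+ 2)) + heat_coef u =
  pi `^ (s - d%:R / 2) * Gamma ((d%:R - s) / 2) / Gamma (s / 2) * (enorm u `^ (d%:R - s))^-1.
Proof.
move=> u0; have qu := q_gt0 u0; apply: EFin_inj.
rewrite EFinD heat_coefE// fineK ?heat_int_tail_fin ?(ltW qu)// addeC heat_int_total//.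
congr EFin; have pi0 : 0 <= (pi : R) by exact: pi_ge0.
have e0 := enorm_ge0 u.
rewrite powRM ?exprn_ge0// -[pi ^+ 2]powR_mulrn// -[enorm u ^+ 2]powR_mulrn// -!powRrM.
have -> : 2 * - ((d%:R - s) / 2) = - (d%:R - s) by field.
rewrite -[X in _ = _ * X]powRN.
have -> : s - d%:R / 2 = d%:R / 2 + - (d%:R - s) by field.
rewrite (@powRD _ pi (d%:R / 2) (- (d%:R - s))) ?(gt_eqF (pi_gt0 R)) ?implybT//.
ring.
Qed.

Lemma integral_riesz_shifted (u y : 'cV[R]_d) : dual_lattice A u ->
  (\int[tor]_x (riesz_shifted (x - y)%R * (1 - torus_cos u 0 (x - y)%R)%:E) =
   (if u == 0 then 0 else riesz_fourier u)%:E)%E.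
Proof.
move=> du; have [->|u0] := eqVneq u 0.
  (* The weight 1 - cos vanishes identically; where the kernel is +oo, the product with 0 is 0 as
     well. *)
  under eq_integral => x _.
    rewrite /torus_cos (_ : dotv _ 0 = 0); last first.
      by rewrite dotvC /dotv big1// => i _; rewrite mxE mul0r.
    rewrite mulr0 addr0 cos0 subrr mule0; over.
  exact: integral0.
have phi0 x : 0 <= 1 - torus_cos u 0 x.
  by have := cos_le1 (2 * pi * dotv x u + 0); rewrite /torus_cos subr_ge0.
have mphi : measurable_fun setT (fun x => 1 - torus_cos u 0 x).
  by apply: measurable_funB => //; exact: measurable_torus_cos.
have pphi : periodic_lattice A (fun x => 1 - torus_cos u 0 x).
  by move=> x v Av; rewrite (torus_cos_periodic 0 du x Av).
have mxy : measurable_fun setT (fun x : 'cV[R]_d => x - y) by exact: measurable_cVB.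
have mphi' : measurable_fun setT (fun x : 'cV[R]_d => (1 - torus_cos u 0 (x - y))%:E).
  by apply/measurable_EFinP; exact: (measurableT_comp mphi mxy).
have short0 x : (0 <= \esum_(v in lattice A) riesz_short s (x + v)%R)%E.
  by apply: esum_ge0 => v _; exact: riesz_short_ge0.
have long0 x : (0 <= \esum_(w in dual0) (long w x)%:E)%E.
  by apply: esum_ge0 => w _; rewrite lee_fin.
have qu := q_gt0 u0.
have mshort' : measurable_fun setT
    (fun x : 'cV[R]_d => \esum_(v in lattice A) riesz_short s (x - y + v)%R)%E.
  exact: (measurableT_comp measurable_short_sum mxy).
transitivity (\int[tor]_x ((\esum_(v in lattice A) riesz_short s (x - y + v)%R) *
     (1 - torus_cos u 0 (x - y)%R)%:E) +
   ci%:E * \int[tor]_x ((\esum_(w in dual0) (long w (x - y)%R)%:E) *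
     (1 - torus_cos u 0 (x - y)%R)%:E))%E.
  rewrite -ge0_integralZl//; last 3 first.
  - apply: emeasurable_funM => //; exact: (measurableT_comp measurable_long_sum mxy).
  - by move=> x _; rewrite mule_ge0// lee_fin.
  - by rewrite lee_fin (ltW ci0).
  rewrite -ge0_integralD//.
  - by apply: eq_integral => x _; rewrite muleA -ge0_muleDl// mule_ge0// lee_fin (ltW ci0).
  - by move=> x _; apply: mule_ge0; rewrite ?lee_fin.
  - by apply: emeasurable_funM => //; exact: mshort'.
  - by move=> x _; rewrite !mule_ge0 ?lee_fin ?(ltW ci0).
  - apply: measurable_funeM; apply: emeasurable_funM => //.
    exact: (measurableT_comp measurable_long_sum mxy).
rewrite (ge0_integral_torus_unfold Au y measurable_short (riesz_short_ge0 s_gt0) mphi phi0 pphi).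
rewrite integral_riesz_short// -/ci.
have -> : (\int[tor]_x ((\esum_(w in dual0) (long w (x - y)%R)%:E) *
     (1 - torus_cos u 0 (x - y)%R)%:E) = (B - heat_coef u)%:E)%E.
  transitivity (\int[tor]_x (\esum_(z in [set: 'cV[int]_d]) if z == 0%R then 0 else
      (heat_coef (Bd *m ivec z)%R * ((1 + torus_cos (Bd *m ivec z)%R 0 (x - y)%R) *
        (1 - torus_cos u 0 (x - y)%R)))%:E))%E.
    apply: eq_integral => x _; rewrite esum_dual0 muleC -esumZl//; last first.
      by move=> z; case: (z == 0) => //; rewrite lee_fin.
    apply: eq_esum => z _; case: (z == 0); first by rewrite mule0.
    by rewrite muleC -EFinM /long mulrA.
  rewrite (ge0_integral_esum (I := 'cV[int]_d))//; last 2 first.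
  - move=> z; case: (z == 0) => //; apply/measurable_EFinP.
    have m1 : measurable_fun setT (fun x => 1 + torus_cos (Bd *m ivec z) 0 x).
      by apply: measurable_funD => //; exact: measurable_torus_cos.
    apply: measurable_funM => //; apply: measurable_funM.
      exact: (measurableT_comp m1 mxy).
    exact: (measurableT_comp mphi mxy).
  - move=> z x; case: (z == 0) => //; rewrite lee_fin mulr_ge0 ?heat_coef_ge0//.
    by rewrite mulr_ge0// torus_cosD1_ge0.
  (* Only [u] and [- u] lose weight, half of their coefficient each; these coefficients being equal,
     the total is [B - heat_coef u]. *)
  pose h w := heat_coef w * (1 - (w == u)%:R / 2 - (w == - u)%:R / 2).
  transitivity (\esum_(w in dual0) (h w)%:E)%E.
    rewrite esum_dual0; apply: eq_esum => z _; have [//|z0] := eqVneq z 0.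
      by rewrite integral0.
    have dw : dual_lattice A (Bd *m ivec z).
      by rewrite dual_latticeE//; apply/latticeP; exists z.
    have w0 : Bd *m ivec z != 0.
      apply: contra_neq z0 => h0; apply: (lattice_inj Bdu).
      by rewrite h0 ivec0 mulmx0.
    under eq_integral do rewrite EFinM.
    rewrite ge0_integralZl ?lee_fin ?heat_coef_ge0//.
    - by rewrite integral_torus_cos2.
    - apply/measurable_EFinP.
      have m1 : measurable_fun setT (fun x => 1 + torus_cos (Bd *m ivec z) 0 x).
        by apply: measurable_funD => //; exact: measurable_torus_cos.
      apply: measurable_funM; first exact: (measurableT_comp m1 mxy).
      exact: (measurableT_comp mphi mxy).
    - by move=> x _; rewrite lee_fin mulr_ge0// torus_cosD1_ge0.
  have h0 w : 0 <= h w.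
    rewrite mulr_ge0 ?heat_coef_ge0//.
    by case: (w == u); case: (w == - u); rewrite ?mul1r ?mul0r; lra.
  have dNu : dual_lattice A (- u).
    by move=> v Av; rewrite dotvNl rpredN; exact: du.
  have delta v : dual_lattice A v -> v != 0 -> heat_coef v = heat_coef u ->
      (\esum_(w in dual0) (heat_coef w * ((w == v)%:R / 2))%:E = (heat_coef u / 2)%:E)%E.
    move=> dv v0 <-; rewrite (esum_eq1 (i := v)) ?eqxx ?mul1r//.
    - by split=> //; apply/eqP.
    - by rewrite lee_fin mulr_ge0 ?heat_coef_ge0.
    - by move=> w _ /negbTE ->; rewrite mul0r mulr0.
  (* The two halves are added back rather than subtracted, so that only sums of nonnegative families
     occur. *)
  have sumB : (\esum_(w in dual0) (h w)%:E + (heat_coef u / 2)%:E + (heat_coef u / 2)%:E = B%:E)%E.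
    rewrite -{1}(delta u)// -(delta (- u)) ?oppr_eq0 ?heat_coefN//.
    have p0 v w : (0 <= (heat_coef w * ((w == v)%:R / 2))%:E)%E.
      by rewrite lee_fin mulr_ge0 ?heat_coef_ge0// divr_ge0.
    have h0' w : (0 <= (h w)%:E)%E by rewrite lee_fin.
    rewrite -esumD// -esumD//; last by move=> w _; apply: adde_ge0.
    rewrite BE; apply: eq_esum => w _; rewrite -!EFinD; congr EFin.
    by rewrite /h; ring.
  move: sumB; case: (\esum_(w in dual0) (h w)%:E)%E => //= r.
  by rewrite -!EFinD => -[<-]; congr EFin; field.
rewrite -[X in (_ * (_ - X) + _)%E]fineK ?heat_int_tail_fin ?(ltW qu)//.
rewrite heat_int_tail0// -EFinB -!EFinM -EFinD; congr EFin.
by rewrite /riesz_fourier -(heat_total u0); ring.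
Qed.

End periodic_riesz_torus.

(** * Finiteness of the lattice points in a ball *)

Section lattice_finiteness.
Context {R : realType} {d : nat}.
Implicit Types x : 'cV[R]_d.

Lemma coor_le_norm x (i : 'I_d) : `|x i 0| <= `|x|.
Proof.
rewrite -[ `|x| ]/(mx_norm x) mx_normrE.
by have := le_bigmax 0 (fun ij : 'I_d * 'I_1 => `|x ij.1 ij.2|) (i, 0).
Qed.

Lemma dotv_le_norm x : dotv x x <= d%:R * `|x| ^+ 2.
Proof.
rewrite mulr_natl -[X in _ <= _ *+ X]card_ord -sumr_const.
apply: ler_sum => i _; rewrite -expr2 -real_normK ?num_real//.
by rewrite lerXn2r ?nnegrE// coor_le_norm.
Qed.

Lemma bounded_dotv (D : set 'cV[R]_d) : bounded_set D ->
  exists2 M : R, 0 < M & forall x, D x -> dotv x x <= M.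
Proof.
move=> /pinfty_ex_gt0[M M0 DM]; exists (d%:R * M ^+ 2 + 1).
  by rewrite ltr_wpDl// mulr_ge0// sqr_ge0.
move=> x /DM xM; apply: (le_trans (dotv_le_norm x)); rewrite ler_wpDr//.
by rewrite ler_wpM2l// lerXn2r ?nnegrE// ltW.
Qed.

Lemma finite_lattice_ball (B : 'M[R]_d) (M : R) : B \in unitmx ->
  finite_set [set w | lattice B w /\ dotv w w <= M].
Proof.
move=> Bu; have [C C0 hC] := mulmx_dotv_bound (invmx B).
have [n nP] : exists n : nat, C * M <= n%:R ^+ 2.
  exists (Num.truncn (`|C * M| + 1)).+1; apply: (le_trans (ler_norm _)).
  have h : `|C * M| + 1 <= (Num.truncn (`|C * M| + 1)).+1%:R by rewrite ltW// truncnS_gt.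
  have := normr_ge0 (C * M).
  move: h; set a := `|_|; set b := _%:R => *; nra.
(* Integer coordinates in [-n, n] are coded, after a shift by [n], by the 2 n + 1 ordinals, so the
   ball lies in the image of a finite type. *)
apply: (@sub_finite_set _ _ [set B *m ivec (\col_i ((M' i 0)%:Z - n%:Z))
    | M' in [set: 'cV['I_(2 * n).+1]_d]]); last exact/finite_image/finite_finset.
move=> w [/latticeP[z ->] wM].
have zn i : `|z i 0| <= n%:Z.
  have h : dotv (ivec z) (ivec z) <= n%:R ^+ 2 :> R.
    apply: le_trans nP; apply: (@le_trans _ _ (C * dotv (B *m ivec z) (B *m ivec z))).
      by rewrite -{1 2}[ivec z](mulKmx Bu); exact: hC.
    by rewrite ler_wpM2l// ltW.
  have := le_trans (coor_le_enorm (ivec z : 'cV[R]_d) i) _.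
  move=> /(_ n%:R); rewrite /enorm -[X in _ <= X]ger0_norm ?ler0n// -sqrtr_sqr ler_sqrt ?sqr_ge0//.
  by move=> /(_ h); rewrite mxE -intr_norm -[n%:R]/((n%:Z)%:~R) ler_int.
have zn2 i : (`|(z i 0%R + n%:Z)%R|%N < (2 * n).+1)%N.
  by have := zn i; rewrite ler_norml ltnS => /andP[h1 h2]; lia.
exists (\col_i Ordinal (zn2 i)) => //; congr (_ *m ivec _); apply/matrixP => i j.
rewrite (ord1 j) !mxE /=; have := zn i; rewrite ler_norml => /andP[h1 h2]; lia.
Qed.

End lattice_finiteness.

(** * Expected energy of the determinantal process *)

Section frequencies.
Context {R : realType} {d : nat}.
Variables (A : 'M[R]_d) (Au : A \in unitmx).
Variables (D : set 'cV[R]_d) (boundedD : bounded_set D) (N : nat).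

Definition freq_set : set 'cV[R]_d :=
  dual_lattice A `&` [set N%:R `^ d%:R^-1 *: x | x in D].

Definition freq : {fset 'cV[R]_d} := fset_set freq_set.

Lemma finite_freq_set : finite_set freq_set.
Proof.
have [M M0 DM] := bounded_dotv boundedD.
have Bdu : invmx A^T \in unitmx by rewrite unitmx_inv unitmx_tr.
pose c := N%:R `^ d%:R^-1 : R.
apply: sub_finite_set (finite_lattice_ball (c ^+ 2 * M) Bdu) => w [dw [x Dx wE]].
split; first by rewrite -dual_latticeE.
rewrite -{}wE.
rewrite dotvZl dotvC dotvZl mulrA -expr2.
by rewrite ler_wpM2l ?sqr_ge0// DM.
Qed.

Lemma mem_freq w : (w \in freq) = (w \in freq_set).
Proof. by rewrite in_fset_set//; exact: finite_freq_set. Qed.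

Lemma freq_dual w : w \in freq -> dual_lattice A w.
Proof. by rewrite mem_freq => /set_mem[]. Qed.

(** [f] is general in the value of [kappa] so as to serve both the count [npoints], where that value
    is the summand, and the kernel, where it is a factor. *)
Lemma sum_kappa (M : nmodType) (F : 'cV[R]_d -> M) (f : nat -> 'cV[R]_d -> M) :
  (forall w, f 0 w = 0) -> (forall w, f 1 w = F w) ->
  \sum_(w \in dual_lattice A) f (kappa A D N w) w = \sum_(w <- freq) F w.
Proof.
move=> f0 f1.
have kE w : kappa A D N w = (w \in freq_set) by [].
rewrite -(@fsbig_widen _ _ _ _ freq_set)//.
- rewrite fsbig_finite//; last exact: finite_freq_set.
  rewrite big_seq_cond [RHS]big_seq_cond; apply: eq_bigr => w.
  by rewrite andbT kE -/freq mem_freq => ->.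
- by move=> w [].
- by move=> w [_ nw]; rewrite /preimage/= kE memNset.
Qed.

Lemma npointsE : npoints A D N = size freq.
Proof.
rewrite /npoints (sum_kappa (F := fun=> 1%N) (f := fun n _ => n))//.
by rewrite sum1_size.
Qed.

Lemma lattice_kernelE u v :
  lattice_kernel A D N u v = \sum_(w <- freq) expi (2 * pi * dotv (u - v) w).
Proof.
pose f n w := n%:R * expi (2 * pi * dotv (u - v) w) : R[i].
rewrite /lattice_kernel (sum_kappa (F := f 1) (f := f)).
- by apply: eq_bigr => w _; rewrite /f mul1r.
- by move=> w; rewrite /f mul0r.
- by [].
Qed.

Lemma Re_expiM (a b : R) : complex.Re (expi a * expi b) = cos (a + b).
Proof. by rewrite cosD. Qed.

(** The diagonal product, the squared number of frequencies, is written as a double sum of ones and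
    matched with the cosines of the off-diagonal product, so that every summand is nonnegative. *)
Lemma Re_det_lattice_kernel (t : 2.-tuple 'cV[R]_d) :
  complex.Re (\det (\matrix_(i < 2, j < 2)
    lattice_kernel A D N (tnth t i) (tnth t j))) =
  \sum_(w <- freq) \sum_(w' <- freq)
    (1 - torus_cos (w - w') 0 (tnth t 0 - tnth t 1)).
Proof.
set x := tnth t 0; set y := tnth t 1.
have Kd z : lattice_kernel A D N z z = (size freq)%:R.
  rewrite lattice_kernelE subrr -sum1_size natr_sum; apply: eq_bigr => w _.
  by rewrite /expi /dotv big1 ?mulr0 ?cos0 ?sin0// => i _; rewrite mxE mul0r.
rewrite (expand_det_row _ ord0) !big_ord_recl big_ord0 /cofactor !det_mx11 !mxE.
rewrite (_ : lift ord0 _ = 1) ?(_ : lift (lift _ _) _ = 0); try exact/val_inj.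
rewrite (_ : lift _ _ = ord0); last exact/val_inj.
rewrite -/x -/y !Kd expr0 expr1 mul1r addr0 mulN1r mulrN raddfB/= -natrM.
rewrite (_ : complex.Re (lattice_kernel A D N x y * lattice_kernel A D N y x) =
    \sum_(w <- freq) \sum_(w' <- freq) torus_cos (w - w') 0 (x - y)); last first.
  rewrite !lattice_kernelE mulr_suml raddf_sum; apply: eq_bigr => w _.
  rewrite mulr_sumr raddf_sum; apply: eq_bigr => w' _.
  rewrite [LHS](Re_expiM _ _) -(opprB x y) (dotvNl (x - y)); congr cos; move: (x - y) => z.
  by rewrite !(dotvC z) dotvDl dotvNl; ring.
rewrite -[(_ * _)%:R]/(1 *+ (_ * _)) raddfMn/=.
rewrite (_ : 1 *+ _ = \sum_(w <- freq) \sum_(w' <- freq) (1 : R)); last first.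
  by rewrite !big_const_seq !count_predT !iter_addr_0 mulrnA.
by rewrite -sumrB; apply: eq_bigr => w _; rewrite -sumrB.
Qed.

End frequencies.

(** * Pairs of points and the two-point intensity *)

Section pair_correlation.
Context {R : realType} {d1 : measure_display} {V : measurableType d1}.
Variable m : {sigma_finite_measure set V -> \bar R}.

Lemma ge0_integral_tuple1 (f : V -> \bar R) :
  measurable_fun setT f -> (forall x, 0 <= f x)%E ->
  (\int[tuple_measure m 1]_t f (tnth t ord0) = \int[m]_x f x)%E.
Proof.
move=> mf f0.
have mg : measurable_fun setT (fun t : 1.-tuple V => f (tnth t ord0)).
  by apply: measurableT_comp => //; exact: measurable_tnth.
rewrite (@ge0_integral_pushforward _ _ _ _ R _
  (@measurable_tcons _ V 0) (product_measure1 m (tuple_measure m 0)))//.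
rewrite preimage_setT fubini_tonelli1//; last 2 first.
- by apply: measurableT_comp => //; exact: measurable_tcons.
- by move=> t; exact: f0.
apply: eq_integral => x _; rewrite /fubini_F /=.
transitivity (\int[dirac ([tuple] : 0.-tuple V)]_(y in setT) cst (f x) y)%E.
  by apply: eq_integral => y _; rewrite (tnth_nth x).
by rewrite integral_dirac// [X in (X * _)%E]diracE in_setT mul1e.
Qed.

(** The first point is integrated inside: for [f] a function of [x - y], the inner integral is then
    a torus integral translated by a fixed [y]. *)
Lemma ge0_integral_tuple2 (f : V -> V -> \bar R) :
  measurable_fun setT (fun p : V * V => f p.1 p.2) -> (forall x y, 0 <= f x y)%E ->
  (\int[tuple_measure m 2]_t f (tnth t ord0) (tnth t 1%R) =
   \int[m]_y \int[m]_x f x y)%E.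
Proof.
move=> mf f0.
have mg : measurable_fun setT (fun t : 2.-tuple V => f (tnth t ord0) (tnth t 1)).
  have mp : measurable_fun setT (fun t : 2.-tuple V => (tnth t ord0, tnth t 1)).
    by apply: measurable_fun_pair; exact: measurable_tnth.
  exact: (measurableT_comp mf mp).
rewrite (@ge0_integral_pushforward _ _ _ _ R _
  (@measurable_tcons _ V 1) (product_measure1 m (tuple_measure m 1)))//.
rewrite preimage_setT fubini_tonelli2//; last 2 first.
- by apply: measurableT_comp => //; exact: measurable_tcons.
- by move=> t; exact: f0.
rewrite -[RHS]ge0_integral_tuple1; last 2 first.
- exact: (measurable_fun_fubini_tonelli_G (fun p : V * V => f p.1 p.2)).
- by move=> y; exact: integral_ge0.
apply: eq_integral => t _; rewrite /fubini_G /=; apply: eq_integral => x _ /=.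
by rewrite !(tnth_nth x).
Qed.

End pair_correlation.

Section pair_intensity.
Local Open Scope ereal_scope.
Context {R : realType} {d dV : measure_display} {T : measurableType d}
  {V : measurableType dV}.
Variables (P : probability T R) (n : nat) (X : {RV P >-> n.-tuple V}).
Variables (mu : {sigma_finite_measure set V -> \bar R}) (rho : 2.-tuple V -> R).
Hypotheses (mrho : measurable_fun setT rho) (rho_ge0 : forall t, (0 <= rho t)%R).
Hypothesis Xrho : joint_intensity X mu rho.

Lemma big_pair_ffun (F : 'I_n -> 'I_n -> \bar R) :
  \sum_(f : {ffun 'I_2 -> 'I_n} | injectiveb f) F (f ord0) (f 1%R) =
  \sum_(k < n) \sum_(j < n | j != k) F k j.
Proof.
rewrite pair_big_dep/=.
pose g (p : 'I_n * 'I_n) : {ffun 'I_2 -> 'I_n} :=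
  [ffun i => if i == ord0 then p.1 else p.2].
pose g' (f : {ffun 'I_2 -> 'I_n}) := (f ord0, f 1%R).
have i2 (i : 'I_2) : i = ord0 \/ i = 1%R.
  by case: i => -[|[|//]] ?; [left|right]; exact/val_inj.
have gK : cancel g g' by move=> [k j]; rewrite /g' /g !ffunE.
have g'K : cancel g' g.
  by move=> f; apply/ffunP => i; rewrite ffunE; case: (i2 i) => ->.
rewrite (reindex g); last by exists g' => f _; [exact: gK|exact: g'K].
apply: eq_big => [[k j]|[k j] _]; last by rewrite /g !ffunE.
rewrite /= eq_sym; apply/injectiveP/idP => [inj|kj].
  by apply/negP => /eqP kj; have := inj ord0 1%R; rewrite !ffunE/= => /(_ kj).
move=> i i'; rewrite !ffunE; case: (i2 i) (i2 i') => -> [] -> //=.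
  by move/eqP: kj => /[apply].
by move=> /esym; move/eqP: kj => /[apply].
Qed.

(** Injections of a two-element index set are the ordered pairs of distinct indices;
    [ge0_integral_sum_density], applied to the list of injections, extends the defining property of
    the intensity from sets to [h]. *)
Lemma ge0_integral_pairs (h : V -> V -> \bar R) :
  measurable_fun setT (fun p : V * V => h p.1 p.2) -> (forall x y, 0 <= h x y) ->
  \int[P]_u (\sum_(k < n) \sum_(j < n | j != k) h (tnth (X u) k) (tnth (X u) j)) =
  \int[tuple_measure mu 2]_t (h (tnth t ord0) (tnth t 1%R) * (rho t)%:E).
Proof.
move=> mh h0.
pose phi (f : {ffun 'I_2 -> 'I_n}) u : 2.-tuple V := [tuple tnth (X u) (f i) | i < 2].
pose r := [seq f : {ffun 'I_2 -> 'I_n} <- index_enum _ | injectiveb f].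
have mphi f : measurable_fun setT (phi f).
  apply/measurable_fun_tnthP => i.
  rewrite (_ : _ \o _ = fun u => tnth (X u) (f i)).
    by apply: (measurableT_comp (measurable_tnth (f i))); exact: measurable_funPT.
  by apply/funext => u /=; rewrite tnth_mktuple.
have mh' : measurable_fun setT (fun t : 2.-tuple V => h (tnth t ord0) (tnth t 1%R)).
  have mp : measurable_fun setT (fun t : 2.-tuple V => (tnth t ord0, tnth t 1%R)).
    by apply: measurable_fun_pair; exact: measurable_tnth.
  exact: (measurableT_comp mh mp).
rewrite -(ge0_integral_sum_density (m := P) (r := r) (phi := phi) mphi mrho rho_ge0 _ mh')//.
  apply: eq_integral => u _; rewrite big_filter -big_pair_ffun.
  by apply: eq_bigr => f _; rewrite !tnth_mktuple.
move=> B mB; rewrite -Xrho//; apply: eq_integral => u _.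
by rewrite big_filter sumEFin.
Qed.

End pair_intensity.

(** * The exact formula for the expected energy *)

Section expected_energy.
Context {R : realType} {d : nat}.
Variables (A : 'M[R]_d) (Au : A \in unitmx).
Variables (D : set 'cV[R]_d) (boundedD : bounded_set D) (N : nat).
Context {dT : measure_display} {T : measurableType dT}.
Variables (P : probability T R).
Variable X : {RV P >-> (npoints A D N).-tuple 'cV[R]_d}.
Hypothesis detX : determinantal X (torus_measure Au) (lattice_kernel A D N).
Variables (s : R) (s_gt0 : 0 < s) (s_ltd : s < d%:R).

Local Notation tor := (torus_measure Au).
Local Notation W := (freq A D N).

Let phi w (x : 'cV[R]_d) := 1 - torus_cos w 0 x.

Let phi_ge0 w x : 0 <= phi w x.
Proof. by have := cos_le1 (2 * pi * dotv x w + 0); rewrite /phi /torus_cos subr_ge0. Qed.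

Let measurable_phi w : measurable_fun setT (phi w).
Proof. by apply: measurable_funB => //; exact: measurable_torus_cos. Qed.

Let rho (x : 'cV[R]_d) := \sum_(w <- W) \sum_(w' <- W) phi (w - w') x.

Let rho_ge0 x : 0 <= rho x.
Proof. by apply: sumr_ge0 => w _; apply: sumr_ge0. Qed.

Let measurable_rho : measurable_fun setT rho.
Proof. by apply: measurable_sum => w; apply: measurable_sum. Qed.

Let measurable_shifted : measurable_fun setT (riesz_shifted A s).
Proof. exact: measurable_riesz_shifted. Qed.

Let measurable_sub (V := 'cV[R]_d) : measurable_fun setT (fun p : V * V => p.1 - p.2).
Proof. by apply: measurable_cVB; [exact: measurable_fst|exact: measurable_snd]. Qed.

(** The intensity depends on [x - y] only, so the inner integral over the torus does not depend on
    [y], and the outer one is over a probability. *)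
Lemma expected_riesz_shifted :
  (\int[P]_u (\sum_(k < npoints A D N) \sum_(j < npoints A D N | j != k)
      riesz_shifted A s (tnth (X u) k - tnth (X u) j)%R) =
   (\sum_(w <- W) \sum_(w' <- W)
      if w - w' == 0 then 0 else riesz_fourier A s (w - w'))%:E)%E.
Proof.
have Xrho : joint_intensity X tor (fun t : 2.-tuple 'cV[R]_d => rho (tnth t ord0 - tnth t 1)).
  have /= := detX.2 2 isT; congr (joint_intensity _ _ _); apply/funext => t.
  exact: (Re_det_lattice_kernel Au boundedD).
have mt : measurable_fun setT (fun t : 2.-tuple 'cV[R]_d => tnth t ord0 - tnth t 1).
  have mp : measurable_fun setT (fun t : 2.-tuple 'cV[R]_d => (tnth t ord0, tnth t 1)).
    by apply: measurable_fun_pair; exact: measurable_tnth.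
  exact: (measurableT_comp measurable_sub mp).
have mh : measurable_fun setT (fun p : 'cV[R]_d * 'cV[R]_d => riesz_shifted A s (p.1 - p.2)).
  exact: (measurableT_comp measurable_shifted measurable_sub).
have mr : measurable_fun setT (fun p : 'cV[R]_d * 'cV[R]_d => (rho (p.1 - p.2)%R)%:E).
  by apply/measurable_EFinP; exact: (measurableT_comp measurable_rho measurable_sub).
have F0 := riesz_shifted_ge0 Au s_gt0.
rewrite (ge0_integral_pairs (measurableT_comp measurable_rho mt) _ Xrho
  (h := fun x y => riesz_shifted A s (x - y)))//; last first.
  by move=> t; exact: rho_ge0.
rewrite (ge0_integral_tuple2 tor
  (f := fun x y => (riesz_shifted A s (x - y)%R * (rho (x - y)%R)%:E)%E)); last 2 first.
- exact: emeasurable_funM.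
- by move=> x y; rewrite mule_ge0// lee_fin.
have inner (y : 'cV[R]_d) : (\int[tor]_x (riesz_shifted A s (x - y)%R * (rho (x - y)%R)%:E) =
   (\sum_(w <- W) \sum_(w' <- W)
      if w - w' == 0 then 0 else riesz_fourier A s (w - w'))%:E)%E.
  have mxy : measurable_fun setT (fun x : 'cV[R]_d => x - y) by exact: measurable_cVB.
  have mF w : measurable_fun setT
      (fun x : 'cV[R]_d => riesz_shifted A s (x - y)%R * (phi w (x - y)%R)%:E)%E.
    apply: emeasurable_funM; first exact: (measurableT_comp measurable_shifted mxy).
    by apply/measurable_EFinP; exact: (measurableT_comp (measurable_phi w) mxy).
  transitivity (\int[tor]_x (\sum_(w <- W) \sum_(w' <- W)
      (riesz_shifted A s (x - y)%R * (phi (w - w') (x - y)%R)%:E)))%E.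
    apply: eq_integral => x _; rewrite /rho -sumEFin ge0_sume_distrr; last first.
      by move=> w _; rewrite lee_fin sumr_ge0.
    apply: eq_bigr => w _; rewrite -sumEFin ge0_sume_distrr// => w' _.
    by rewrite lee_fin.
  have p0 w x : (0 <= riesz_shifted A s (x - y)%R * (phi w (x - y)%R)%:E)%E.
    by rewrite mule_ge0// lee_fin.
  rewrite ge0_integral_sum//; last 2 first.
  - by move=> w; exact: emeasurable_sum.
  - by move=> w x _; apply: sume_ge0.
  rewrite -sumEFin big_seq [RHS]big_seq; apply: eq_bigr => w /(freq_dual Au boundedD) dw.
  rewrite ge0_integral_sum// -sumEFin big_seq [RHS]big_seq.
  apply: eq_bigr => w' /(freq_dual Au boundedD) dw'.
  rewrite integral_riesz_shifted// => v Av.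
  by rewrite dotvDl dotvNl rpredB//; [exact: dw|exact: dw'].
under eq_integral do rewrite inner.
by rewrite (integral_cst tor)// [X in (_ * X)%E](@probability_setT _ _ _ tor) mule1.
Qed.

Lemma sum_offdiagonal (r : seq 'cV[R]_d) (c : R) : uniq r ->
  \sum_(w <- r) \sum_(w' <- r) (if w - w' == 0 then 0 else c) =
  c * ((size r)%:R ^+ 2 - (size r)%:R).
Proof.
move=> ur; transitivity (\sum_(w <- r) (c * ((size r)%:R - 1))).
  rewrite big_seq [RHS]big_seq; apply: eq_bigr => w wr.
  transitivity (\sum_(w' <- r) (c - (if w' == w then c else 0))).
    by apply: eq_bigr => w' _; rewrite subr_eq0 eq_sym; case: eqP; rewrite ?subrr ?subr0.
  rewrite sumrB -big_mkcond/= -[X in _ - X]big_filter (filter_pred1_uniq ur wr).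
  by rewrite big_seq1 big_const_seq count_predT iter_addr_0 mulrBr mulr1 mulr_natr.
by rewrite big_const_seq count_predT iter_addr_0 -mulr_natr; ring.
Qed.

Lemma expected_riesz_energy :
  (\int[P]_u riesz_energy A s (X u) =
   (2 * pi `^ (d%:R / 2) * (covolume A)^-1 / (Gamma (s / 2) * (d%:R - s))
      * ((npoints A D N)%:R ^+ 2 - (npoints A D N)%:R)
    - pi `^ (s - d%:R / 2) * Gamma ((d%:R - s) / 2) / (Gamma (s / 2) * covolume A)
      * \sum_(w <- W) \sum_(w' <- W) (enorm (w - w') `^ (d%:R - s))^-1)%:E)%E.
Proof.
set n := npoints A D N.
(* The constant added to F. Removing it from each of the n^2 - n ordered pairs cancels the
   [riesz_shift] contained in [riesz_fourier]. *)
pose c := (covolume A)^-1 * riesz_shift A s.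
pose G u := (\sum_(k < n) \sum_(j < n | j != k)
  riesz_shifted A s (tnth (X u) k - tnth (X u) j)%R)%E.
pose K := \sum_(k < n) \sum_(j < n | j != k) (- c).
have KE : K = - c * (n%:R ^+ 2 - n%:R).
  transitivity (\sum_(k < n) (- c * (n%:R - 1))).
    apply: eq_bigr => k _; apply: (addrI (- c)).
    rewrite -[LHS](bigD1 k (P := predT))// sumr_const card_ord -[in LHS]mulr_natr; ring.
  by rewrite sumr_const card_ord -mulr_natr; ring.
have G0 u : (0 <= G u)%E.
  by apply: sume_ge0 => k _; apply: sume_ge0 => j _; exact: (riesz_shifted_ge0 Au s_gt0).
have EG u : riesz_energy A s (X u) = (G u + K%:E)%E.
  rewrite /G /K -sumEFin -big_split/=; apply: eq_bigr => k _.
  rewrite -sumEFin -big_split/=; apply: eq_bigr => j _.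
  by rewrite (riesz_shiftedE Au s_gt0 s_ltd) EFinN addeK.
have mG : measurable_fun setT G.
  apply: emeasurable_sum => k; under eq_fun do rewrite -big_filter.
  apply: emeasurable_sum => j.
  have mX i : measurable_fun setT (fun u => tnth (X u) i).
    by apply: (measurableT_comp (measurable_tnth i)); exact: measurable_funPT.
  exact: (measurableT_comp measurable_shifted (measurable_cVB (mX k) (mX j))).
have iG : P.-integrable setT G.
  apply/integrableP; split => //; under eq_integral do rewrite gee0_abs//.
  by rewrite expected_riesz_shifted ltry.
under eq_integral do rewrite EG.
rewrite integralD//; last exact: finite_measure_integrable_cst.
rewrite (integral_cst P)// [X in (_ * X)%E](@probability_setT _ _ _ P) mule1.
rewrite expected_riesz_shifted -EFinD KE; congr EFin.
pose a1 := pi `^ (s - d%:R / 2) * Gamma ((d%:R - s) / 2) / Gamma (s / 2).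
pose a0 := 2 * pi `^ (d%:R / 2) / (Gamma (s / 2) * (d%:R - s)).
pose ci := (covolume A)^-1.
have -> : \sum_(w <- W) \sum_(w' <- W) (if w - w' == 0 then 0 else riesz_fourier A s (w - w')) =
   ci * (a0 + riesz_shift A s) * (n%:R ^+ 2 - n%:R) -
   ci * a1 * \sum_(w <- W) \sum_(w' <- W) (enorm (w - w') `^ (d%:R - s))^-1.
  rewrite (npointsE Au boundedD N : n = _) -sum_offdiagonal ?fset_uniq//.
  rewrite mulr_sumr -sumrB; apply: eq_bigr => w _.
  rewrite mulr_sumr -sumrB; apply: eq_bigr => w' _.
  case: ifP => [/eqP ->|_]; last by rewrite /riesz_fourier -/a0 -/a1 -/ci; ring.
  (* On the diagonal 0 to the power d - s is 0 and its inverse is 0, so the sum over all pairs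
     equals the sum over distinct ones. *)
  rewrite /enorm (eqP (_ : dotv _ _ == 0)) ?dotv_eq0// sqrtr0 powR0 ?subr_eq0 ?gt_eqF//.
  by rewrite invr0 mulr0 subr0.
rewrite /c -/ci invfM; move: (\sum_(w <- W) _) (n%:R ^+ 2 - n%:R) => S q.
rewrite /a0 /a1 !invfM -/ci; ring.
Qed.

End expected_energy.

(** * Riemann sums over the dual lattice *)

Section lattice_grid.
Context {R : realType} {d : nat}.
Variables (B : 'M[R]_d) (Bu : B \in unitmx).
Implicit Types (c : R) (x y : 'cV[R]_d).

Lemma norm_le_enorm n (x : 'cV[R]_n) : `|x| <= enorm x.
Proof.
rewrite -[ `|x| ]/(mx_norm x) mx_normrE; apply: bigmax_le => [|[i j] _ /=].
  exact: enorm_ge0.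
by rewrite (ord1 j); exact: coor_le_enorm.
Qed.

Lemma enormZ n c (x : 'cV[R]_n) : enorm (c *: x) = `|c| * enorm x.
Proof.
by rewrite /enorm dotvZl dotvC dotvZl mulrA -expr2 sqrtrM ?sqr_ge0// sqrtr_sqr.
Qed.

(** Rounding to the lattice shrunk by [c]; multiplication by [c] leads back to a point of the
    lattice itself. *)
Definition grid_floor c y : 'cV[R]_d := c^-1 *: lattice_floor B (c *: y).

Lemma grid_floor_dist : exists2 C : R, 0 < C &
  forall c y, 0 < c -> dotv (y - grid_floor c y) (y - grid_floor c y) <= C / c ^+ 2.
Proof.
have [C C0 hC] := lattice_floor_dist Bu; exists C => // c y c0.
have -> : y - grid_floor c y = c^-1 *: (c *: y - lattice_floor B (c *: y)).
  by rewrite scalerBr scalerA mulVf ?gt_eqF// scale1r.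
rewrite dotvZl dotvC dotvZl mulrA -expr2 mulrC -exprVn.
by rewrite ler_wpM2r ?sqr_ge0.
Qed.

(** [Y] is arbitrary: rounding takes countably many values, each on a measurable cell. *)
Lemma measurable_lattice_floor_preimage (Y : set 'cV[R]_d) :
  measurable (lattice_floor B @^-1` Y).
Proof.
have m : measurable_fun setT (fun x => (\1_Y (lattice_floor B x) : R)%:E).
  by apply: (measurable_lattice_floor Bu (h := fun x => (\1_Y x : R)%:E)) => x; rewrite lee_fin.
have := m measurableT _ (emeasurable_set1 1%E); rewrite setTI.
congr (measurable _); apply/seteqP; split => x /=; rewrite indicE.
  by case: (boolP (lattice_floor B x \in Y)) => [/set_mem//|_ /eqP]; rewrite eqe/= eq_sym oner_eq0.
by move=> Yx; rewrite mem_set.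
Qed.

Lemma measurable_cVZ n d' (T : measurableType d') (c : R) (f : T -> 'cV[R]_n) :
  measurable_fun setT f -> measurable_fun setT (fun t => c *: f t).
Proof.
move=> mf; apply: measurable_cV => i.
rewrite [X in measurable_fun _ X](_ : _ = (fun t => c * f t i 0)).
  by apply: measurable_funM => //; exact: measurable_cV_coor.
by apply/funext => t; rewrite mxE.
Qed.

Lemma measurable_grid_floor_preimage c (Y : set 'cV[R]_d) :
  measurable (grid_floor c @^-1` Y).
Proof.
have mc : measurable_fun setT (fun x : 'cV[R]_d => c *: x) by exact: measurable_cVZ.
have := mc measurableT _ (measurable_lattice_floor_preimage [set w | Y (c^-1 *: w)]).
by rewrite setTI.
Qed.

Lemma measurable_grid_floor c : measurable_fun setT (grid_floor c).
Proof.
by move=> _ Y mY; rewrite setTI; exact: measurable_grid_floor_preimage.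
Qed.

Section grid_sequence.
Variable c : R^nat.
Hypotheses (c_gt0 : forall n, 0 < c n) (c_cvg : c n @[n --> \oo] --> +oo).

Lemma grid_floor_norm : exists2 e : R^nat, e n @[n --> \oo] --> 0 &
  forall n y, `|y - grid_floor (c n) y| <= e n.
Proof.
have [C C0 hC] := grid_floor_dist.
exists (fun n => Num.sqrt C * (c n)^-1).
  rewrite -[X in _ --> X](mulr0 (Num.sqrt C)); apply: cvgM; first exact: cvg_cst.
  by rewrite gtr0_cvgV0//; exact: nearW.
move=> n y; apply: (le_trans (norm_le_enorm _)).
rewrite /enorm -[(c n)^-1]ger0_norm ?invr_ge0 ?(ltW (c_gt0 _))//.
rewrite -sqrtr_sqr -sqrtrM ?(ltW C0)// ler_wsqrtr//.
by rewrite exprVn; exact: hC.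
Qed.

Lemma grid_floor_cvg y : grid_floor (c n) y @[n --> \oo] --> y.
Proof.
have [e e0 he] := grid_floor_norm.
apply/cvgrPdist_le => eps eps0; near=> n; apply: (le_trans (he n y)).
near: n; have /cvgrPdist_le/(_ _ eps0) := e0; apply: filterS => n.
by rewrite sub0r normrN; apply: le_trans; exact: ler_norm.
Unshelve. all: by end_near. Qed.

End grid_sequence.

(** Relates the topology of the sup norm to the sigma-algebra of the coordinates. An open set is a
    countable union of preimages under rounding to finer and finer grids: at each mesh, take the
    grid points whose ball of radius the rounding error lies in [U]. *)
Lemma open_measurable_cV (U : set 'cV[R]_d) : open U -> measurable U.
Proof.
move=> oU; pose c n : R := n.+1%:R.
have c0 n : 0 < c n by rewrite ltr0n.
have coo : c n @[n --> \oo] --> +oo.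
  by rewrite -gtr0_cvgV0; [exact: cvg_harmonic|exact: nearW].
have [e e0 he] := grid_floor_norm c0 coo.
pose V n := [set w : 'cV[R]_d | forall y, `|y - w| <= e n -> U y].
have -> : U = \bigcup_n (grid_floor (c n) @^-1` V n).
  apply/seteqP; split => [y Uy|y [n _]]; last by apply.
  have [r /= r0 ryU] := open_subball oU Uy.
  (* A point of the ball around the rounded [y] is at distance at most [2 * e n] from [y]: one error
     for [y], one for that point. *)
  have [n] : exists n, 2 * e n < r / 2.
    have /cvgrPdist_lt/(_ (r / 4)) := e0; rewrite divr_gt0// => /(_ isT)[n _ /(_ n (leqnn n))].
    rewrite sub0r normrN => h; exists n; have := ler_norm (e n); lra.
  exists n => // z zn; apply: (ryU (r / 2)); rewrite ?divr_gt0//=.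
    by rewrite sub0r normrN gtr0_norm ?divr_gt0//; lra.
  rewrite -ball_normE/=.
  have := ler_normD (y - grid_floor (c n) y) (grid_floor (c n) y - z).
  rewrite subrKA => h; have := he n y; rewrite -normrN opprB in zn; lra.
by apply: bigcup_measurable => n _; exact: measurable_grid_floor_preimage.
Qed.

End lattice_grid.

(** * The measure [nu] and sums over the dual lattice *)

Section dual_measure.
Context {R : realType} {d : nat}.
Variables (A : 'M[R]_d) (Au : A \in unitmx).
Local Notation Bd := (invmx A^T).
Local Notation nu := (dual_measure A).
Local Notation lam := (@lebesgue_cV R d).

Let Bdu : Bd \in unitmx. Proof. by rewrite unitmx_inv unitmx_tr. Qed.

Let covol_gt0 : 0 < covolume A.
Proof. by rewrite normr_gt0 -unitfE -unitmxE. Qed.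

Lemma covolume_dual : covolume Bd = (covolume A)^-1.
Proof. by rewrite /covolume det_inv det_tr normfV. Qed.

Lemma dual_measureE (Y : set 'cV[R]_d) : (nu Y = (covolume A)%:E * lam Y)%E.
Proof.
rewrite /dual_measure /mscale /= lebesgue_fundamental_domain//= covolume_dual.
by rewrite invrK.
Qed.

Lemma ge0_integral_dual_measure (f : 'cV[R]_d -> \bar R) :
  measurable_fun setT f -> (forall x, 0 <= f x)%E ->
  (\int[nu]_x f x = (covolume A)%:E * \int[lam]_x f x)%E.
Proof.
move=> mf f0; rewrite [LHS](@ge0_integral_mscale _ _ R lam)//=.
by rewrite lebesgue_fundamental_domain//= covolume_dual invrK.
Qed.

Lemma ge0_integral_scale (c : R) (f : 'cV[R]_d -> \bar R) : 0 < c ->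
  measurable_fun setT f -> (forall x, 0 <= f x)%E ->
  (\int[lam]_x f (c *: x)%R = (c ^+ d)^-1%:E * \int[lam]_x f x)%E.
Proof.
move=> c0 mf f0; have cu : (c%:M : 'M[R]_d) \in unitmx.
  by rewrite unitmxE det_scalar unitfE expf_eq0 gt_eqF// andbF.
have := ge0_integral_mulmx cu mf f0.
rewrite det_scalar ger0_norm ?exprn_ge0 ?(ltW c0)// => <-.
by apply: eq_integral => x _; rewrite mul_scalar_mx.
Qed.

(** A cell of the dual lattice has [nu]-mass 1, hence a cell of the grid shrunk by [c] has mass
    c^(-d). *)
Lemma esum_dual_grid (c : R) (h : 'cV[R]_d -> \bar R) : 0 < c ->
  (forall x, 0 <= h x)%E ->
  (\esum_(w in lattice Bd) h w =
   (c ^+ d)%:E * \int[nu]_y h (c *: grid_floor Bd c y)%R)%E.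
Proof.
move=> c0 h0.
have gE y : c *: grid_floor Bd c y = lattice_floor Bd (c *: y).
  by rewrite /grid_floor scalerA mulfV ?gt_eqF// scale1r.
under eq_integral do rewrite gE.
have ml := measurable_lattice_floor Bdu h0.
have mc : measurable_fun setT (fun x : 'cV[R]_d => c *: x) by exact: measurable_cVZ.
rewrite ge0_integral_dual_measure//; last exact: (measurableT_comp ml mc).
rewrite (ge0_integral_scale c0 ml)// ge0_integral_lattice_floor// covolume_dual.
have cd0 : c ^+ d != 0 by rewrite expf_neq0 ?gt_eqF.
rewrite !muleA -!EFinM (_ : _ * _ = 1) ?mul1e//.
by field; rewrite cd0 gt_eqF.
Qed.

End dual_measure.

(** * Integrability of the Riesz kernel *)

Section riesz_kernel.
Context {R : realType} {d : nat}.
Local Notation lam := (@lebesgue_cV R d).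
Local Notation mu := (@lebesgue_measure R).

(* It vanishes at 0, where Rocq's 0 `^ t is 0 for t != 0 and 0^-1 = 0. *)
Definition riesz_kernel (t : R) (z : 'cV[R]_d) : R := (enorm z `^ t)^-1.

Lemma riesz_kernel_ge0 t z : 0 <= riesz_kernel t z.
Proof. by rewrite invr_ge0 powR_ge0. Qed.

Lemma measurable_riesz_kernel t : measurable_fun setT (riesz_kernel t).
Proof.
apply: (measurableT_comp measurable_invr); apply: (measurableT_comp (measurable_powR t)).
exact: measurable_enorm.
Qed.

Lemma riesz_kernelE t z : riesz_kernel t z = (dotv z z) `^ (- (t / 2)).
Proof.
rewrite powRN /riesz_kernel -enorm_sqr -powR_mulrn ?enorm_ge0// -powRrM.
by congr (_ `^ _)^-1; field.
Qed.

Lemma ge0_integral_gauss (c : R) : 0 < c ->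
  (\int[lam]_x (expR (- (dotv x x * c)))%:E = (Num.sqrt (pi / c) ^+ d)%:E)%E.
Proof.
move=> c0; have := ge0_integral_gauss_cV (0 : 'cV[R]_d) (pi / 2) c0.
rewrite cos_pihalf mulr0 addr0 mulr1 => <-; apply: eq_integral => x _.
rewrite /torus_cos (_ : dotv x 0 = 0); last by rewrite /dotv big1// => i _; rewrite mxE mulr0.
by rewrite mulr0 add0r cos_pihalf addr0 mulr1 enorm_sqr.
Qed.

Lemma measurable_dotvv : measurable_fun setT (fun x : 'cV[R]_d => dotv x x).
Proof.
under eq_fun do rewrite -enorm_sqr.
by apply: measurable_funX; exact: measurable_enorm.
Qed.

Lemma measurable_ball_indic (L : R) :
  measurable_fun setT (fun x : 'cV[R]_d => (dotv x x <= L)%R%:R : R).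
Proof.
have m : measurable_fun setT (fun b : bool => b%:R : R) by [].
have mb : measurable_fun setT (fun z : 'cV[R]_d => dotv z z <= L).
  by apply: measurable_fun_ler => //; exact: measurable_dotvv.
exact: (measurableT_comp m mb).
Qed.

(** On the ball, 1 <= exp (L - |x|^2), which is integrable. *)
Lemma ball_volume_lty (L : R) :
  (\int[lam]_x ((dotv x x <= L)%R%:R)%:E < +oo)%E.
Proof.
apply: (@le_lt_trans _ _ (\int[lam]_x (expR L * expR (- (dotv x x * 1)))%:E)%E).
  apply: ge0_le_integral => //.
  - by apply/measurable_EFinP; exact: measurable_ball_indic.
  - apply/measurable_EFinP; apply: measurable_funM => //.
    do 2 apply: measurableT_comp => //; apply: measurable_funM => //.
    exact: measurable_dotvv.
  - move=> x _; rewrite lee_fin -expRD mulr1; case: (leP (dotv x x) L) => h.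
      by rewrite -expR0 ler_expR subr_ge0.
    exact: expR_ge0.
under eq_integral do rewrite EFinM.
rewrite ge0_integralZl ?lee_fin ?expR_ge0//.
- by rewrite ge0_integral_gauss// -EFinM ltry.
- apply/measurable_EFinP.
  do 2 apply: measurableT_comp => //; apply: measurable_funM => //.
  exact: measurable_dotvv.
Qed.

Variables (t : R) (t_gt0 : 0 < t) (t_ltd : t < d%:R).

Let b := t / 2.
Let b_gt0 : 0 < b. Proof. by rewrite divr_gt0. Qed.

(** If |z|^2 <= u and |z|^2 <= 1 then |z|^2 m(u) <= 1, so both constraints together are dominated by
    the Gaussian e exp (- |z|^2 m(u)); this accounts for the factor [expR 1] in [F]. *)
Let m (u : R) : R := Num.max u^-1 1.

Let m_gt0 u : 0 < m u.
Proof. by rewrite lt_max ltr01 orbT. Qed.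

Let F (p : 'cV[R]_d * R) : R :=
  (0 < p.2)%R%:R * (b * p.2 `^ (- b - 1)) * (expR 1 * expR (- (dotv p.1 p.1 * m p.2))).

Let F0 p : 0 <= F p.
Proof.
apply: mulr_ge0; last by rewrite mulr_ge0 ?expR_ge0.
by rewrite mulr_ge0// mulr_ge0 ?powR_ge0 ?(ltW b_gt0).
Qed.

Let mF : measurable_fun setT (EFin \o F).
Proof.
apply/measurable_EFinP; apply: measurable_funM; first apply: measurable_funM.
- have mn : measurable_fun setT (fun b : bool => b%:R : R) by [].
  have mb : measurable_fun setT (fun z : 'cV[R]_d * R => 0 < z.2).
    exact: measurable_fun_ltr.
  exact: (measurableT_comp mn mb).
- apply: measurable_funM => //.
  exact: (measurableT_comp (measurable_powR _) measurable_snd).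
- apply: measurable_funM => //; do 2 apply: measurableT_comp => //.
  apply: measurable_funM; first exact: (measurableT_comp measurable_dotvv measurable_fst).
  apply: measurable_maxr => //.
  exact: (measurableT_comp measurable_invr measurable_snd).
Qed.

(* q^-b is a superposition of the indicators of {q <= u}, which are dominated by
   Gaussians. *)
Let kernel_le z :
  (((dotv z z <= 1)%R%:R * riesz_kernel t z)%:E <= \int[mu]_u (F (z, u))%:E)%E.
Proof.
have [q1|q1] := leP (dotv z z) 1; last first.
  by rewrite mul0r; apply: integral_ge0 => u _; rewrite lee_fin.
have := dotv_ge0 z; rewrite le_eqVlt => /predU1P[q0|q0].
  rewrite riesz_kernelE -q0 powR0 ?oppr_eq0 ?gt_eqF// mulr0.
  by apply: integral_ge0 => u _; rewrite lee_fin.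
have kE : (riesz_kernel t z)%:E =
    (\int[mu]_(u in `[dotv z z, +oo[) (b * u `^ (- b - 1))%:E)%E.
  under eq_integral do rewrite EFinM.
  rewrite ge0_integralZl//.
  - by rewrite integral_powR_tail// -EFinM riesz_kernelE; congr EFin; field; rewrite gt_eqF.
  - by apply/measurable_EFinP; apply: measurable_funTS; exact: measurable_powR.
  - by move=> u _; rewrite lee_fin powR_ge0.
  - by rewrite lee_fin ltW.
rewrite mul1r kE integral_mkcond; apply: ge0_le_integral => //.
- by move=> u _; rewrite patchE; case: ifP => // _; rewrite lee_fin mulr_ge0 ?powR_ge0// ltW.
- apply/(measurable_restrictT _ _).1 => //; apply/measurable_EFinP.
  by apply: measurable_funM => //; apply: measurable_funTS; exact: measurable_powR.
- by apply: (measurableT_comp mF); exact: pair1_measurable.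
- move=> u _; rewrite patchE; case: ifPn => [|_]; last by rewrite lee_fin.
  move=> /set_mem/=; rewrite in_itv/= andbT => qu; have u0 : 0 < u by exact: lt_le_trans qu.
  rewrite lee_fin /F/= u0 mul1r ler_peMr//.
    by rewrite mulr_ge0 ?powR_ge0 ?(ltW b_gt0).
  rewrite -expRD -[X in X <= _]expR0 ler_expR subr_ge0 /m; case: (leP u^-1 1) => _.
    by rewrite mulr1.
  by rewrite -ler_pdivlMr ?invr_gt0// invrK mul1r.
Qed.

(** Gaussian integrals stand in for polar coordinates. By Tonelli's theorem there remains, up to a
    constant, the integral of u^(-b-1) min(u, 1)^(d/2) over u > 0, which converges at 0 because t <
    d and at infinity because t > 0. *)
Lemma riesz_kernel_near_lty :
  (\int[lam]_z ((dotv z z <= 1)%R%:R * riesz_kernel t z)%:E < +oo)%E.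
Proof.
apply: (@le_lt_trans _ _ (\int[lam]_z \int[mu]_u (F (z, u))%:E)%E).
  apply: ge0_le_integral => //.
  - by move=> z _; rewrite lee_fin mulr_ge0 ?riesz_kernel_ge0.
  - apply/measurable_EFinP; apply: measurable_funM; first exact: measurable_ball_indic.
    exact: measurable_riesz_kernel.
  - exact: (measurable_fun_fubini_tonelli_F (m2 := mu) (EFin \o F)).
rewrite (@fubini_tonelli _ _ _ _ R lam mu (EFin \o F))//.
pose C : R := b * expR 1 * Num.sqrt pi ^+ d.
have C0 : 0 <= C.
  by apply: mulr_ge0; [rewrite mulr_ge0 ?expR_ge0 ?(ltW b_gt0)|rewrite exprn_ge0].
have inner u : (\int[lam]_z (F (z, u))%:E =
    ((0 < u)%R%:R * (C * u `^ (- b - 1) * (Num.sqrt (m u)^-1) ^+ d))%:E)%E.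
  transitivity (((0 < u)%R%:R * (b * u `^ (- b - 1)) * expR 1)%:E *
      \int[lam]_z (expR (- (dotv z z * m u)))%:E)%E.
    rewrite -ge0_integralZl//.
    - by apply: eq_integral => z _; rewrite -EFinM /F/= mulrA.
    - apply/measurable_EFinP; do 2 apply: measurableT_comp => //.
      by apply: measurable_funM => //; exact: measurable_dotvv.
    - by rewrite lee_fin mulr_ge0 ?expR_ge0// mulr_ge0// mulr_ge0 ?powR_ge0 ?(ltW b_gt0).
  rewrite ge0_integral_gauss// -EFinM sqrtrM ?pi_ge0// exprMn /C; congr EFin; ring.
rewrite [X in (X < _)%E](_ : _ = \int[mu]_u ((0 < u)%R%:R *
    (C * u `^ (- b - 1) * (Num.sqrt (m u)^-1) ^+ d))%:E)%E; last first.
  by apply: eq_integral => u _; exact: inner.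
rewrite integral_bool.
rewrite (_ : [set u | _] = `]0, +oo[%classic); last first.
  by apply/seteqP; split => u /=; rewrite in_itv/= andbT.
rewrite integral0y_split; last 2 first.
- apply/measurable_EFinP; apply: measurable_funM.
    by apply: measurable_funM => //; exact: measurable_powR.
  have ms : measurable_fun setT (@Num.sqrt R).
    by apply: continuous_measurable_fun; exact: sqrt_continuous.
  apply: measurable_funX; apply: (measurableT_comp ms).
  apply: (measurableT_comp measurable_invr).
  by apply: measurable_maxr => //; exact: measurable_invr.
- by move=> u; rewrite lee_fin mulr_ge0 ?exprn_ge0// mulr_ge0 ?powR_ge0.
have e0 : 0 < d%:R / 2 - b by rewrite /b -mulrBl divr_gt0// subr_gt0.
apply: lte_add_pinfty.
  rewrite [X in (X < _)%E](_ : _ = \int[mu]_(u in `]0%R, 1%R[)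
      (C%:E * (u `^ (d%:R / 2 - b - 1))%:E))%E; last first.
    apply: eq_integral.
    move=> u /set_mem/=; rewrite in_itv/= => /andP[u0 u1]; rewrite -EFinM; congr EFin.
    rewrite -mulrA; congr (_ * _); rewrite /m max_l; last by rewrite invf_ge1// ltW.
    rewrite invrK -powR12_sqrt ?(ltW u0)// -powR_mulrn ?powR_ge0// -powRrM.
    rewrite -powRD ?(gt_eqF u0) ?implybT//.
    by congr (_ `^ _); field.
  rewrite ge0_integralZl//.
  - rewrite lte_mul_pinfty ?lee_fin//.
    by apply: le_lt_trans (integral_powR_01 e0) _; rewrite ltry.
  - by apply/measurable_EFinP; apply: measurable_funTS; exact: measurable_powR.
  - by move=> u _; rewrite lee_fin powR_ge0.
rewrite [X in (X < _)%E](_ : _ = \int[mu]_(u in `[1%R, +oo[)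
    (C%:E * (u `^ (- b - 1))%:E))%E; last first.
  apply: eq_integral.
  move=> u /set_mem/=; rewrite in_itv/= andbT => u1; rewrite -EFinM; congr EFin.
  have u0 : 0 < u by exact: lt_le_trans u1.
  by rewrite /m max_r ?invr1 ?sqrtr1 ?expr1n ?mulr1// invf_le1.
rewrite ge0_integralZl//.
- by rewrite integral_powR_tail// -EFinM ltry.
- by apply/measurable_EFinP; apply: measurable_funTS; exact: measurable_powR.
- by move=> u _; rewrite lee_fin powR_ge0.
Qed.

(** Outside the unit ball the kernel is at most 1, and the volume of the ball is finite. *)
Lemma riesz_kernel_ball_lty (L : R) :
  (\int[lam]_z ((dotv z z <= L)%R%:R * riesz_kernel t z)%:E < +oo)%E.
Proof.
have mk := measurable_riesz_kernel t.
apply: (@le_lt_trans _ _ (\int[lam]_z (((dotv z z <= 1)%R%:R * riesz_kernel t z)%:E +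
    ((dotv z z <= L)%R%:R)%:E))%E).
  apply: ge0_le_integral => //.
  - by move=> z _; rewrite lee_fin mulr_ge0 ?riesz_kernel_ge0.
  - by apply/measurable_EFinP; apply: measurable_funM => //; exact: measurable_ball_indic.
  - apply: emeasurable_funD; apply/measurable_EFinP; last exact: measurable_ball_indic.
    by apply: measurable_funM => //; exact: measurable_ball_indic.
  - move=> z _; rewrite -EFinD lee_fin.
    have k0 := riesz_kernel_ge0 t z.
    case: (leP (dotv z z) 1) => h1; case: (leP (dotv z z) L) => hL; rewrite ?mul1r ?mul0r ?addr0 ?add0r//.
      by rewrite lerDl.
    rewrite riesz_kernelE powRN invf_le1 ?powR_gt0 ?(lt_trans _ h1)//.
    by rewrite -[X in X <= _](powRr0 (dotv z z)) ler_powR ?(ltW h1)// ltW.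
rewrite ge0_integralD//.
- by rewrite lte_add_pinfty ?riesz_kernel_near_lty ?ball_volume_lty.
- by move=> z _; rewrite lee_fin mulr_ge0 ?riesz_kernel_ge0.
- by apply/measurable_EFinP; apply: measurable_funM => //; exact: measurable_ball_indic.
- by apply/measurable_EFinP; exact: measurable_ball_indic.
Qed.

Lemma riesz_kernel_pair_lty (L : R) :
  (\int[lam]_y \int[lam]_x ((dotv x x <= L)%R%:R * (dotv y y <= L)%R%:R *
     riesz_kernel t (x - y)%R)%:E < +oo)%E.
Proof.
(* |x|^2 <= L and |y|^2 <= L give |x - y|^2 <= 4 L, so at fixed [y] the inner integral is at most a
   translate of [I]. *)
pose I := (\int[lam]_z ((dotv z z <= 4 * L)%R%:R * riesz_kernel t z)%:E)%E.
have I0 : (0 <= I)%E.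
  by apply: integral_ge0 => z _; rewrite lee_fin mulr_ge0 ?riesz_kernel_ge0.
have Ifin : I \is a fin_num by rewrite ge0_fin_numE// riesz_kernel_ball_lty.
have mk := measurable_riesz_kernel t.
have mI : measurable_fun setT (fun z : 'cV[R]_d =>
    ((dotv z z <= 4 * L)%R%:R * riesz_kernel t z)%:E).
  by apply/measurable_EFinP; apply: measurable_funM => //; exact: measurable_ball_indic.
have mB := measurable_ball_indic L.
pose H (z : 'cV[R]_d * 'cV[R]_d) : \bar R := ((dotv z.1 z.1 <= L)%R%:R *
  (dotv z.2 z.2 <= L)%R%:R * riesz_kernel t (z.1 - z.2))%:E.
have mH : measurable_fun setT H.
  apply/measurable_EFinP; apply: measurable_funM.
    apply: measurable_funM; first exact: (measurableT_comp mB measurable_fst).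
    exact: (measurableT_comp mB measurable_snd).
  apply: (measurableT_comp mk); apply: measurable_cVB.
    exact: measurable_fst.
  exact: measurable_snd.
have H0 z : (0 <= H z)%E by rewrite lee_fin mulr_ge0 ?riesz_kernel_ge0.
have my (y : 'cV[R]_d) : measurable_fun setT (fun x : 'cV[R]_d => x - y).
  by apply: measurable_cVB => //; exact: measurable_cst.
have mIy (y : 'cV[R]_d) : measurable_fun setT (fun x : 'cV[R]_d =>
    ((dotv (x - y) (x - y) <= 4 * L)%R%:R * riesz_kernel t (x - y))%:E).
  exact: (measurableT_comp mI (my y)).
have Iy0 (x y : 'cV[R]_d) :
    (0 <= ((dotv (x - y)%R (x - y)%R <= 4 * L)%R%:R * riesz_kernel t (x - y)%R)%:E)%E.
  by rewrite lee_fin mulr_ge0 ?riesz_kernel_ge0.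
have IE (y : 'cV[R]_d) : (I = \int[lam]_x
    ((dotv (x - y)%R (x - y)%R <= 4 * L)%R%:R * riesz_kernel t (x - y)%R)%:E)%E.
  apply/esym; apply: (ge0_integral_translate (- y) mI) => z.
  by rewrite lee_fin mulr_ge0 ?riesz_kernel_ge0.
have inner y : (\int[lam]_x H (x, y) <= ((dotv y y <= L)%R%:R)%:E * I)%E.
  rewrite (IE y) -(ge0_integralZl lam measurableT (mIy y)); last 2 first.
  - by move=> x _; exact: Iy0.
  - by rewrite lee_fin.
  apply: ge0_le_integral; first exact: measurableT.
  - by move=> x _; exact: (H0 (x, y)).
  - exact: (measurableT_comp mH (pair2_measurable y)).
  - by apply: measurable_funeM; exact: mIy.
  - move=> x _; rewrite -EFinM lee_fin mulrA ler_wpM2r ?riesz_kernel_ge0//.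
    have := dotv_parallelogram x (- y); rewrite [dotv (- y) (- y)]dotvNl dotvC dotvNl opprK.
    case: (leP (dotv x x) L) => xL; case: (leP (dotv y y) L) => yL; rewrite ?mul1r ?mul0r//.
    by move=> h; rewrite (_ : dotv _ _ <= _)//; lra.
apply: (@le_lt_trans _ _ (\int[lam]_y (((dotv y y <= L)%R%:R)%:E * I))%E).
  apply: ge0_le_integral; first exact: measurableT.
  - by move=> y _; apply: integral_ge0 => x _; exact: (H0 (x, y)).
  - exact: (measurable_fun_fubini_tonelli_G H).
  - by apply: emeasurable_funM; [exact/measurable_EFinP|exact: measurable_cst].
  - by move=> y _; exact: inner.
rewrite ge0_integralZr//; last exact/measurable_EFinP.
by rewrite muleC lte_mul_pinfty// ball_volume_lty.
Qed.

End riesz_kernel.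

(** * Convergence of the Riemann sums *)

Section riemann_sums.
Context {R : realType} {d : nat}.
Hypothesis d_gt0 : (0 < d)%N.
Variables (A : 'M[R]_d) (Au : A \in unitmx).
Variables (D : set 'cV[R]_d) (openD : open D) (boundedD : bounded_set D).
Hypothesis boundaryD : lebesgue_cV (closure D `\` D°) = 0%E.
Variables (t : R) (t_gt0 : 0 < t) (t_ltd : t < d%:R).

Local Notation Bd := (invmx A^T).
Local Notation nu := (dual_measure A).
Local Notation lam := (@lebesgue_cV R d).

Let Bdu : Bd \in unitmx. Proof. by rewrite unitmx_inv unitmx_tr. Qed.

(** The scale N^(1/d) at N = n + 1; starting at 1 keeps it at least 1, so rounding errors are
    bounded uniformly in [n]. *)
Let c (n : nat) : R := n.+1%:R `^ d%:R^-1.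

Let c_gt0 n : 0 < c n.
Proof. by rewrite powR_gt0. Qed.

Let c_ge1 n : 1 <= c n.
Proof. by rewrite -[X in X <= _](powRr0 n.+1%:R) ler_powR ?ler1n. Qed.

Let c_exp n : c n ^+ d = n.+1%:R.
Proof. by rewrite -powR_mulrn ?powR_ge0// -powRrM mulVf ?powRr1// pnatr_eq0 -lt0n. Qed.

Let c_cvg : c n @[n --> \oo] --> +oo.
Proof.
have h : (n.+1%:R : R) @[n --> \oo] --> +oo.
  by rewrite -gtr0_cvgV0; [exact: cvg_harmonic|exact: nearW].
have d0 : 0 < d%:R^-1 :> R by rewrite invr_gt0 ltr0n.
rewrite -gtr0_cvgV0; last exact: nearW.
have := @cvg_comp _ _ _ (fun n => n.+1%:R : R) _ _ _ _ h (powR_cvgy d0).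
by apply: cvg_trans; apply: near_eq_cvg; apply: nearW => n /=; rewrite powRN.
Qed.

Let p n y : 'cV[R]_d := grid_floor Bd (c n) y.

Let mp n : measurable_fun setT (p n).
Proof. exact: measurable_grid_floor. Qed.

Let mD : measurable D. Proof. exact: open_measurable_cV Bdu _ openD. Qed.

Let mI : measurable_fun setT (\1_D : 'cV[R]_d -> R).
Proof. exact: measurable_indic. Qed.

Let k := @riesz_kernel R d t.

Let k_ge0 z : 0 <= k z. Proof. exact: riesz_kernel_ge0. Qed.

(** A dual vector is a frequency exactly when, scaled down by [c n], it lies in [D]; the factor N is
    c^d. *)
Lemma sum_freq_grid n (F : 'cV[R]_d -> R) : (forall w, 0 <= F w) ->
  ((\sum_(w <- freq A D n.+1) F w)%:E =
   n.+1%:R%:E * \int[nu]_y (\1_D (p n y) * F (c n *: p n y))%:E)%E.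
Proof.
move=> F0; transitivity (\esum_(w in freq_set A D n.+1) (F w)%:E)%E.
  have ff := finite_freq_set Au boundedD n.+1.
  rewrite esum_fset//; last by move=> w _; rewrite lee_fin.
  by rewrite fsbig_finite// sumEFin.
rewrite /freq_set esum_mkcondr dual_latticeE//.
rewrite (esum_dual_grid Au (c_gt0 n)); last by move=> w; case: ifP => // _; rewrite lee_fin.
rewrite c_exp; congr (_ * _)%E; apply: eq_integral => y _.
rewrite indicE -/(p n y); have [Dy|nDy] := boolP (p n y \in D).
  by rewrite mul1r ifT// mem_set//; exists (p n y) => //; exact/set_mem.
rewrite mul0r ifF//; apply/negbTE; apply: contra nDy => /set_mem[x Dx].
by move/(scalerI (lt0r_neq0 (c_gt0 n))) => <-; exact: mem_set.
Qed.

Lemma npoints_grid n :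
  ((npoints A D n.+1)%:R%:E = n.+1%:R%:E * \int[nu]_y (\1_D (p n y))%:E)%E.
Proof.
have := sum_freq_grid n (F := fun=> 1) (fun=> ler01).
rewrite -[X in X = _ -> _](congr1 EFin (natr_sum _ _ predT (fun=> 1%N))) sum1_size.
rewrite -(npointsE Au boundedD) => ->.
by congr (_ * _)%E; apply: eq_integral => y _; rewrite mulr1.
Qed.

Definition pair_sum N : R :=
  \sum_(w <- freq A D N) \sum_(w' <- freq A D N) (enorm (w - w') `^ t)^-1.

Let G (q : 'cV[R]_d -> 'cV[R]_d) (z : 'cV[R]_d * 'cV[R]_d) : R :=
  \1_D (q z.1) * \1_D (q z.2) * k (q z.1 - q z.2).

Let G_ge0 q z : 0 <= G q z.
Proof. by rewrite !mulr_ge0. Qed.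

Let measurable_G q : measurable_fun setT q -> measurable_fun setT (EFin \o G q).
Proof.
move=> mq; have m1 : measurable_fun setT (fun x => \1_D (q x) : R).
  exact: (measurableT_comp mI mq).
apply/measurable_EFinP; apply: measurable_funM.
  apply: measurable_funM; first exact: (measurableT_comp m1 measurable_fst).
  exact: (measurableT_comp m1 measurable_snd).
apply: (measurableT_comp (measurable_riesz_kernel t)); apply: measurable_cVB.
  exact: (measurableT_comp mq measurable_fst).
exact: (measurableT_comp mq measurable_snd).
Qed.

Lemma riesz_kernelZ a z : 0 < a -> k (a *: z) = (a `^ t)^-1 * k z.
Proof.
move=> a0; rewrite /k /riesz_kernel enormZ gtr0_norm// powRM ?enorm_ge0 ?(ltW a0)//.
by rewrite invfM.
Qed.

(** Each of the two sums gives one factor N, and the homogeneity of the kernel gives (c n)^(-t). *)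
Lemma pair_sum_grid n :
  ((pair_sum n.+1)%:E = (n.+1%:R ^+ 2 * (c n `^ t)^-1)%:E *
    \int[(nu \x nu)%E]_z (G (p n) z)%:E)%E.
Proof.
pose N : R := n.+1%:R.
rewrite (fubini_tonelli1 (EFin \o G (p n)))//; last 2 first.
- exact: measurable_G.
- by move=> z; rewrite lee_fin.
rewrite /pair_sum sum_freq_grid; last by move=> w; apply: sumr_ge0 => w' _; exact: k_ge0.
rewrite -/N.
have mp1 : measurable_fun setT (fun x => \1_D (p n x) : R).
  exact: (measurableT_comp mI (mp n)).
have inner x : ((\1_D (p n x) * \sum_(w' <- freq A D n.+1) (enorm (c n *: p n x - w') `^ t)^-1)%:E
    = (N * (c n `^ t)^-1)%:E * fubini_F nu (EFin \o G (p n)) x)%E.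
  have E0 : ((\sum_(w' <- freq A D n.+1) (enorm (c n *: p n x - w') `^ t)^-1)%:E =
      N%:E * \int[nu]_y (\1_D (p n y) * k (c n *: p n x - c n *: p n y)%R)%:E)%E.
    exact: (sum_freq_grid n (F := fun w' => k (c n *: p n x - w')) (fun w => k_ge0 _)).
  pose h y := \1_D (p n y) * k (p n x - p n y).
  have h0 y : (0 <= (h y)%:E)%E by rewrite lee_fin mulr_ge0.
  have mh : measurable_fun setT (EFin \o h).
    apply/measurable_EFinP; apply: measurable_funM => //.
    apply: (measurableT_comp (measurable_riesz_kernel t)); apply: measurable_cVB => //.
  have E1 : (\int[nu]_y (\1_D (p n y) * k (c n *: p n x - c n *: p n y)%R)%:E
      = ((c n `^ t)^-1)%:E * \int[nu]_y (h y)%:E)%E.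
    rewrite -(ge0_integralZl nu measurableT mh); last 2 first.
    - by move=> y _; exact: h0.
    - by rewrite lee_fin invr_ge0 powR_ge0.
    apply: eq_integral => y _; rewrite -EFinM -scalerBr.
    by rewrite riesz_kernelZ// mulrCA.
  have E2 : (\int[nu]_y (EFin \o G (p n)) (x, y) = (\1_D (p n x))%:E * \int[nu]_y (h y)%:E)%E.
    rewrite -(ge0_integralZl nu measurableT mh); last 2 first.
    - by move=> y _; exact: h0.
    - by rewrite lee_fin.
    by apply: eq_integral => y _; rewrite -EFinM /G/= /h mulrA.
  rewrite EFinM E0 E1 /fubini_F E2 EFinM -!muleA [LHS]muleCA; congr (_ * _)%E.
  by rewrite [LHS]muleCA.
under eq_integral => x _ do rewrite inner.
rewrite ge0_integralZl//; last 3 first.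
- by apply: measurable_fun_fubini_tonelli_F; [exact: measurable_G|move=> z; rewrite lee_fin].
- by move=> x _; apply: integral_ge0 => y _; rewrite lee_fin.
- by rewrite lee_fin mulr_ge0 ?invr_ge0 ?powR_ge0// ler0n.
by rewrite muleA -EFinM mulrA -expr2.
Qed.

Let bad := closure D `\` D°.

Let measurable_bad : measurable bad.
Proof.
apply: measurableD.
  rewrite -[closure D]setCK; apply: measurableC; apply: (open_measurable_cV Bdu).
  exact/closed_openC/closed_closure.
by apply: (open_measurable_cV Bdu); exact: open_interior.
Qed.

Let nu_bad : nu bad = 0%E.
Proof. by rewrite dual_measureE// boundaryD mule0. Qed.

(** Off the boundary, [y] has a neighbourhood inside [D] or outside its closure, which the rounded
    points eventually enter. *)
Let indic_cvg (y : 'cV[R]_d) : ~ bad y -> \forall n \near \oo, \1_D (p n y) = \1_D y :> R.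
Proof.
have py : p n y @[n --> \oo] --> y by exact: (grid_floor_cvg Bdu c_gt0 c_cvg).
move=> nbad; have [Dy|nDy] := pselect (D y).
  have : nbhs y D by exact: open_nbhs_nbhs.
  move=> /py [N _ Dp]; exists N => // n /Dp Dpn.
  by rewrite /= !indicE !mem_set.
have ncD : (~` closure D) y.
  by move=> cD; apply: nbad; split => // /interior_subset.
have : nbhs y (~` closure D).
  by apply: open_nbhs_nbhs; split => //; exact/closed_openC/closed_closure.
move=> /py [N _ Dp]; exists N => // n /Dp nDp.
rewrite /= !indicE !memNset//.
by move=> Dpn; apply: nDp; exact: subset_closure.
Qed.

Let grid_bounded : exists2 L : R, 0 < L & forall n y, D (p n y) -> dotv y y <= L.
Proof.
have [M M0 DM] := bounded_dotv boundedD.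
have [C C0 hC] := grid_floor_dist Bdu.
exists (2 * M + 2 * C); first by rewrite addr_gt0// mulr_gt0.
move=> n y /DM pM; have := dotv_parallelogram (p n y) (y - p n y).
rewrite [p n y + _]addrC subrK => /le_trans; apply.
apply: lerD; rewrite ler_pM2l//; apply: (le_trans (hC _ _ (c_gt0 n))).
by rewrite ler_pdivrMr ?exprn_gt0// ler_peMr ?(ltW C0)// expr_ge1 ?(ltW (c_gt0 n)).
Qed.

Let nuT_gt0 : 0 < covolume A.
Proof. by rewrite normr_gt0 -unitfE -unitmxE. Qed.

Lemma npoints_cvg : (\int[nu]_y (\1_D (p n y))%:E)%E @[n --> \oo] --> nu D.
Proof.
have [L L0 hL] := grid_bounded.
pose g (y : 'cV[R]_d) : \bar R := ((dotv y y <= L)%R%:R)%:E.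
have mg : measurable_fun setT g by apply/measurable_EFinP; exact: measurable_ball_indic.
have ig : nu.-integrable setT g.
  apply/integrableP; split => //; under eq_integral do rewrite gee0_abs ?lee_fin//.
  rewrite ge0_integral_dual_measure//; last by move=> x; rewrite lee_fin.
  by rewrite lte_mul_pinfty ?lee_fin ?(ltW nuT_gt0)// ball_volume_lty.
have [||||_ _] := @dominated_convergence _ _ _ nu setT measurableT
  (fun n y => (\1_D (p n y))%:E) (fun y => (\1_D y)%:E) g _ _ _ ig _.
- move=> n; apply/measurable_EFinP; exact: (measurableT_comp mI (mp n)).
- exact/measurable_EFinP.
- exists bad; split => // y /= h; apply: contrapT => nb; apply: h => _.
  apply: cvg_near_cst; apply: filterS (indic_cvg nb) => n ->//.
- apply: aeW => y n _; rewrite gee0_abs ?lee_fin// indicE.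
  case: (boolP (p n y \in D)) => // /set_mem /hL h; by rewrite /g h.
by rewrite integral_indic// setIT.
Qed.

Let k_cvg x y : k (p n x - p n y) @[n --> \oo] --> k (x - y).
Proof.
(* On the diagonal the rounded points coincide too, so the sequence is constant despite the
   singularity of [k]. *)
have [->|xy] := eqVneq x y.
  by under eq_fun do rewrite subrr; rewrite subrr; exact: cvg_cst.
have [e e0 he] := grid_floor_norm Bdu c_gt0 c_cvg.
have coor z i : p n z i 0 @[n --> \oo] --> z i 0.
  apply/cvgrPdist_le => eps eps0; near=> n.
  have := coor_le_norm (z - p n z) i; rewrite !mxE => /le_trans; apply.
  apply: (le_trans (he n z)); near: n; have /cvgrPdist_le/(_ _ eps0) := e0.
  by apply: filterS => n; rewrite sub0r normrN; apply: le_trans; exact: ler_norm.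
have dcvg : dotv (p n x - p n y) (p n x - p n y) @[n --> \oo] --> dotv (x - y) (x - y).
  rewrite /dotv; apply: cvg_big => [|i _]; first exact: add_continuous.
  have h : (p n x - p n y) i 0 @[n --> \oo] --> (x - y) i 0.
    have E (a b : 'cV[R]_d) : (a - b) i 0 = a i 0 - b i 0 by rewrite !mxE.
    by under eq_fun do rewrite E; rewrite E; apply: cvgB; exact: coor.
  exact: cvgM.
have q0 : 0 < dotv (x - y) (x - y).
  by rewrite lt_neqAle dotv_ge0 eq_sym dotv_eq0 subr_eq0 xy.
rewrite /k riesz_kernelE; under eq_fun do rewrite riesz_kernelE.
exact: (@cvg_comp _ _ _ _ (fun q : R => q `^ (- (t / 2))) _ _ _ dcvg (continuous_powR_gt0 q0)).
Unshelve. all: by end_near. Qed.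

(* If p n x != p n y, the squared rounding errors are at most a multiple of the
   squared mesh, hence of the squared distance between p n x and p n y. *)
Let k_dominated : exists2 C : R, 0 <= C & forall n x y,
  k (p n x - p n y) <= C * k (x - y).
Proof.
have [C C0 hC] := grid_floor_dist Bdu.
have [m m0 hm] := lattice_min_norm Bdu.
(* The parallelogram inequality, used twice, bounds |x - y|^2 by twice the rounded squared distance
   plus 8 C / c^2, and c^(-2) is at most the rounded squared distance over [m]. *)
pose K := 2 + 8 * C / m; have K0 : 0 < K by rewrite addr_gt0// divr_gt0// mulr_gt0.
have KE q : K * q = 2 * q + 8 * (C / m * q) by rewrite /K; ring.
have bound (a b e f g q q' : R) : e <= f -> b <= e -> a <= e ->
  g <= 2 * a + 2 * b -> q <= 2 * q' + 2 * g -> q <= 2 * q' + 8 * f by lra.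
have invpow (a q q' : R) : 0 < a -> 0 < q' -> 0 < q -> q <= a * q' ->
    (q' `^ (t / 2))^-1 <= a `^ (t / 2) * (q `^ (t / 2))^-1.
  move=> a0 q'0 q0 h; rewrite ler_pdivlMr ?powR_gt0// ler_pdivrMl ?powR_gt0//.
  rewrite -powRM ?(ltW a0) ?(ltW q'0)// [q' * a]mulrC; apply: ge0_ler_powR.
  - by rewrite divr_ge0// ltW.
  - by rewrite nnegrE ltW.
  - by rewrite nnegrE mulr_ge0 ?ltW.
  - by [].
exists (K `^ (t / 2)); first exact: powR_ge0.
move=> n x y; rewrite /k !riesz_kernelE !powRN.
have a0 : t / 2 != 0 by rewrite gt_eqF// divr_gt0.
(* If both points round to the same grid point, the left side is the value 0 of the kernel at 0. *)
have := dotv_ge0 (p n x - p n y); rewrite le_eqVlt => /predU1P[<-|q0].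
  by rewrite powR0// invr0 mulr_ge0 ?invr_ge0 ?powR_ge0.
have xy : x - y != 0.
  move: (lt0r_neq0 q0); rewrite dotv_eq0; apply: contra_neq => /subr0_eq ->.
  exact: subrr.
have r0 : 0 < dotv (x - y) (x - y) by rewrite lt_neqAle dotv_ge0 eq_sym dotv_eq0 xy.
have c2 : 0 < c n ^+ 2 by rewrite exprn_gt0.
have cm : m <= c n ^+ 2 * dotv (p n x - p n y) (p n x - p n y).
  pose w := lattice_floor Bd (c n *: x) - lattice_floor Bd (c n *: y).
  have pw : p n x - p n y = (c n)^-1 *: w by rewrite /p /grid_floor -scalerBr.
  rewrite (_ : c n ^+ 2 * _ = dotv w w); last first.
    by rewrite pw dotvZl dotvC dotvZl; field; rewrite gt_eqF.
  apply: hm; last first.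
    by move: (lt0r_neq0 q0); rewrite dotv_eq0 pw; apply: contra_neq => ->; exact: scaler0.
  have /latticeP[z1 e1] := lattice_floorP Bd (c n *: x).
  have /latticeP[z2 e2] := lattice_floorP Bd (c n *: y).
  by apply/latticeP; exists (z1 - z2); rewrite /w e1 e2 ivecD ivecN mulmxBr.
have le : dotv (x - y) (x - y) <= K * dotv (p n x - p n y) (p n x - p n y).
  have h1 := dotv_parallelogram (p n x - p n y) ((x - p n x) - (y - p n y)).
  have E : p n x - p n y + (x - p n x - (y - p n y)) = x - y.
    by apply/matrixP => i j; rewrite !mxE; ring.
  rewrite E in h1.
  have h2 := dotv_parallelogram (x - p n x) (- (y - p n y)).
  rewrite [dotv (- (y - p n y)) _]dotvNl [dotv _ (- (y - p n y))]dotvC dotvNl opprK in h2.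
  have h3 : C / c n ^+ 2 <= C / m * dotv (p n x - p n y) (p n x - p n y).
    rewrite ler_pdivrMr//; move: cm; set q' := dotv _ _; set r := c n ^+ 2 => cm.
    have -> : C / m * q' * r = C * ((r * q') / m) by ring.
    by apply: ler_peMr; rewrite ?(ltW C0)// ler_pdivlMr// mul1r.
  rewrite KE; have hy := hC _ y (c_gt0 n); have hx := hC _ x (c_gt0 n).
  rewrite -/(p n x) -/(p n y) in hx hy.
  exact: (bound _ _ _ _ _ _ _ h3 hy hx h2 h1).
exact: (invpow _ _ _ K0 q0 r0 le).
Qed.

Let ae_bad : (nu \x nu)%E.-negligible [set z | bad z.1 \/ bad z.2].
Proof.
have n1 : (nu \x nu)%E.-negligible (bad `*` setT).
  exists (bad `*` setT); split => //; first exact: measurableX.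
  by rewrite [LHS]product_measure1E// [X in (X * _)%E]nu_bad mul0e.
have n2 : (nu \x nu)%E.-negligible (setT `*` bad).
  exists (setT `*` bad); split => //; first exact: measurableX.
  by rewrite [LHS]product_measure1E// [X in (_ * X)%E]nu_bad mule0.
apply: negligibleS (negligibleU n1 n2) => z /= [b|b]; [left|right]; by split.
Qed.

(** The majorant is the kernel times the constant of [k_dominated], cut off by the ball of
    [grid_bounded], the same for all [n]; it is integrable by [riesz_kernel_pair_lty]. *)
Lemma pair_cvg :
  (\int[(nu \x nu)%E]_z (G (p n) z)%:E)%E @[n --> \oo] --> (riesz_integral A D t)%:E.
Proof.
have [L L0 hL] := grid_bounded.
have [M M0 DM] := bounded_dotv boundedD.
have [C C0 hC] := k_dominated.
pose H (z : 'cV[R]_d * 'cV[R]_d) : \bar R := ((dotv z.1 z.1 <= L)%R%:R *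
  (dotv z.2 z.2 <= L)%R%:R * k (z.1 - z.2))%:E.
have mB := @measurable_ball_indic R d L.
have mH : measurable_fun setT H.
  apply/measurable_EFinP; apply: measurable_funM.
    apply: measurable_funM; first exact: (measurableT_comp mB measurable_fst).
    exact: (measurableT_comp mB measurable_snd).
  apply: (measurableT_comp (measurable_riesz_kernel t)); apply: measurable_cVB.
    exact: measurable_fst.
  exact: measurable_snd.
have H0 z : (0 <= H z)%E by rewrite lee_fin mulr_ge0.
have HH : (\int[(nu \x nu)%E]_z H z < +oo)%E.
  rewrite (fubini_tonelli2 H mH H0) /fubini_G.
  have inner y : (\int[nu]_x H (x, y) = (covolume A)%:E * \int[lam]_x H (x, y))%E.
    apply: (ge0_integral_dual_measure Au) => [|x]; last exact: H0.
    exact: (measurableT_comp mH (pair2_measurable y)).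
  have mHy : measurable_fun setT (fun y => \int[lam]_x H (x, y))%E.
    exact: (measurable_fun_fubini_tonelli_G H).
  have Hy0 y : (0 <= \int[lam]_x H (x, y))%E by apply: integral_ge0 => x _; exact: H0.
  under eq_integral do rewrite inner.
  rewrite (ge0_integral_dual_measure Au); last 2 first.
  - exact: measurable_funeM.
  - by move=> y; apply: mule_ge0; [rewrite lee_fin ltW|exact: Hy0].
  rewrite (ge0_integralZl lam measurableT mHy); last 2 first.
  - by move=> y _; exact: Hy0.
  - by rewrite lee_fin ltW.
  rewrite muleA -EFinM lte_mul_pinfty ?lee_fin ?mulr_ge0 ?(ltW nuT_gt0)//.
  exact: riesz_kernel_pair_lty.
pose g z : \bar R := (C%:E * H z)%E.
have g0 z : (0 <= g z)%E by apply: mule_ge0; [rewrite lee_fin|exact: H0].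
have ig : (nu \x nu)%E.-integrable setT g.
  apply/integrableP; split; first exact: measurable_funeM.
  under eq_integral do rewrite gee0_abs//.
  rewrite (ge0_integralZl (nu \x nu)%E measurableT mH) ?lee_fin//.
  by rewrite lte_mul_pinfty ?lee_fin.
have Gg n z : (`|(G (p n) z)%:E| <= g z)%E.
  rewrite gee0_abs; last by rewrite lee_fin.
  rewrite /g /H -EFinM lee_fin /G !indicE.
  case: (boolP (p n z.1 \in D)) => [/set_mem/hL h1|_]; last first.
    by rewrite !mul0r !mulr_ge0.
  case: (boolP (p n z.2 \in D)) => [/set_mem/hL h2|_]; last first.
    by rewrite mulr0 mul0r !mulr_ge0.
  by rewrite h1 h2 !mul1r; exact: (hC n z.1 z.2).
have [||||iG _ cG] := @dominated_convergence _ _ _ (nu \x nu)%E setT measurableT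
  (fun n z => (G (p n) z)%:E) (fun z => (G id z)%:E) g _ _ _ ig _.
- by move=> n; exact: measurable_G.
- by apply: measurable_G; exact: measurable_id.
- apply: negligibleS ae_bad => z /= h; apply: contrapT => /not_orP[b1 b2]; apply: h => _.
  have c1 : \1_D (p n z.1) @[n --> \oo] --> (\1_D z.1 : R).
    by apply: cvg_near_cst; apply: filterS (indic_cvg b1) => n ->.
  have c2 : \1_D (p n z.2) @[n --> \oo] --> (\1_D z.2 : R).
    by apply: cvg_near_cst; apply: filterS (indic_cvg b2) => n ->.
  have c3 : G (p n) z @[n --> \oo] --> G id z.
    by rewrite /G; apply: cvgM; [apply: cvgM; [exact: c1|exact: c2]|exact: k_cvg].
  by apply: cvg_EFin; [exact: nearW|exact: c3].
- by apply: aeW => z n _.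
suff -> : ((riesz_integral A D t)%:E = \int[(nu \x nu)%E]_z (G id z)%:E)%E by [].
rewrite /riesz_integral /Rintegral integral_mkcond.
have -> : (((fun z => ((enorm (z.1 - z.2) `^ t)^-1)%:E) \_ (D `*` D)) =
    (fun z => (G id z)%:E))%E.
  apply/funext => z; rewrite patchE /G/= !indicE in_setX.
  by case: (z.1 \in D); case: (z.2 \in D); rewrite /= ?mul0r ?mulr0 ?mul0r ?mul1r.
by rewrite fineK//; exact: integrable_fin_num.
Qed.

Lemma npoints_ratio_cvg : ((covolume A)%:E * lebesgue_cV D = 1)%E ->
  (npoints A D n.+1)%:R / n.+1%:R @[n --> \oo] --> (1 : R).
Proof.
move=> vol; have e n : ((npoints A D n.+1)%:R / n.+1%:R)%:E =
    (\int[nu]_y (\1_D (p n y))%:E)%E.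
  rewrite EFinM npoints_grid muleC muleA -EFinM mulVf ?mul1e//.
have := npoints_cvg; rewrite dual_measureE// vol.
under eq_cvg do rewrite -e.
by move/fine_cvgP => [_].
Qed.

Lemma pair_sum_cvg :
  pair_sum n.+1 / n.+1%:R `^ (2 - t / d%:R) @[n --> \oo] --> riesz_integral A D t.
Proof.
have N0 n : 0 < n.+1%:R :> R by [].
have K n : n.+1%:R ^+ 2 * (c n `^ t)^-1 = n.+1%:R `^ (2 - t / d%:R).
  rewrite /c -powRrM -powRN -powR_mulrn// -powRD ?(gt_eqF (N0 n)) ?implybT//.
  by congr (_ `^ (_ + - _)); rewrite mulrC.
have e n : (pair_sum n.+1 / n.+1%:R `^ (2 - t / d%:R))%:E =
    (\int[(nu \x nu)%E]_z (G (p n) z)%:E)%E.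
  rewrite EFinM pair_sum_grid K muleC muleA -EFinM mulVf ?mul1e//.
have := pair_cvg; under eq_cvg do rewrite -e.
by move/fine_cvgP => [_].
Qed.

End riemann_sums.

(** [b] is the common power of N. The shift by one keeps the case N = 0 out of the normalizations;
    it does not affect the limit. *)
Lemma littleo_shift (R : realType) (f g : nat -> R) (b u v : nat -> R) :
  (forall n, 0 < b n) ->
  (forall n, f n.+1 = b n * u n) -> (forall n, g n.+1 = b n * v n) ->
  u n @[n --> \oo] --> (0 : R) -> v n @[n --> \oo] --> (1 : R) ->
  f =o_\oo g.
Proof.
move=> b0 fE gE u0 v1; apply/eqoP => e e0.
(* Eventually |v| >= 1/2, so |u| <= e / 2 suffices. *)
have e2 : 0 < e / 2 by rewrite divr_gt0.
have h2 : 0 < 2^-1 :> R by rewrite invr_gt0.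
have /cvgrPdist_le/(_ _ e2)[n1 _ h1] := u0.
have /cvgrPdist_le/(_ _ h2)[n2 _ h3] := v1.
exists (maxn n1 n2).+1 => // -[//|n] /=; rewrite ltnS geq_max => /andP[/h1 + /h3].
rewrite /= sub0r normrN fE gE !normrM gtr0_norm// => un vn.
rewrite mulrCA ler_pM2l//; apply: (le_trans un); rewrite ler_pM2l//.
by have := ler_norm (v n); have := ler_norm (1 - v n); lra.
Qed.

Theorem proposition2 (R : realType) (d : nat) (d_gt0 : (0 < d)%N)
    (A : 'M[R]_d) (Au : A \in unitmx)
    (D : set 'cV[R]_d) (openD : open D) (boundedD : bounded_set D)
    (boundaryD : lebesgue_cV (closure D `\` D°) = 0%E)
    (volumeD : ((covolume A)%:E * lebesgue_cV D = 1)%E)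
    (disp : nat -> measure_display)
    (T : forall N : nat, measurableType (disp N))
    (P : forall N : nat, probability (T N) R)
    (omega : forall N : nat, {RV (P N) >-> (npoints A D N).-tuple 'cV[R]_d})
    (omega_domain : forall N (u : T N) (k : 'I_(npoints A D N)),
      fundamental_domain A (tnth (omega N u) k))
    (omega_determinantal : forall N : nat,
      determinantal (omega N) (torus_measure Au) (lattice_kernel A D N))
    (s : R) (s_gt0 : 0 < s) (s_ltd : s < d%:R) :
  let t (N : nat) : R := (npoints A D N)%:R in
  let EE (N : nat) : \bar R := (\int[P N]_u riesz_energy A s (omega N u))%E in
  (forall N : nat, EE N \is a fin_num) /\
  (fun N : nat => fine (EE N) -
     (2 * pi `^ (d%:R / 2) * (covolume A)^-1 / (Gamma (s / 2) * (d%:R - s))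
        * t N ^+ 2
      - pi `^ (s - d%:R / 2) * Gamma ((d%:R - s) / 2)
          / (Gamma (s / 2) * covolume A)
        * riesz_integral A D (d%:R - s) * t N `^ (1 + s / d%:R)))
    =o_\oo (fun N : nat => t N `^ (1 + s / d%:R)).

Proof.
move=> t EE.
have dR : 0 < d%:R :> R by rewrite ltr0n.
pose tau := d%:R - s; have tau0 : 0 < tau by rewrite subr_gt0.
have taud : tau < d%:R by rewrite /tau; lra.
pose beta := 1 + s / d%:R.
(* The growth exponent of the pair sums is that of the second term of the expansion. *)
have betaE : 2 - tau / d%:R = beta by rewrite /tau /beta; field; rewrite gt_eqF.
pose c0 := 2 * pi `^ (d%:R / 2) * (covolume A)^-1 / (Gamma (s / 2) * (d%:R - s)).
pose C := pi `^ (s - d%:R / 2) * Gamma ((d%:R - s) / 2) / (Gamma (s / 2) * covolume A).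
have EEE N : EE N = (c0 * (t N ^+ 2 - t N) - C * pair_sum A D tau N)%:E.
  exact: (expected_riesz_energy boundedD (omega_determinantal N) s_gt0 s_ltd).
split=> [N|]; first by rewrite EEE.
pose I := riesz_integral A D tau.
have r1 := npoints_ratio_cvg d_gt0 Au openD boundedD boundaryD volumeD.
have uI := pair_sum_cvg d_gt0 Au openD boundedD boundaryD tau0 taud.
rewrite betaE -/I in uI.
pose r n : R := t n.+1 / n.+1%:R.
have r0 n : 0 <= r n by rewrite divr_ge0.
have N0 n : 0 < n.+1%:R :> R by [].
have rb : r n `^ beta @[n --> \oo] --> (1 : R).
  have := @cvg_comp _ _ _ _ (fun q : R => q `^ beta) _ _ _ r1 (continuous_powR_gt0 ltr01).
  by rewrite powR1.
have tE n : t n.+1 = r n * n.+1%:R by rewrite /r mulfVK.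
have tb n : t n.+1 `^ beta = n.+1%:R `^ beta * r n `^ beta.
  by rewrite tE powRM ?(ltW (N0 n))// mulrC.
(* Divided by N^beta, the error consists of the leftover linear term c0 t_N, of order N^(-s/d)
   because N = N^beta N^(-s/d), and of the difference between the normalized pair sum and I r^beta,
   both of which tend to I. *)
apply: (@littleo_shift _ _ _ (fun n => n.+1%:R `^ beta)
  (fun n => - (c0 * (r n * n.+1%:R `^ (- (s / d%:R)))) -
    C * (pair_sum A D tau n.+1 / n.+1%:R `^ beta - I * r n `^ beta))
  (fun n => r n `^ beta)) => //.
  move=> n; rewrite EEE /= -/c0 -/C -/tau -/I -/beta tb.
  have NN : n.+1%:R `^ beta * n.+1%:R `^ (- (s / d%:R)) = n.+1%:R :> R.
    by rewrite -powRD ?(gt_eqF (N0 n)) ?implybT// /beta addrK powRr1// ltW.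
  have X0 : n.+1%:R `^ beta != 0 :> R by rewrite gt_eqF// powR_gt0.
  have : t n.+1 = r n * (n.+1%:R `^ beta * n.+1%:R `^ (- (s / d%:R))) by rewrite NN -tE.
  move: X0 {tE tb NN}; move: (t n.+1) (n.+1%:R `^ beta) (n.+1%:R `^ - _) => tn X Y X0 ->.
  by field.
have hN : (n.+1%:R : R) @[n --> \oo] --> +oo.
  by rewrite -gtr0_cvgV0; [exact: cvg_harmonic|exact: nearW].
have sd0 : 0 < s / d%:R by rewrite divr_gt0.
have hp : n.+1%:R `^ (- (s / d%:R)) @[n --> \oo] --> (0 : R).
  exact: (@cvg_comp _ _ _ (fun n => n.+1%:R : R) (fun q : R => q `^ _) _ _ _ hN (powR_cvgy sd0)).
have -> : 0 = - (c0 * (1 * 0)) - C * (I - I * 1) :> R by ring.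
apply: cvgB.
  by apply: cvgN; apply: cvgM; [exact: cvg_cst|apply: cvgM; [exact: r1|exact: hp]].
apply: cvgM; first exact: cvg_cst.
by apply: cvgB; [exact: uI|apply: cvgM; [exact: cvg_cst|exact: rb]].
Qed.
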